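(* Let the static kernel $g$ satisfy Assumption G and let the kernels $k,\ell$ satisfy Assumption F (both stated in the context). Let $$\mathcal N=\{(n_1,n_2,n_3)\in\mathbb N_0^3:\ n_1\le 1,\ n_2=n_3=0,\ \text{ or }\ n_1=0,\ n_2+n_3\le 2\},$$ with directions of pathwise differentiation $\eta,\bar\eta\in \mathrm{BV}_0$, and assume that either one of the following conditions holds: (i) the family $(u_{m,n})_{m,n\in\mathbb N}$ of minimisers of the optimal recovery problems is relatively compact in $\mathcal C^{\mathcal N}(\mathcal X)$, and there exists a unique solution $u^\star$ to the target PPDE in $\mathcal C^{\mathcal N}(\mathcal X)$; (ii) there exists a unique solution $u^\star$ to the target PPDE in $\mathcal H$. If, moreover, as $m$ and $n$ tend to infinity, the collocation points $(\omega^i)_{i=1}^m$ and $(\omega^i)_{i=m+1}^{m+n}$ form a dense family of $\mathcal X^\circ$ and of $\partial\mathcal X$ respectively, then $(u_{m,n})_{m,n\in\mathbb N}$ converges towards $u^\star$ in the $\mathcal C^{\mathcal N}$-topology (i.e. in the norm $\|\cdot\|_{\mathcal N}$) as $m,n$ tend to $+\infty$.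
   Context: **Path spaces.** Fix $T>0$, $\mathbb T=[0,T]$, $d,e\in\mathbb N_0$, $p>1$, $\alpha\in(0,1)$. For $q\ge1$ and $\gamma:[t,t']\to\mathbb R^e$, $|\gamma|_{q\text{-var};[t,t']}=\big(\sup\sum_i|\gamma_{t_{i+1}}-\gamma_{t_i}|^q\big)^{1/q}$ (sup over partitions of $[t,t']$) and $\|\gamma\|_{q\text{-var};[t,t']}=|\gamma_t|+|\gamma|_{q\text{-var};[t,t']}$; $\|\gamma\|_0$ denotes the supremum norm. $\mathrm{BV}_t=\mathrm{BV}([t,T],\mathbb R^e)$ is the set of continuous paths $[t,T]\to\mathbb R^e$ of finite 1-variation with one strictly monotone coordinate; this coordinate is denoted $\gamma^0$ and the remaining $\mathbb R^{e-1}$-valued path $\check\gamma$. Let $$\Omega=\{(t,x,\gamma)\in\mathbb T\times\mathbb R^d\times \mathrm{BV}_0:\ \check\gamma_s=\check\gamma_0\ \text{for all } s\le t\},$$ with distance $\boldsymbol d((t,x,\gamma),(\bar t,\bar x,\bar\gamma))=|t-\bar t|+|x-\bar x|+\|\gamma-\bar\gamma\|_{p\text{-var};\mathbb T}$. **Compact domain.** $\mathcal X$ is a fixed compact subset of $(\Omega,\boldsymbol d)$ on which the 1-variation norms of the paths are bounded by some $R>0$; typically $\mathcal X=\{(t,x,\gamma)\in\mathbb T\times\prod_{i=1}^d[a_i,b_i]\times \mathrm{BV}_0:\gamma\in B_t(R)\}$, where $B_t(R)$ is the set of $\gamma\in\mathrm{BV}_0$ with $\check\gamma_s=\check\gamma_0$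 for $s\le t$ and whose 1-variation plus $\alpha$-Hölder norm is at most $R$. $\mathcal X^\circ$ is the set of $(t,x,\gamma)\in\mathcal X$ with $t<T$, and $\partial\mathcal X$ the set of those with $t=T$ (terminal condition). **Derivatives.** $\partial_t u$ is the right time derivative, with the convention $\partial_tu(T,x,\gamma)=0$; $\partial_x$ is the usual spatial derivative. Only functionals depending on the path through $[t,T]$ are considered: $u(t,x,\gamma)=u_{t,x}(\gamma^0|_{[t,T]},\check\gamma|_{[t,T]})$. The (Gateaux) pathwise derivative in direction $\eta\in \mathrm{BV}_0$ is $$\widehat\partial^{\eta}_\gamma u(t,x,\gamma)=\lim_{\varepsilon\to0}\frac{u_{t,x}(\gamma^0|_{[t,T]},(\check\gamma+\varepsilon\check\eta)|_{[t,T]})-u_{t,x}(\gamma^0|_{[t,T]},\check\gamma|_{[t,T]})}{\varepsilon},$$ and $\widehat\partial^{\eta\bar\eta}_\gamma$ is the iterated derivative. The Fréchet pathwise derivative $\widetilde\partial^\eta_\gamma u$ is the linear operator in $\eta$ defined by $u(t,x,\gamma+\eta\mathbf 1_{[t,T]})-u(t,x,\gamma)=\widetilde\partial^\eta_\gamma u(t,x,\gamma)+o(\|\eta\mathbf 1_{[t,T]}\|_0)$ (second order analogously); when it exists it coincides with the Gateaux derivative in the same direction. Elements of $\mathcal H$ are differentiated using that the kernel $\kappa$ below is defined on all of $\mathbb T\times\mathbb R^d\times\mathrm{BV}_0$. $\mathcal C^{\mathcal N}(\mathcal X)$ is the space of functionals whose derivatives $\partial_t^{n_1}\partial_x^{n_2}\widehat\partial_\gamma^{\boldsymbol\eta}$,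 $(n_1,n_2,n_3)\in\mathcal N$, $\boldsymbol\eta\in(\mathrm{BV}_0)^{n_3}$, exist and are continuous on $\mathcal X$, with norm $$\|h\|_{\mathcal N}=\sum_{\partial\in\mathscr D}\sup\{|\partial h(\omega)|:\omega\in\mathcal X,\ \eta,\bar\eta\in \mathrm{BV}_0,\ \|\eta\|_{1\text{-var};\mathbb T}\vee\|\bar\eta\|_{1\text{-var};\mathbb T}\le1\},$$ $\mathscr D=\{\mathrm{id},\partial_t,\partial_x,\partial_x^2,\widehat\partial^\eta_\gamma\partial_x,\widehat\partial^\eta_\gamma,\widehat\partial^{\eta\bar\eta}_\gamma\}$. **Target PPDE.** For measurable real functions $f,\phi$ and constants $a_n\in\mathbb R$ and fixed directions $\boldsymbol\eta\in(\mathrm{BV}_0)^{n_3}$ ($n\in\mathcal N$), it is $$\widetilde{\mathcal L}_tu(t,x,\gamma)=f(t,x,\gamma),\quad u(T,x,\gamma)=\phi(T,x,\gamma),\qquad \widetilde{\mathcal L}_t=\sum_{n\in\mathcal N}a_n\partial_t^{n_1}\partial_x^{n_2}\widetilde\partial_\gamma^{\boldsymbol\eta}.$$ $\mathcal L_t=\sum_{n\in\mathcal N}a_n\partial_t^{n_1}\partial_x^{n_2}\widehat\partial_\gamma^{\boldsymbol\eta}$ is its Gateaux analogue. Solutions in $\mathcal C^{\mathcal N}(\mathcal X)$ or $\mathcal H$ are required to satisfy the equation at points of $\mathcal X$. **Signature kernels.** For a Hilbert space $V$, $\overline{T(V)}$ is the Hilbert space completion of the algebraic direct sum $\bigoplus_{n\ge0}V^{\otimes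 n}$ with inner product $\sum_n\langle a_n,b_n\rangle_{V^{\otimes n}}$. The signature $S(\gamma)_{t,t'}\in\overline{T(V)}$ of a continuous bounded variation path is the sequence of its iterated Riemann–Stieltjes integrals over $t<t_1<\dots<t_m<t'$, with zeroth term 1. Let $g:\mathbb R^e\times\mathbb R^e\to\mathbb R$ be a kernel with RKHS $\mathcal H_g$ and Lipschitz feature map $v\mapsto g(v,\cdot)$, and $\gamma^g_u=g(\gamma_u,\cdot)\in\mathcal H_g$. Set $\kappa^g_{\mathrm{sig}}(\gamma,\tau)=\langle S(\gamma^g)_{0,T},S(\tau^g)_{0,T}\rangle_{\overline{T(\mathcal H_g)}}$, $\kappa^{g,\ell}_{\mathrm{sig}}(\gamma,\tau)=\ell(\gamma_0,\tau_0)\,\kappa^g_{\mathrm{sig}}(\gamma-\gamma_0,\tau-\tau_0)$ and $$\kappa((s,x,\gamma),(t,y,\tau))=k((s,x),(t,y))\,\kappa^{g,\ell}_{\mathrm{sig}}(\gamma,\tau),$$ where $k,\ell$ are cc-universal kernels on $\mathbb R^{d+1},\mathbb R^e$ (continuous, symmetric, positive semidefinite, with RKHS dense in the continuous functions on every compact set, in uniform norm). $\mathcal H$ is the RKHS of $\kappa$ restricted to $\mathcal X\times\mathcal X$. **Assumption G.** $g$ is four times differentiable and, for all $0\le n,m\le4$, $\sup_{x,y\in\mathbb R^e}\big(\sum_{|I|=n,|J|=m}|\partial^n_{x^I}\partial^m_{y^J}g(x,y)|^2\big)^{1/2}<\infty$. **Assumption F.** The feature maps $\varphi(x)=\ell(x,\cdot)$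 (into the RKHS of $\ell$) and $\chi(x)=k(x,\cdot)$ (into the RKHS of $k$) are bounded, Lipschitz continuous, twice differentiable, with bounded, Lipschitz continuous derivatives. **Optimal recovery.** For $m,n\in\mathbb N$ and collocation points $\omega^1,\dots,\omega^m\in\mathcal X^\circ$, $\omega^{m+1},\dots,\omega^{m+n}\in\partial\mathcal X$, $u_{m,n}$ denotes the unique minimiser of $\tfrac12\|u\|_{\mathcal H}^2$ over $u\in\mathcal H$ subject to $\mathcal L_tu(\omega^i)=f(\omega^i)$ for $1\le i\le m$ and $u(\omega^i)=\phi(\omega^i)$ for $m<i\le m+n$.
   Formalization: Solutions of the target PPDE, and their uniqueness, are in the Gateaux sense instead of the sup-norm Fréchet sense; in C^N(X) continuity of the time derivative is asked only for t<T, and functionals may depend on the monotone coordinate before t, as elements of H do. *)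

(* Defs.v *)
From HB Require Import structures.
From mathcomp Require Import all_boot all_order all_algebra.
From mathcomp Require Import all_classical all_reals all_analysis.

Set Implicit Arguments.
Unset Strict Implicit.
Unset Printing Implicit Defensive.

Import Order.TTheory GRing.Theory Num.Theory.
Import numFieldNormedType.Exports.

Local Open Scope classical_set_scope.
Local Open Scope ring_scope.

Definition dist_space (R : realType) (A : Type) (dist : A -> A -> \bar R) : Type :=
  A.

Section DistanceTopology.
Variables (R : realType) (A : Type) (dist : A -> A -> \bar R).
Notation dist_space := (dist_space dist).

Definition dist_open (U : set dist_space) : Prop :=
  forall x, U x ->
    exists2 r : R, 0 < r & forall y, (dist x y < r%:E)%E -> U y.

Lemma dist_openT : dist_open setT.
Proof. by move=> x _; exists 1. Qed.

Lemma dist_openI : setI_closed dist_open.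
Proof.
move=> U V oU oV x [Ux Vx].
have [r r0 rU] := oU x Ux; have [s s0 sV] := oV x Vx.
exists (Num.min r s) => [|y]; first by rewrite lt_min r0 s0.
rewrite EFin_min lt_min => /andP[xyr xys].
by split; [exact: rU|exact: sV].
Qed.

Lemma dist_open_bigU (I : Type) (F : I -> set dist_space) :
  (forall i, dist_open (F i)) -> dist_open (\bigcup_i F i).
Proof.
move=> oF x [i _ Fix]; have [r r0 rF] := oF i x Fix.
by exists r => // y /rF Fiy; exists i.
Qed.

HB.instance Definition _ := gen_eqMixin dist_space.
HB.instance Definition _ := gen_choiceMixin dist_space.
HB.instance Definition _ :=
  isOpenTopological.Build dist_space dist_openT dist_openI dist_open_bigU.

End DistanceTopology.

Section Kernels.
Variables (R : realType) (A : Type).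
Implicit Types (K : A -> A -> R) (f h : A -> R).

Definition is_kernel K : Prop :=
  (forall a b, K a b = K b a) /\
  (forall n (a : 'I_n -> A) (c : 'I_n -> R),
     0 <= \sum_i \sum_j c i * c j * K (a i) (a j)).

(* The values of [dot] outside [carrier] are irrelevant. By Moore-Aronszajn, a
   kernel has an RKHS, and any two agree on [carrier] and on [dot] there. *)
Record rkhs K := Rkhs {
  carrier : set (A -> R);
  dot : (A -> R) -> (A -> R) -> R;
  carrier0 : carrier (fun=> 0);
  carrierP : forall c f h, carrier f -> carrier h ->
    carrier (fun a => c * f a + h a);
  dotC : forall f h, carrier f -> carrier h -> dot f h = dot h f;
  dotP : forall c f1 f2 h, carrier f1 -> carrier f2 -> carrier h ->
    dot (fun a => c * f1 a + f2 a) h = c * dot f1 h + dot f2 h;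
  dot_ge0 : forall f, carrier f -> 0 <= dot f f;
  dot_eq0 : forall f, carrier f -> dot f f = 0 -> f = (fun=> 0);
  carrier_complete : forall F : nat -> A -> R,
    (forall n, carrier (F n)) ->
    (forall r, 0 < r -> exists N, forall m n, (N <= m)%N -> (N <= n)%N ->
       Num.sqrt (dot (F m \- F n) (F m \- F n)) < r) ->
    exists2 f, carrier f &
      (fun n => Num.sqrt (dot (F n \- f) (F n \- f))) @ \oo --> (0 : R);
  carrier_kernel : forall a, carrier (K a);
  reproducing : forall f a, carrier f -> f a = dot f (K a)
}.

Definition hnorm K (H : rkhs K) f : R := Num.sqrt (dot H f f).

End Kernels.

Definition enorm (R : realType) n (v : 'rV[R]_n) : R :=
  Num.sqrt (\sum_i v 0 i ^+ 2).

Section EuclideanKernels.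
Variables (R : realType) (n : nat).
Implicit Types K : 'rV[R]_n -> 'rV[R]_n -> R.

Definition cc_universal K (H : rkhs K) : Prop :=
  [/\ is_kernel K,
      continuous (fun z : 'rV[R]_n * 'rV[R]_n => K z.1 z.2) &
      forall (C : set 'rV[R]_n) (f : 'rV[R]_n -> R),
        compact C -> {within C, continuous f} ->
        forall r : R, 0 < r ->
          exists2 h, carrier H h & forall x, C x -> `|h x - f x| <= r].

Definition lipschitz_feature K (H : rkhs K) : Prop :=
  exists L : R, forall x y, hnorm H (K x \- K y) <= L * enorm (x - y).

(* [D1 x v] is the first derivative of the feature map at [x] in direction [v],
   and [D2 x w v] is the derivative at [x] in direction [w] of [D1 _ v]; norms
   of derivatives are operator norms. *)
Definition assumption_F K (H : rkhs K) : Prop :=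
  exists (L : R)
    (D1 : 'rV[R]_n -> 'rV[R]_n -> 'rV[R]_n -> R)
    (D2 : 'rV[R]_n -> 'rV[R]_n -> 'rV[R]_n -> 'rV[R]_n -> R),
  [/\
   [/\ forall x v, carrier H (D1 x v),
       forall x w v, carrier H (D2 x w v),
       forall x c v v' a, D1 x (c *: v + v') a = c * D1 x v a + D1 x v' a,
       forall x w c v v' a,
         D2 x w (c *: v + v') a = c * D2 x w v a + D2 x w v' a &
       forall x c w w' v a,
         D2 x (c *: w + w') v a = c * D2 x w v a + D2 x w' v a],
   (forall x (r : R), 0 < r -> \forall h \near (0 : 'rV[R]_n),
      hnorm H (K (x + h) \- K x \- D1 x h) <= r * enorm h),
   (forall x (r : R), 0 < r -> \forall h \near (0 : 'rV[R]_n), forall v,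
      hnorm H (D1 (x + h) v \- D1 x v \- D2 x h v) <= r * enorm h * enorm v),
   [/\ forall x, hnorm H (K x) <= L,
       forall x v, hnorm H (D1 x v) <= L * enorm v &
       forall x w v, hnorm H (D2 x w v) <= L * enorm w * enorm v] &
   [/\ forall x y, hnorm H (K x \- K y) <= L * enorm (x - y),
       forall x y v,
         hnorm H (D1 x v \- D1 y v) <= L * enorm (x - y) * enorm v &
       forall x y w v, hnorm H (D2 x w v \- D2 y w v)
         <= L * enorm (x - y) * enorm w * enorm v]].

Definition partial (I : seq 'I_n) (f : 'rV[R]_n -> R) : 'rV[R]_n -> R :=
  foldr (fun i h x => 'D_(delta_mx 0 i) h x) f I.

Fixpoint partial_exists (I : seq 'I_n) (f : 'rV[R]_n -> R) : Prop :=
  if I is i :: J then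
    partial_exists J f /\
    forall x, derivable (partial J f) x (delta_mx 0 i)
  else True.

Fixpoint times_differentiable (V : normedModType R) m (f : V -> R) : Prop :=
  if m is m'.+1 then
    (forall z, differentiable f z) /\
    forall v : V, times_differentiable m' (fun z => 'D_v f z)
  else True.

Definition mixed_partial (I J : seq 'I_n) K (x y : 'rV[R]_n) : R :=
  partial I (fun x' => partial J (K x') y) x.

(* Existence of the mixed derivatives up to order (4, 4) does not follow from
   four times differentiability; it is implicit in their bound. *)
Definition assumption_G K : Prop :=
  [/\ times_differentiable 4 (fun z : 'rV[R]_n * 'rV[R]_n => K z.1 z.2),
      forall I J : seq 'I_n, (size I <= 4)%N -> (size J <= 4)%N ->
        (forall x, partial_exists J (K x)) /\
        (forall y, partial_exists I (fun x => partial J (K x) y)) &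
      forall p q, (p <= 4)%N -> (q <= 4)%N ->
        exists C : R, forall x y : 'rV[R]_n,
          Num.sqrt (\sum_(I : p.-tuple 'I_n) \sum_(J : q.-tuple 'I_n)
                      mixed_partial I J K x y ^+ 2) <= C].

End EuclideanKernels.

(* The Hilbert space completion of the tensor algebra over the RKHS [V] of [K]
   is realised as the RKHS of this kernel on words: the pure tensor
   [f_1 (x) ... (x) f_n] is the function that maps words [a_1 ... a_n] of length
   n to [\prod_i f_i a_i] and the other words to 0. Hence the kernel function of
   a word w is [K a_1 (x) ... (x) K a_n]; pure tensors of different degrees are
   orthogonal, and within a degree their inner product is the product of the
   inner products in [V]. *)
Definition tensor_kernel (R : realType) (A : Type) (K : A -> A -> R)
    (v w : seq A) : R :=
  (size v == size w)%:R * \prod_(ab <- zip v w) K ab.1 ab.2.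

Section Signature.
Variable R : realType.

(* [s] lists the points of the partition after [a], the last one being [b]. *)
Definition is_RS_integral (f h : R -> R) (a b l : R) : Prop :=
  forall r : R, 0 < r -> exists2 delta : R, 0 < delta &
    forall (s : seq R) (xi : nat -> R), itv_partition a b s ->
      (forall i, (i < size s)%N ->
         nth b s i - nth b (a :: s) i < delta /\
         nth b (a :: s) i <= xi i <= nth b s i) ->
      `|\sum_(i < size s) f (xi i) * (h (nth b s i) - h (nth b (a :: s) i)) - l|
        < r.

Definition RS_integral (f h : R -> R) (a b : R) : R :=
  get (is_RS_integral f h a b).

(* Coordinate of the signature at the word a_1 ... a_n, i.e., its inner product
   with [K a_1 (x) ... (x) K a_n]: the iterated integral over
   t < t_1 < ... < t_n < t' of d(X_{t_1} a_1) ... d(X_{t_n} a_n). *)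
Definition signature (A : Type) (X : R -> A -> R) (t t' : R) (w : seq A) : R :=
  foldl (fun F a s => RS_integral F (fun r => X r a) t s) (fun=> 1) w t'.

Section SignatureKernel.
Variables (T : R) (e : nat) (g : 'rV[R]_e -> 'rV[R]_e -> R).
Variables (TV : rkhs (tensor_kernel g)) (l : 'rV[R]_e -> 'rV[R]_e -> R).
Implicit Types gam tau : R -> 'rV[R]_e.

Definition sig_kernel gam tau : R :=
  dot TV (signature (fun s => g (gam s)) 0 T)
         (signature (fun s => g (tau s)) 0 T).

Definition sig_kernel_l gam tau : R :=
  l (gam 0) (tau 0) *
  sig_kernel (fun s => gam s - gam 0) (fun s => tau s - tau 0).

End SignatureKernel.
End Signature.

Section Paths.
Variable R : realType.

(* Paths take values in R^(e+1), coordinate 0 being the monotone one. *)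
Definition path_type (e : nat) := R -> 'rV[R]_e.+1.

Definition pvar n (q a b : R) (gam : R -> 'rV[R]_n) : \bar R :=
  (ereal_sup [set (\sum_(i < size s)
       enorm (gam (nth b s i) - gam (nth b (a :: s) i)) `^ q)%:E
     | s in [set s | itv_partition a b s]] `^ q^-1)%E.

Definition pvar_norm n (q a b : R) (gam : R -> 'rV[R]_n) : \bar R :=
  ((enorm (gam a))%:E + pvar q a b gam)%E.

(* A path on [0, T] is encoded as a function on R that is constant outside
   [0, T], so that equality of paths is equality on [0, T]. *)
Definition BV0 (T : R) e (gam : path_type e) : Prop :=
  [/\ forall s, gam s = gam (Num.max 0 (Num.min s T)),
      {within `[0, T]%classic, continuous gam},
      (pvar 1 0 T gam < +oo)%E &
      (forall s t, 0 <= s -> s < t -> t <= T -> gam s 0 0 < gam t 0 0) \/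
      (forall s t, 0 <= s -> s < t -> t <= T -> gam t 0 0 < gam s 0 0)].

Record ppoint (d e : nat) := PPoint {
  ptime : R; pspace : 'rV[R]_d; ppath : path_type e }.

Definition kernel_domain (T : R) d e (w : ppoint d e) : Prop :=
  0 <= ptime w <= T /\ BV0 T (ppath w).

Definition Omega (T : R) d e (w : ppoint d e) : Prop :=
  kernel_domain T w /\
  forall s, 0 <= s <= ptime w -> forall j : 'I_e.+1, j != 0 ->
    ppath w s 0 j = ppath w 0 0 j.

Definition odist (T p : R) d e (w z : ppoint d e) : \bar R :=
  (`|ptime w - ptime z|%:E + (enorm (pspace w - pspace z))%:E +
   pvar_norm p 0 T (fun s => (ppath w s - ppath z s)%R))%E.

Definition ospace (T p : R) d e := dist_space (@odist T p d e).

Definition kappa (T : R) d e (k : 'rV[R]_(1 + d) -> 'rV[R]_(1 + d) -> R)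
    (g l : 'rV[R]_e.+1 -> 'rV[R]_e.+1 -> R) (TV : rkhs (tensor_kernel g))
    (w z : ppoint d e) : R :=
  k (row_mx (const_mx (ptime w)) (pspace w))
    (row_mx (const_mx (ptime z)) (pspace z)) *
  sig_kernel_l T TV l (ppath w) (ppath z).

End Paths.

Section Derivatives.
Variables (R : realType) (T p : R) (d e : nat).
Notation ppoint := (ppoint R d e).
Notation path := (path_type R e).
Implicit Types (u : ppoint -> R) (w : ppoint).

(* A functional of the path restricted to [t, T] is evaluated at points of
   Omega, whose paths are frozen before t except for coordinate 0. So a
   perturbation of the path on [t, T] is extended to [0, t] by its value at t;
   coordinate 0 is not perturbed. *)
Definition frozen_direction (t : R) (eta : path) : path :=
  fun s => \row_j (if j == 0 then 0 else eta (Num.max t s) 0 j).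

Inductive step := Step_t | Step_x of 'I_d | Step_path of path.

Definition shift_pt (st : step) (h : R) w : ppoint :=
  match st with
  | Step_t => PPoint (ptime w + h) (pspace w) (ppath w)
  | Step_x i => PPoint (ptime w) (pspace w + h *: delta_mx 0 i) (ppath w)
  | Step_path eta => PPoint (ptime w) (pspace w)
      (fun s => ppath w s + h *: frozen_direction (ptime w) eta s)
  end.

Definition is_time (st : step) : bool := if st is Step_t then true else false.

Definition diff_quotient (st : step) u w (h : R) : R :=
  h^-1 * (u (shift_pt st h w) - u w).

Definition deriv1 (st : step) u w : R :=
  if is_time st then
    if ptime w < T then lim (diff_quotient st u w @ 0^'+) else 0
  else lim (diff_quotient st u w @ 0^').

Definition deriv1_exists (st : step) u w : Prop :=
  if is_time st then
    ptime w < T -> cvg (diff_quotient st u w @ 0^'+)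
  else cvg (diff_quotient st u w @ 0^').

Definition iter_deriv (sts : seq step) u : ppoint -> R := foldr deriv1 u sts.

(* The derivative of order n at a point requires the one of order n - 1 on a
   neighbourhood of that point along the outermost variable. *)
Fixpoint iter_deriv_exists (sts : seq step) u w : Prop :=
  if sts is st :: sts' then
    (if is_time st
     then \forall h \near 0^'+, ptime w + h <= T ->
            iter_deriv_exists sts' u (shift_pt st h w)
     else \forall h \near 0^', iter_deriv_exists sts' u (shift_pt st h w)) /\
    iter_deriv_exists sts' u w /\ deriv1_exists st (iter_deriv sts' u) w
  else True.

(* Multi-indices; membership in [in_N] bounds the components by 1, 2, 2. *)
Definition midx := ('I_2 * 'I_3 * 'I_3)%type.
Definition ord_t (n : midx) : nat := n.1.1.
Definition ord_x (n : midx) : nat := n.1.2.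
Definition ord_g (n : midx) : nat := n.2.

Definition in_N (n : midx) : bool :=
  [&& ord_t n <= 1, ord_x n == 0 & ord_g n == 0]%N || [&& ord_t n == 0 & ord_x n + ord_g n <= 2]%N.

(* The operator which applies first the pathwise derivatives in the directions
   [etas], then the spatial ones in the coordinates [I], then those in time. The
   same mixed derivative is used in the operator L and in the norm. *)
Definition steps (n : midx) (I : (ord_x n).-tuple 'I_d)
    (etas : (ord_g n).-tuple path) : seq step :=
  nseq (ord_t n) Step_t ++ map Step_x I ++ map Step_path etas.

Definition before_T (X : set (ospace T p d e)) : set (ospace T p d e) :=
  [set w | X w /\ ptime w < T].
Definition at_T (X : set (ospace T p d e)) : set (ospace T p d e) :=
  [set w | X w /\ ptime w = T].

Definition unit_directions m (etas : m.-tuple path) : Prop :=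
  forall i, BV0 T (tnth etas i) /\ (pvar_norm 1 0 T (tnth etas i) <= 1)%E.

(* For vector-valued and matrix-valued spatial derivatives, the absolute value
   is the Euclidean norm. *)
Definition normN (X : set (ospace T p d e)) u : \bar R :=
  (\sum_(n : midx | in_N n)
     ereal_sup [set (Num.sqrt (\sum_(I : (ord_x n).-tuple 'I_d)
                   iter_deriv (steps I etas) u w ^+ 2))%:E
                | w in X & etas in @unit_directions (ord_g n)])%E.

(* Continuity of a time derivative is required for t < T only, since its value
   at t = T is conventional. *)
Definition in_CN (X : set (ospace T p d e)) u : Prop :=
  (forall (n : midx) (I : (ord_x n).-tuple 'I_d) (etas : (ord_g n).-tuple path),
     in_N n -> (forall i, BV0 T (tnth etas i)) ->
     (forall w, X w -> iter_deriv_exists (steps I etas) u w) /\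
     {within (if ord_t n == 0 then X else before_T X)%N,
        continuous (iter_deriv (steps I etas) u : ospace T p d e -> R)}) /\
  (normN X u < +oo)%E.

Definition CN_space (X : set (ospace T p d e)) :=
  dist_space (fun u v : {u : ppoint -> R | in_CN X u} =>
    normN X (sval u \- sval v)).

(* Pathwise derivatives are Gateaux derivatives, also for solutions of the
   equation. A Frechet derivative for the supremum norm coincides with the
   Gateaux derivative when it exists, but functionals of the signature are in
   general not even continuous for the supremum norm.
   For d > 1 the coefficient [a n] is an array indexed by the coordinates of the
   spatial derivative, so that gradients and Hessians are contracted. *)
Definition operator_L (a : forall n : midx, (ord_x n).-tuple 'I_d -> R)
    (eta : forall n : midx, (ord_g n).-tuple path) u w : R :=
  \sum_(n : midx | in_N n) \sum_(I : (ord_x n).-tuple 'I_d)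
     a n I * iter_deriv (steps I (eta n)) u w.

Definition solves_ppde (X : set (ospace T p d e)) a eta (f phi : ppoint -> R)
    u : Prop :=
  (forall w, before_T X w -> operator_L a eta u w = f w) /\
  (forall w, at_T X w -> u w = phi w).

Definition borel_on (X : set (ospace T p d e)) (f : ppoint -> R) : Prop :=
  forall B : set R, measurable B ->
    <<s @open (ospace T p d e) >> (X `&` (f : ospace T p d e -> R) @^-1` B).

(* The first [c (m, n)] points of the family indexed by [(m, n)] become dense in
   [Y] as m and n tend to infinity. *)
Definition asymptotically_dense (Y : set (ospace T p d e))
    (c : nat * nat -> nat) (pts : nat -> nat -> nat -> ppoint) : Prop :=
  forall w : ospace T p d e, Y w -> forall U, nbhs w U ->
    \forall mn \near filter_prod \oo \oo,
      exists2 i, (i < c mn)%N & U (pts mn.1 mn.2 i).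

End Derivatives.

Section OptimalRecovery.
Variables (R : realType) (T p : R) (d e : nat).
Notation ppoint := (ppoint R d e).
Variables (X : set (ospace T p d e)) (K : ppoint -> ppoint -> R).

Definition restricted_kernel (w z : {w : ppoint | X w}) : R :=
  K (sval w) (sval z).

Variable H : rkhs restricted_kernel.

(* The extension of h from X given by the reproducing formula; it is the element
   of least norm extending h in the RKHS of the unrestricted kernel. *)
Definition extension (h : {w : ppoint | X w} -> R) : ppoint -> R :=
  fun w => dot H h (fun z => K w (sval z)).

Definition feasible a eta (f phi : ppoint -> R) (m n : nat)
    (wint wter : nat -> ppoint) (h : {w : ppoint | X w} -> R) : Prop :=
  [/\ carrier H h,
      forall i, (i < m)%N ->
        operator_L T a eta (extension h) (wint i) = f (wint i) &
      forall j, (j < n)%N -> extension h (wter j) = phi (wter j)].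

Definition optimal_recovery a eta f phi m n wint wter h : Prop :=
  feasible a eta f phi m n wint wter h /\
  forall h', feasible a eta f phi m n wint wter h' ->
    2^-1 * hnorm H h ^+ 2 <= 2^-1 * hnorm H h' ^+ 2.

End OptimalRecovery.

(* Main.v *)
(* Mixed differences up to order three of the feature map of kappa, along
   directions in time, space and path space, are bounded in the RKHS by the
   product of the sizes of the directions. For the signature factor this holds for
   piecewise constant paths, whose signatures are products of factors 1 + (jump),
   and passes to the limit. Hence the functionals of H have the derivatives indexed
   by N, these derivatives at a point are bounded linear functionals on H, and they
   depend on the point continuously, uniformly on the unit ball of H.

   Case (ii): the error v of a minimiser u is orthogonal to u and annihilated by the
   collocation functionals. As the points become dense, v is asymptotically
   orthogonal to the representers of all the functionals of the equation, which by
   uniqueness span a dense subspace, so that |v|^2 = <v, ustar> is o(|v|). Case (i): a limit point of the minimisers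
   solves the equation by density and continuity, hence it is ustar. *)

Require Import Defs.
From HB Require Import structures.
From mathcomp Require Import all_boot all_order all_algebra.
From mathcomp Require Import all_classical all_reals all_analysis.
From mathcomp Require Import ring lra.
Import Order.TTheory GRing.Theory Num.Theory.
Import numFieldNormedType.Exports.
Local Open Scope classical_set_scope.
Local Open Scope ring_scope.
Set Implicit Arguments.
Unset Strict Implicit.
Unset Printing Implicit Defensive.

(** * Kernels and reproducing kernel Hilbert spaces *)

(** The obstacle is that the signature is not visibly differentiable as a map into the RKHS: its
    iterated integrals converge word by word only, and convergence in [odist] with p > 1 does not
    control the 1-variation of a difference of paths. [rk_le] expresses a norm bound by inequalities
    between finitely many values. It therefore survives pointwise limits, and by the Schur product
    theorem it is multiplicative, so that bounds for k, l and the signature kernel combine into one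
    for kappa. Derivatives of order two are obtained from differences: a bound of order three makes
    the second difference quotients converge with an explicit rate. The static kernel needs order
    four, because its differences are taken of increments of the lifted path, and the increment
    itself costs one order. Continuity of a derivative in the point is read off difference quotients
    with a fixed step, for which a Lipschitz bound of the feature map in the supremum norm, at
    bounded 1-variation, is enough. *)

Definition kform (R : realType) (A : Type) (K : A -> A -> R) n (a : 'I_n -> A)
    (c : 'I_n -> R) : R :=
  \sum_i \sum_j c i * c j * K (a i) (a j).

(* For a kernel with an RKHS this says that f lies in the RKHS and has norm at
   most C; it does not refer to the RKHS, which makes it stable under pullback
   and pointwise limits. *)
Definition rk_le (R : realType) (A : Type) (K : A -> A -> R) (f : A -> R)
    (C : R) : Prop :=
  0 <= C /\ forall n (a : 'I_n -> A) (c : 'I_n -> R),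
    `|\sum_i c i * f (a i)| <= C * Num.sqrt (kform K a c).

(** * The Schur product of positive semidefinite matrices *)

Section Schur.
Variable R : realType.

Definition psd n (M : 'I_n -> 'I_n -> R) : Prop :=
  (forall i j, M i j = M j i) /\
  forall c : 'I_n -> R, 0 <= \sum_i \sum_j c i * c j * M i j.

(** The minimum over t is attained at - b / c. If c = 0 the polynomial is affine, and the chosen t
    gives it the value -1 unless b = 0. The Cauchy-Schwarz inequalities below come from here. *)
Lemma quad_ge0 (a b c : R) : 0 <= c ->
  (forall t, 0 <= a + 2 * t * b + t ^+ 2 * c) -> b ^+ 2 <= a * c.
Proof.
move=> c0 H.
have [c_eq|c_ne] := eqVneq c 0.
  have [->|bne] := eqVneq b 0; first by rewrite c_eq mulr0 expr0n.
  have := H (- (a + 1) / (2 * b)); rewrite c_eq mulr0 addr0.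
  have -> : a + 2 * (- (a + 1) / (2 * b)) * b = - 1 by field.
  by rewrite lerNr oppr0 ler10.
have cp : 0 < c by rewrite lt_def c_ne.
have := H (- b / c).
have -> : a + 2 * (- b / c) * b + (- b / c) ^+ 2 * c = (a * c - b ^+ 2) / c by field.
by rewrite pmulr_lge0 ?invr_gt0// subr_ge0.
Qed.

(** Induction on n by one step of Gaussian elimination: M = v v^T / M_00 + M', where M' is the Schur
    complement of the first entry, positive semidefinite with vanishing first row and column. The
    rank-one part contributes the form of B at the coefficients c_i v_i, and M' reduces to a matrix
    of smaller size. *)
Lemma psd_schur n (M B : 'I_n -> 'I_n -> R) :
  psd M -> psd B -> forall c : 'I_n -> R,
  0 <= \sum_i \sum_j c i * c j * (M i j * B i j).
Proof.
elim: n M B => [|n IH] M B [sM pM] [sB pB] c; first by rewrite big_ord0.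
pose v (i : 'I_n.+1) := M i ord0.
pose M' i j := M i j - v i * v j / M ord0 ord0.
(* The form at x e_0 + y e_j; written as a sum of two indicators, the formula also covers j = 0. *)
have entry (x y : R) (j : 'I_n.+1) :
    \sum_i \sum_k ((if i == ord0 then x else 0) + (if i == j then y else 0)) *
     ((if k == ord0 then x else 0) + (if k == j then y else 0)) * M i k
    = x ^+ 2 * M ord0 ord0 + 2 * (x * y * M ord0 j) + y ^+ 2 * M j j.
  have inner i : \sum_k ((if i == ord0 then x else 0) + (if i == j then y else 0)) *
     ((if k == ord0 then x else 0) + (if k == j then y else 0)) * M i k =
     ((if i == ord0 then x else 0) + (if i == j then y else 0)) *
     (x * M i ord0 + y * M i j).
    rewrite (eq_bigr (fun k => ((if i == ord0 then x else 0) + (if i == j then y else 0)) *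
      ((if k == ord0 then x * M i k else 0) + (if k == j then y * M i k else 0)))).
      by rewrite -big_distrr big_split/= -!big_mkcond !big_pred1_eq.
    by move=> k _; case: (k == ord0); case: (k == j); ring.
  rewrite (eq_bigr _ (fun i _ => inner i)).
  rewrite (eq_bigr (fun i => (if i == ord0 then x * (x * M i ord0 + y * M i j) else 0) +
     (if i == j then y * (x * M i ord0 + y * M i j) else 0))).
    rewrite big_split/= -!big_mkcond !big_pred1_eq (sM j ord0); ring.
  by move=> k _; case: (k == ord0); case: (k == j); ring.
have m00 : 0 <= M ord0 ord0.
  have := pM (fun i => (if i == ord0 then 1 else 0) + (if i == ord0 then 0 else 0)).
  by rewrite entry expr1n expr0n/= !mul1r !mul0r mulr0 !addr0.
(* In the degenerate case M_00 = 0 the first row vanishes, and the convention 1 / 0 = 0 yields M' =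
   M. *)
have row0 : M ord0 ord0 = 0 -> forall j, M ord0 j = 0.
  move=> m0 j; apply/eqP; rewrite -sqrf_eq0 eq_le sqr_ge0 andbT.
  suff : M ord0 j ^+ 2 <= M j j * M ord0 ord0 by rewrite m0 mulr0.
  apply: quad_ge0 => // t.
  have := pM (fun i => (if i == ord0 then t else 0) + (if i == j then 1 else 0)).
  by rewrite entry; lra.
have M'0 i : M' i ord0 = 0.
  rewrite /M' /v; have [m0|mn] := eqVneq (M ord0 ord0) 0.
    by rewrite sM row0// m0 invr0 !mulr0 subrr.
  by rewrite -mulrA divff// mulr1 subrr.
have sM' i j : M' i j = M' j i by rewrite /M' sM; congr (_ - _); ring.
have pM' : psd M'.
  split=> // c'.
  pose s := \sum_i c' i * v i.
  have Eq t : \sum_i \sum_j (c' i + (if i == ord0 then t else 0)) *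
       (c' j + (if j == ord0 then t else 0)) * M i j =
     (\sum_i \sum_j c' i * c' j * M i j) + 2 * t * s + t ^+ 2 * M ord0 ord0.
    have inner i : \sum_j (c' i + (if i == ord0 then t else 0)) *
       (c' j + (if j == ord0 then t else 0)) * M i j =
       (\sum_j c' i * c' j * M i j) + c' i * t * v i +
       (if i == ord0 then t * (\sum_j c' j * M i j + t * v i) else 0).
      rewrite (eq_bigr (fun j => c' i * c' j * M i j +
        (if j == ord0 then c' i * t * M i j else 0) +
        (if i == ord0 then t else 0) * (c' j * M i j + (if j == ord0 then t * M i j else 0)))).
        rewrite !big_split/= -big_distrr/= big_split/= -!big_mkcond/= !big_pred1_eq.
        by case: ifP => _ //; rewrite mul0r.
      by move=> j _; case: ifP => _; case: ifP => _; ring.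
    rewrite (eq_bigr _ (fun i _ => inner i)) !big_split/= -big_mkcond big_pred1_eq.
    have -> : \sum_i c' i * t * v i = t * s.
      by rewrite /s big_distrr/=; apply: eq_bigr => i _; ring.
    have -> : \sum_j c' j * M ord0 j = s by apply: eq_bigr => j _; rewrite /v sM.
    rewrite /v; ring.
  (* The discriminant of the form at c' + t e_0 is the positivity of the Schur complement at c'. *)
  have Hs : s ^+ 2 <= (\sum_i \sum_j c' i * c' j * M i j) * M ord0 ord0.
    by apply: quad_ge0 => // t; rewrite -Eq; apply: pM.
  have -> : \sum_i \sum_j c' i * c' j * M' i j =
      (\sum_i \sum_j c' i * c' j * M i j) - s ^+ 2 / M ord0 ord0.
    rewrite expr2 {1}/s big_distrl/= big_distrl/= -sumrB; apply: eq_bigr => i _.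
    rewrite /s big_distrr/= big_distrl/= -sumrB; apply: eq_bigr => j _.
    rewrite /M'; ring.
  have [m0|mn] := eqVneq (M ord0 ord0) 0.
    by rewrite m0 invr0 mulr0 subr0; apply: pM.
  by rewrite subr_ge0 ler_pdivrMr// lt_def mn.
have -> : \sum_i \sum_j c i * c j * (M i j * B i j) =
   (\sum_i \sum_j (c i * v i) * (c j * v j) * B i j) / M ord0 ord0 +
   \sum_i \sum_j c i * c j * (M' i j * B i j).
  rewrite big_distrl/= -big_split/=; apply: eq_bigr => i _.
  rewrite big_distrl/= -big_split/=; apply: eq_bigr => j _.
  rewrite /M'; ring.
rewrite addr_ge0// ?mulr_ge0 ?invr_ge0//.
rewrite big_ord_recl [X in X + _](_ : _ = 0); last first.
  by apply: big1 => j _; rewrite sM' M'0 mul0r mulr0.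
rewrite add0r (eq_bigr (fun i => \sum_j c (lift ord0 i) * c (lift ord0 j) *
    (M' (lift ord0 i) (lift ord0 j) * B (lift ord0 i) (lift ord0 j)))); last first.
  by move=> i _; rewrite big_ord_recl M'0 mul0r mulr0 add0r.
pose ext (c' : 'I_n -> R) (i : 'I_n.+1) := oapp c' 0 (unlift ord0 i).
have minor (N : 'I_n.+1 -> 'I_n.+1 -> R) : psd N ->
    psd (fun i j => N (lift ord0 i) (lift ord0 j)).
  move=> [sN pN]; split=> // c'; have := pN (ext c').
  rewrite big_ord_recl [X in X + _](_ : _ = 0) ?add0r; last first.
    by apply: big1 => j _; rewrite /ext unlift_none/= !mul0r.
  congr (_ <= _); apply: eq_bigr => i _.
  rewrite big_ord_recl /ext unlift_none/= mulr0 mul0r add0r.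
  by apply: eq_bigr => j _; rewrite !liftK.
by apply: (IH _ _ (minor _ pM') (minor _ (conj sB pB))).
Qed.

End Schur.

Lemma cvgr_le_cst (R : realType) (T : Type) (F : set_system T)
    (FF : ProperFilter F) (f : T -> R) (l c : R) :
  f @ F --> l -> (\forall x \near F, f x <= c) -> l <= c.
Proof.
move=> fl H; rewrite -(cvg_lim (@Rhausdorff R) fl).
by apply: limr_le => //; apply/cvg_ex; exists l.
Qed.

Lemma cvg_sum_ord (R : realType) (T : Type) (F : set_system T)
    (FF : Filter F) n (f : 'I_n -> T -> R) (l : 'I_n -> R) :
  (forall i, f i @ F --> l i) ->
  (fun x => \sum_i f i x) @ F --> \sum_i l i.
Proof.
elim: n f l => [|n IH] f l H.
  by rewrite big_ord0; under eq_fun do rewrite big_ord0; exact: cvg_cst.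
rewrite big_ord_recl; under eq_fun do rewrite big_ord_recl.
by apply: cvgD; [exact: H|apply: IH => i; exact: H].
Qed.

Lemma natinv_small (R : realType) (eps : R) : 0 < eps ->
  exists N, forall n, (N <= n)%N -> n.+1%:R^-1 < eps.
Proof.
move=> e0; have [N _ HN] := near_infty_natSinv_lt (PosNum e0).
by exists N => n Nn; exact: HN.
Qed.

(** * Norm bounds that do not refer to the Hilbert space *)

Section RKBound.
Variables (R : realType) (A : Type) (K : A -> A -> R).
Implicit Types (f h : A -> R) (C D : R).

Lemma rk_le_ge0 f C : rk_le K f C -> 0 <= C.
Proof. by case. Qed.

Lemma rk_le_mono C D f : C <= D -> rk_le K f C -> rk_le K f D.
Proof.
move=> CD [C0 Hf]; split; first exact: le_trans CD.
by move=> n a c; apply: le_trans (Hf n a c) _; rewrite ler_wpM2r ?sqrtr_ge0.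
Qed.

Lemma rk_le0 C : 0 <= C -> rk_le K (fun=> 0) C.
Proof.
move=> C0; split=> // n a c; rewrite big1 ?normr0 ?mulr_ge0 ?sqrtr_ge0//.
by move=> i _; rewrite mulr0.
Qed.

Lemma rk_leD f h C D : rk_le K f C -> rk_le K h D ->
  rk_le K (fun x => f x + h x) (C + D).
Proof.
move=> [C0 Hf] [D0 Hh]; split; first exact: addr_ge0.
move=> n a c; under eq_bigr do rewrite mulrDr.
rewrite big_split/= mulrDl; apply: le_trans (ler_normD _ _) _.
by apply: lerD; [exact: Hf|exact: Hh].
Qed.

Lemma rk_leZ c f C : rk_le K f C -> rk_le K (fun x => c * f x) (`|c| * C).
Proof.
move=> [C0 Hf]; split; first exact: mulr_ge0.
move=> n a b; under eq_bigr do rewrite mulrCA.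
by rewrite -big_distrr/= normrM -mulrA ler_wpM2l//; exact: Hf.
Qed.

Lemma rk_leB f h C D : rk_le K f C -> rk_le K h D ->
  rk_le K (fun x => f x - h x) (C + D).
Proof.
move=> Hf Hh; have := rk_leD Hf (rk_leZ (-1) Hh).
rewrite normrN1 mul1r; congr (rk_le K _ _).
by apply/funext => x; rewrite mulN1r.
Qed.

Lemma rk_leN f C : rk_le K f C -> rk_le K (fun x => - f x) C.
Proof.
move=> Hf; have := rk_leZ (-1) Hf; rewrite normrN1 mul1r.
by congr (rk_le K _ _); apply/funext => x; rewrite mulN1r.
Qed.

(** Each defining inequality involves finitely many values, hence passes to pointwise limits. Bounds
    for discretised signatures reach the signatures in this way without any convergence in norm. *)
Lemma rk_le_lim (F : nat -> A -> R) f C :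
  (\forall n \near \oo, rk_le K (F n) C) ->
  (forall x, (fun n => F n x) @ \oo --> f x) -> rk_le K f C.
Proof.
move=> HF Hlim; split.
  by case: HF => N _ /(_ N) /= /(_ (leqnn _)) [].
move=> n a c.
have cvS : (fun m => `|\sum_i c i * F m (a i)|) @ \oo --> `|\sum_i c i * f (a i)|.
  apply: cvg_norm; apply: cvg_sum_ord => i; apply: cvgM; first exact: cvg_cst.
  exact: Hlim.
apply: (cvgr_le_cst _ cvS); near=> m.
have [_ H] : rk_le K (F m) C by near: m.
exact: H.
Unshelve. all: by end_near. Qed.

End RKBound.

Lemma kform_psd (R : realType) (A : Type) (K : A -> A -> R) :
  is_kernel K -> forall n (a : 'I_n -> A), psd (fun i j => K (a i) (a j)).
Proof. by move=> [sK pK] n a; split=> // c; exact: pK. Qed.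

Lemma rk_le_pull (R : realType) (A B : Type) (K : A -> A -> R) (m : B -> A)
    (f : A -> R) (C : R) :
  rk_le K f C -> rk_le (fun x y => K (m x) (m y)) (f \o m) C.
Proof. by move=> [C0 Hf]; split=> // n a c; have := Hf n (m \o a) c. Qed.

(** The bound for f1 says that C1^2 K1 - f1 (x) f1 is positive semidefinite. Its Schur product with
    K2 bounds the form of K2 at the coefficients c_i f1(a_i) by C1^2 times the form of the product
    kernel, and the bound for f2 is applied at these coefficients. *)
Lemma rk_leM (R : realType) (A : Type) (K1 K2 : A -> A -> R) (f1 f2 : A -> R)
    (C1 C2 : R) :
  is_kernel K1 -> is_kernel K2 -> rk_le K1 f1 C1 -> rk_le K2 f2 C2 ->
  rk_le (fun x y => K1 x y * K2 x y) (fun x => f1 x * f2 x) (C1 * C2).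
Proof.
move=> k1 k2 [C10 H1] [C20 H2]; split; first exact: mulr_ge0.
move=> n a c.
have p2 := kform_psd k2 a.
have pN : psd (fun i j => C1 ^+ 2 * K1 (a i) (a j) - f1 (a i) * f1 (a j)).
  have [s1 p1] := kform_psd k1 a.
  split=> [i j|b]; first by rewrite s1 [X in _ - X]mulrC.
  have -> : \sum_i \sum_j b i * b j *
      (C1 ^+ 2 * K1 (a i) (a j) - f1 (a i) * f1 (a j)) =
      C1 ^+ 2 * kform K1 a b - (\sum_i b i * f1 (a i)) ^+ 2.
    rewrite /kform [X in _ = _ - X]expr2 [X in _ = _ - X]big_distrl/=.
    rewrite [X in _ = X - _]big_distrr/= -sumrB; apply: eq_bigr => i _.
    rewrite !big_distrr/= -sumrB; apply: eq_bigr => j _; ring.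
  rewrite subr_ge0 -[X in _ <= _ * X](sqr_sqrtr (p1 b)) -exprMn -[leLHS]real_normK ?num_real//.
  by rewrite ler_pXn2r ?nnegrE ?mulr_ge0 ?sqrtr_ge0//; exact: H1.
have := psd_schur pN p2 c.
have -> : \sum_i \sum_j c i * c j *
    ((C1 ^+ 2 * K1 (a i) (a j) - f1 (a i) * f1 (a j)) * K2 (a i) (a j)) =
    C1 ^+ 2 * kform (fun x y => K1 x y * K2 x y) a c -
    kform K2 a (fun i => c i * f1 (a i)).
  rewrite /kform big_distrr -sumrB; apply: eq_bigr => i _.
  rewrite !big_distrr/= -sumrB; apply: eq_bigr => j _; ring.
rewrite subr_ge0 => Hle.
have := H2 n a (fun i => c i * f1 (a i)).
rewrite [in X in X -> _](eq_bigr (fun i => c i * (f1 (a i) * f2 (a i)))); last first.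
  by move=> i _; rewrite mulrA.
move=> /le_trans; apply; rewrite (mulrC C1) -mulrA ler_wpM2l//.
rewrite -[X in _ <= X * _](ger0_norm C10) -sqrtr_sqr -sqrtrM ?sqr_ge0//.
exact: ler_wsqrtr.
Qed.

(** * Calculus in a reproducing kernel Hilbert space *)

Section RKHS.
Variables (R : realType) (A : Type) (K : A -> A -> R) (H : rkhs K).
Implicit Types (f h : A -> R) (c : R).
Local Notation C := (carrier H).

Lemma carrierZ c f : C f -> C (fun x => c * f x).
Proof.
move=> Cf; have := carrierP c Cf (carrier0 H).
by congr C; apply/funext => x; rewrite addr0.
Qed.

Lemma carrierD f h : C f -> C h -> C (fun x => f x + h x).
Proof.
move=> Cf Ch; have := carrierP 1 Cf Ch.
by congr C; apply/funext => x; rewrite mul1r.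
Qed.

Lemma carrierB f h : C f -> C h -> C (fun x => f x - h x).
Proof.
move=> Cf Ch; have := carrierP (-1) Ch Cf.
by congr C; apply/funext => x; rewrite mulN1r addrC.
Qed.

Lemma carrier_sum n (f : 'I_n -> A -> R) : (forall i, C (f i)) ->
  C (fun x => \sum_i f i x).
Proof.
elim: n f => [|n IH] f Cf.
  by under eq_fun do rewrite big_ord0; exact: carrier0.
under eq_fun do rewrite big_ord_recl.
by apply: carrierD => //; exact: IH.
Qed.

Lemma dot0l h : C h -> dot H (fun=> 0) h = 0.
Proof.
move=> Ch; have := dotP 1 (carrier0 H) (carrier0 H) Ch.
by rewrite mulr0 addr0 mul1r; lra.
Qed.

Lemma dotZl c f h : C f -> C h -> dot H (fun x => c * f x) h = c * dot H f h.
Proof.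
move=> Cf Ch; have := dotP c Cf (carrier0 H) Ch.
rewrite dot0l// addr0 => <-; congr dot.
by apply/funext => x; rewrite addr0.
Qed.

Lemma dotDl f1 f2 h : C f1 -> C f2 -> C h ->
  dot H (fun x => f1 x + f2 x) h = dot H f1 h + dot H f2 h.
Proof.
move=> C1 C2 Ch; rewrite -[X in X + _]mul1r -dotP//; congr dot.
by apply/funext => x; rewrite mul1r.
Qed.

Lemma dotBl f1 f2 h : C f1 -> C f2 -> C h ->
  dot H (fun x => f1 x - f2 x) h = dot H f1 h - dot H f2 h.
Proof.
move=> C1 C2 Ch; rewrite addrC -mulN1r -dotP//; congr dot.
by apply/funext => x; rewrite mulN1r addrC.
Qed.

Lemma dotBr f1 f2 h : C f1 -> C f2 -> C h ->
  dot H h (fun x => f1 x - f2 x) = dot H h f1 - dot H h f2.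
Proof.
by move=> C1 C2 Ch; rewrite dotC ?dotBl 1?(dotC Ch) 1?(dotC C2)//; exact: carrierB.
Qed.

Lemma dotDr f1 f2 h : C f1 -> C f2 -> C h ->
  dot H h (fun x => f1 x + f2 x) = dot H h f1 + dot H h f2.
Proof.
by move=> C1 C2 Ch; rewrite dotC ?dotDl 1?(dotC Ch) 1?(dotC C2)//; exact: carrierD.
Qed.

Lemma dotZr c f h : C f -> C h -> dot H h (fun x => c * f x) = c * dot H h f.
Proof.
by move=> Cf Ch; rewrite dotC ?dotZl 1?(dotC Ch)//; exact: carrierZ.
Qed.

Lemma dot_suml n (f : 'I_n -> A -> R) h : (forall i, C (f i)) -> C h ->
  dot H (fun x => \sum_i f i x) h = \sum_i dot H (f i) h.
Proof.
elim: n f => [|n IH] f Cf Ch.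
  by under eq_fun do rewrite big_ord0; rewrite big_ord0 dot0l.
under eq_fun do rewrite big_ord_recl; rewrite big_ord_recl -IH// dotDl//.
exact: carrier_sum.
Qed.

Lemma hnorm_ge0 f : 0 <= hnorm H f. Proof. exact: sqrtr_ge0. Qed.

Lemma hnorm_sqr f : C f -> hnorm H f ^+ 2 = dot H f f.
Proof. by move=> Cf; rewrite sqr_sqrtr// dot_ge0. Qed.

Lemma dot_le f h : C f -> C h -> `|dot H f h| <= hnorm H f * hnorm H h.
Proof.
move=> Cf Ch; rewrite -sqrtrM ?dot_ge0// -sqrtr_sqr ler_wsqrtr//.
apply: quad_ge0; first exact: dot_ge0.
move=> t; have := dot_ge0 (carrierP t Ch Cf).
rewrite dotP//; last exact: carrierP.
rewrite (dotC Ch (carrierP t Ch Cf)) (dotC Cf (carrierP t Ch Cf)) !dotP// (dotC Ch Cf).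
by congr (_ <= _); ring.
Qed.

Lemma hnormD f h : C f -> C h -> hnorm H (fun x => f x + h x) <= hnorm H f + hnorm H h.
Proof.
move=> Cf Ch; rewrite -[leRHS]ger0_norm ?addr_ge0 ?hnorm_ge0// -sqrtr_sqr ler_wsqrtr//.
rewrite sqrrD !hnorm_sqr// dotDl ?dotDr//; last exact: carrierD.
have := ler_norm (dot H f h); have := dot_le Cf Ch; rewrite (dotC Ch Cf) mulr2n; lra.
Qed.

Lemma hnormZ c f : C f -> hnorm H (fun x => c * f x) = `|c| * hnorm H f.
Proof.
move=> Cf; rewrite /hnorm dotZl ?dotZr//; last exact: carrierZ.
by rewrite mulrA sqrtrM ?sqr_ge0// sqrtr_sqr.
Qed.

Lemma carrier_comb n (a : 'I_n -> A) (c : 'I_n -> R) :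
  C (fun x => \sum_i c i * K (a i) x).
Proof. by apply: carrier_sum => i; apply: carrierZ; exact: carrier_kernel. Qed.

Lemma dot_comb n (a : 'I_n -> A) (c : 'I_n -> R) f : C f ->
  dot H (fun x => \sum_i c i * K (a i) x) f = \sum_i c i * f (a i).
Proof.
move=> Cf; rewrite dot_suml//; last by move=> i; apply/carrierZ/carrier_kernel.
apply: eq_bigr => i _; rewrite dotZl ?(reproducing (a i) Cf)//.
  by rewrite dotC//; exact: carrier_kernel.
exact: carrier_kernel.
Qed.

Lemma rkhs_sym x y : K x y = K y x.
Proof.
rewrite (reproducing y (carrier_kernel H x)) dotC; try exact: carrier_kernel.
by rewrite -reproducing//; exact: carrier_kernel.
Qed.

Lemma kform_dot n (a : 'I_n -> A) (c : 'I_n -> R) :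
  kform K a c = hnorm H (fun x => \sum_i c i * K (a i) x) ^+ 2.
Proof.
rewrite hnorm_sqr ?dot_comb; try exact: carrier_comb.
apply: eq_bigr => i _; rewrite big_distrr/=; apply: eq_bigr => j _.
by rewrite -mulrA; congr (_ * (_ * _)); exact: rkhs_sym.
Qed.

Lemma rkhs_kernel : is_kernel K.
Proof.
split; first exact: rkhs_sym.
by move=> n a c; have := kform_dot a c; rewrite /kform => ->; exact: sqr_ge0.
Qed.

Lemma carrier_rk_le f : C f -> rk_le K f (hnorm H f).
Proof.
move=> Cf; split; first exact: hnorm_ge0.
move=> n a c; rewrite -dot_comb// kform_dot sqrtr_sqr (ger0_norm (hnorm_ge0 _)) mulrC.
by apply: dot_le => //; exact: carrier_comb.
Qed.

Lemma rk_le_comb n (a : 'I_n -> A) (c : 'I_n -> R) :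
  rk_le K (fun x => \sum_i c i * K (a i) x) (Num.sqrt (kform K a c)).
Proof.
have := carrier_rk_le (carrier_comb a c).
by rewrite kform_dot sqrtr_sqr ger0_norm ?hnorm_ge0.
Qed.

Lemma dot0r h : C h -> dot H h (fun=> 0) = 0.
Proof. by move=> Ch; rewrite dotC ?dot0l//; exact: carrier0. Qed.

Lemma hnorm0 : hnorm H (fun=> 0) = 0.
Proof. by rewrite /hnorm dot0l ?sqrtr0//; exact: carrier0. Qed.

Lemma hnorm_lin c f h : C f -> C h -> hnorm H (fun x => c * f x + h x) ^+ 2 =
  c ^+ 2 * hnorm H f ^+ 2 + 2 * c * dot H f h + hnorm H h ^+ 2.
Proof.
move=> Cf Ch; have Cc := carrierP c Cf Ch.
rewrite !hnorm_sqr// dotP// (dotC Cf Cc) (dotC Ch Cc) !dotP// (dotC Ch Cf); ring.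
Qed.

(* Riesz representation on a subspace given by the graph D of the functional;
   the representer is a limit of elements of the subspace. *)
Lemma riesz_graph (D : (A -> R) -> R -> Prop) (M : R) : 0 <= M ->
  D (fun=> 0) 0 ->
  (forall c f h r s, D f r -> D h s -> D (fun x => c * f x + h x) (c * r + s)) ->
  (forall f r, D f r -> C f /\ `|r| <= M * hnorm H f) ->
  exists g, [/\ C g, hnorm H g <= M,
    forall f r, D f r -> dot H g f = r &
    forall eps, 0 < eps -> exists f r, D f r /\ hnorm H (fun x => g x - f x) < eps].
Proof.
move=> M0 D0 Dlin DC.
(* The energy |f|^2 - 2 r, whose minimising sequences converge to the representer; the bound by M
   keeps it above - M^2. *)
pose J (fr : (A -> R) * R) := hnorm H fr.1 ^+ 2 - 2 * fr.2.
pose S := [set J fr | fr in [set fr | D fr.1 fr.2]].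
have Slb : lbound S (- M ^+ 2).
  move=> _ [[f r] /= /DC[Cf rf] <-]; rewrite /J/=.
  have := ler_norm r; have := sqr_ge0 (hnorm H f - M); rewrite sqrrB mulr2n; lra.
have hS : has_inf S.
  by split; [exists (J ((fun=> 0), 0)), ((fun=> 0), 0)|exists (- M ^+ 2)].
have I_le f r : D f r -> inf S <= J (f, r).
  by move=> Dfr; apply: ge_inf; [exists (- M ^+ 2)|exists (f, r)].
have ex n : {fr | D fr.1 fr.2 /\ J fr < inf S + n.+1%:R^-1}.
  apply: cid; have n0 : (0 : R) < n.+1%:R^-1 by rewrite invr_gt0.
  by have [_ [fr Dfr <-] Jfr] := inf_adherent n0 hS; exists fr.
pose f n := (sval (ex n)).1; pose r n := (sval (ex n)).2.
have Df n : D (f n) (r n) by rewrite /f /r; case: (ex n) => -[? ?] [].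
have Cf n : C (f n) by case: (DC _ _ (Df n)).
have Jf n : hnorm H (f n) ^+ 2 - 2 * r n < inf S + n.+1%:R^-1.
  by rewrite /f /r; case: (ex n) => -[? ?] [].
(* Parallelogram law: the energy of the midpoint is at least the infimum, so almost minimal elements
   are close to each other. *)
have para m n : hnorm H (f m \- f n) ^+ 2 <= 2 * m.+1%:R^-1 + 2 * n.+1%:R^-1.
  have Cs := carrierP 1 (Cf m) (Cf n).
  have := I_le _ _ (Dlin 2^-1 _ _ _ _ (Dlin 1 _ _ _ _ (Df m) (Df n)) D0).
  rewrite /J/= hnorm_lin//; last exact: carrier0.
  rewrite dot0r// hnorm_lin// hnorm0.
  have := Jf m; have := Jf n.
  have -> : (f m \- f n) = (fun x => -1 * f n x + f m x).
    by apply/funext => x; rewrite mulN1r addrC.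
  rewrite hnorm_lin// (dotC (Cf n) (Cf m)).
  by move: (m.+1%:R^-1) (n.+1%:R^-1) => dm dn; rewrite expr1n sqrrN expr1n expr0n/=; lra.
have [g Cg fg] : exists2 g, C g & (fun n => hnorm H (f n \- g)) @ \oo --> (0 : R).
  apply: carrier_complete => // eps e0.
  have e2 : 0 < eps ^+ 2 / 4 by rewrite divr_gt0 ?exprn_gt0.
  have [N HN] := natinv_small e2.
  exists N => m n Nm Nn; rewrite -/(hnorm H _).
  rewrite -[ltRHS]ger0_norm ?ltW// -sqrtr_sqr /hnorm ltr_sqrt ?exprn_gt0//.
  rewrite -hnorm_sqr; last exact: carrierB.
  apply: le_lt_trans (para m n) _.
  have := HN _ Nm; have := HN _ Nn.
  by move: (m.+1%:R^-1) (n.+1%:R^-1) => dm dn; lra.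
have dotf h : C h -> (fun n => dot H (f n) h) @ \oo --> dot H g h.
  move=> Ch; apply/cvgrPdist_le => eps e0.
  have e1 : 0 < eps / (hnorm H h + 1) by rewrite divr_gt0// ltr_wpDl ?hnorm_ge0.
  have /cvgrPdist_le/(_ _ e1) := fg; apply: filterS => n.
  rewrite sub0r normrN ger0_norm ?hnorm_ge0// => fgn.
  rewrite distrC -dotBl//; apply: le_trans (dot_le _ Ch) _; first exact: carrierB.
  have := hnorm_ge0 h; have := fgn; rewrite ler_pdivlMr ?ltr_wpDl ?hnorm_ge0//.
  have := hnorm_ge0 (f n \- g); nra.
have gD h s : D h s -> dot H g h = s.
  move=> Dhs; have [Ch _] := DC _ _ Dhs.
  (* First variation: moving the minimising sequence by t h cannot bring the energy below its
     infimum. As this holds for every t, the linear coefficient vanishes. *)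
  suff H0 t : 0 <= 2 * t * (dot H g h - s) + t ^+ 2 * hnorm H h ^+ 2.
    have : (dot H g h - s) ^+ 2 <= 0 * hnorm H h ^+ 2.
      by apply: quad_ge0 => [|t]; [exact: sqr_ge0|rewrite add0r].
    by rewrite mul0r => s0; apply/eqP; rewrite -subr_eq0 -sqrf_eq0 eq_le s0 sqr_ge0.
  rewrite -oppr_le0.
  have cv : (fun n => - (2 * t * (dot H (f n) h - s) + t ^+ 2 * hnorm H h ^+ 2) -
      n.+1%:R^-1) @ \oo --> - (2 * t * (dot H g h - s) + t ^+ 2 * hnorm H h ^+ 2) - 0.
    apply: cvgB; last exact: cvg_harmonic.
    apply: cvgN; apply: cvgD; last exact: cvg_cst.
    by apply: cvgMr; apply: cvgB; [exact: dotf|exact: cvg_cst].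
  rewrite subr0 in cv; apply: (cvgr_le_cst _ cv); apply: nearW => n.
  have := I_le _ _ (Dlin t _ _ _ _ Dhs (Df n)); have := Jf n.
  by rewrite /J/= hnorm_lin// (dotC Ch (Cf n)); move: (n.+1%:R^-1) => dn; lra.
exists g; split=> //.
- have [->//|g0] := eqVneq (hnorm H g) 0.
  have gp : 0 < hnorm H g by rewrite lt_def g0 hnorm_ge0.
  rewrite -(ler_pM2r gp) -expr2 hnorm_sqr//.
  have cv1 := dotf _ Cg.
  have cv2 : (fun n => M * hnorm H (f n \- g)) @ \oo --> M * 0.
    by apply: cvgMr; exact: fg.
  rewrite mulr0 in cv2.
  have cv : (fun n => dot H (f n) g - M * hnorm H (f n \- g)) @ \oo --> dot H g g - 0.
    exact: cvgB.
  rewrite subr0 in cv; apply: (cvgr_le_cst _ cv); apply: nearW => n.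
  have := hnormD (carrierB (Cf n) Cg) Cg.
  rewrite (_ : (fun x => _ + _) = f n); last by apply/funext => x; rewrite subrK.
  have := ler_norm (r n); have [_] := DC _ _ (Df n).
  rewrite dotC// (gD _ _ (Df n)) => rM rn fn.
  have := ler_wpM2l M0 fn; rewrite mulrDr; lra.
- move=> eps e0; have /cvgrPdist_lt/(_ _ e0)[N _ /(_ N (leqnn _))] := fg.
  rewrite sub0r normrN ger0_norm ?hnorm_ge0// => fgN.
  exists (f N), (r N); split=> //; rewrite (_ : (fun x => _) = (fun x => -1 * (f N x - g x) )).
    by rewrite hnormZ ?normrN1 ?mul1r//; exact: carrierB.
  by apply/funext => x; rewrite mulN1r opprB.
Qed.

(** The bound makes sum_i c_i K(a_i) -> sum_i c_i f(a_i) a bounded functional on the span of the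
    kernel functions; given by its graph, it need not be shown single-valued beforehand. Its
    representer takes the values of f by the reproducing property. *)
Lemma rk_le_carrier f M : rk_le K f M -> C f /\ hnorm H f <= M.
Proof.
move=> [M0 Hf].
pose D h s := exists n (a : 'I_n -> A) (c : 'I_n -> R),
  h = (fun x => \sum_i c i * K (a i) x) /\ s = \sum_i c i * f (a i).
have [|||g [Cg gM gD _]] := @riesz_graph D M M0.
(* The empty combination, with points by ex falso since [A] may be empty. *)
- exists 0%N, (fun i : 'I_0 => False_rect A (notF (ltn_ord i))), (fun=> 0).
  by rewrite big_ord0; split=> //; apply/funext => x; rewrite big_ord0.
- move=> c _ _ _ _ [n [a [b [-> ->]]]] [m [a' [b' [-> ->]]]].
  exists (n + m)%N, (fun i : 'I_(n + m) => match fintype.split i with inl j => a j | inr j => a' j end),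
    (fun i : 'I_(n + m) => match fintype.split i with inl j => c * b j | inr j => b' j end).
  have E (F G : A -> R) : (forall y, F y = G y) ->
      c * (\sum_i b i * F (a i)) + \sum_i b' i * F (a' i) =
      \sum_(i < n + m) (match fintype.split i with inl j => c * b j | inr j => b' j end) *
              G (match fintype.split i with inl j => a j | inr j => a' j end).
    move=> FG; rewrite big_split_ord/= big_distrr/=; congr (_ + _); apply: eq_bigr => i _.
      by rewrite -/(unsplit (inl i)) unsplitK FG mulrA.
    by rewrite -/(unsplit (inr i)) unsplitK FG.
  split; last exact: (E f f).
  by apply/funext => x; exact: (E (K^~ x) (K^~ x)).
- move=> _ _ [n [a [c [-> ->]]]]; split; first exact: carrier_comb.
  have := Hf n a c.
  by rewrite (kform_dot a c) sqrtr_sqr (ger0_norm (hnorm_ge0 _)).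
suff <- : g = f by [].
apply/funext => x; rewrite (reproducing x Cg).
rewrite (gD _ (f x))//; exists 1%N, (fun=> x), (fun=> 1).
by rewrite big_ord1 mul1r; split=> //; apply/funext => y; rewrite big_ord1 mul1r.
Qed.

Lemma rk_le_diagP x : rk_le K (K x) (Num.sqrt (K x x)).
Proof.
have := carrier_rk_le (carrier_kernel H x).
by rewrite /hnorm -reproducing//; exact: carrier_kernel.
Qed.

End RKHS.

(** * Mixed differences of feature maps *)

Section EuclideanNorm.
Variables (R : realType) (n : nat).
Implicit Types u v : 'rV[R]_n.

Lemma enorm_ge0 v : 0 <= enorm v.
Proof. exact: sqrtr_ge0. Qed.

Lemma enorm_sum_ge0 v : 0 <= \sum_i v 0 i ^+ 2.
Proof. by apply: sumr_ge0 => i _; exact: sqr_ge0. Qed.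

Lemma enorm0 : enorm (0 : 'rV[R]_n) = 0.
Proof.
by rewrite /enorm big1 ?sqrtr0// => i _; rewrite mxE expr0n.
Qed.

Lemma enormZ c v : enorm (c *: v) = `|c| * enorm v.
Proof.
rewrite /enorm -sqrtr_sqr -sqrtrM ?sqr_ge0// big_distrr/=; congr Num.sqrt.
by apply: eq_bigr => i _; rewrite mxE exprMn.
Qed.

Lemma enormN v : enorm (- v) = enorm v.
Proof. by rewrite -scaleN1r enormZ normrN1 mul1r. Qed.

Lemma enormD u v : enorm (u + v) <= enorm u + enorm v.
Proof.
have CS : (\sum_i u 0 i * v 0 i) ^+ 2 <= (\sum_i u 0 i ^+ 2) * (\sum_i v 0 i ^+ 2).
  apply: quad_ge0 => [|t]; first exact: enorm_sum_ge0.
  have := enorm_sum_ge0 (u + t *: v); congr (_ <= _).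
  rewrite !big_distrr/= -!big_split/=; apply: eq_bigr => i _.
  by rewrite !mxE; ring.
rewrite -[leRHS]ger0_norm ?addr_ge0 ?enorm_ge0// -sqrtr_sqr ler_wsqrtr//.
rewrite sqrrD !sqr_sqrtr ?enorm_sum_ge0//.
have -> : \sum_i (u + v) 0 i ^+ 2 = (\sum_i u 0 i ^+ 2) +
    2 * (\sum_i u 0 i * v 0 i) + \sum_i v 0 i ^+ 2.
  rewrite !big_distrr/= -!big_split/=; apply: eq_bigr => i _.
  by rewrite !mxE; ring.
have Sle : \sum_i u 0 i * v 0 i <= enorm u * enorm v.
  rewrite -sqrtrM ?enorm_sum_ge0//; apply: le_trans (ler_norm _) _.
  by rewrite -sqrtr_sqr ler_wsqrtr.
by rewrite lerD2r lerD2l [leRHS]mulr2n mulr_natl mulr2n lerD.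
Qed.

Lemma enormB u v : enorm (u - v) <= enorm u + enorm v.
Proof. by rewrite -(enormN v); exact: enormD. Qed.

Lemma coord_le_enorm v i : `|v 0 i| <= enorm v.
Proof.
rewrite -sqrtr_sqr ler_wsqrtr// (bigD1 i)//= lerDl.
by apply: sumr_ge0 => j _; exact: sqr_ge0.
Qed.

Lemma enorm_le_sum v : enorm v <= \sum_i `|v 0 i|.
Proof.
have -> : enorm v = enorm (\sum_i v 0 i *: delta_mx 0 i) by rewrite -row_sum_delta.
have : forall (r : seq 'I_n), enorm (\sum_(i <- r) v 0 i *: (delta_mx 0 i : 'rV[R]_n)) <=
    \sum_(i <- r) `|v 0 i|.
  elim=> [|i r IH]; first by rewrite !big_nil enorm0.
  rewrite !big_cons; apply: le_trans (enormD _ _) _; apply: lerD => //.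
  rewrite enormZ -[leRHS]mulr1 ler_wpM2l// /enorm (bigD1 i)//= mxE !eqxx expr1n.
  rewrite big1 ?addr0 ?sqrtr1// => j /negPf ji; rewrite mxE ji andbF expr0n//.
by apply.
Qed.

End EuclideanNorm.

Section MultiDifference.
Variables (R : realType) (P : zmodType).
Implicit Types (F G : P -> R) (l : seq P) (x v : P).

Fixpoint mdiff F l x : R :=
  if l is v :: l' then mdiff F l' (x + v) - mdiff F l' x else F x.

Lemma mdiffD F G l x : mdiff (fun y => F y + G y) l x = mdiff F l x + mdiff G l x.
Proof. by elim: l x => //= v l IH x; rewrite !IH; ring. Qed.

Lemma mdiffB F G l x : mdiff (fun y => F y - G y) l x = mdiff F l x - mdiff G l x.
Proof. by elim: l x => //= v l IH x; rewrite !IH; ring. Qed.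

Lemma mdiffZ c F l x : mdiff (fun y => c * F y) l x = c * mdiff F l x.
Proof. by elim: l x => //= v l IH x; rewrite !IH mulrBr. Qed.

Lemma mdiff_shift F v l x : mdiff (fun y => F (y + v)) l x = mdiff F l (x + v).
Proof. by elim: l x => //= w l IH x; rewrite !IH addrAC. Qed.

Lemma mdiff_cons F v l x :
  mdiff F (v :: l) x = mdiff (fun y => F (y + v) - F y) l x.
Proof. by rewrite mdiffB mdiff_shift. Qed.

End MultiDifference.

Section CubeBound.
Variables (R : realType) (P : zmodType) (A : Type) (K : A -> A -> R).
Implicit Types (F G : P -> A -> R) (l : seq (P * R)) (M N : R) (x v : P).

(* All mixed differences of F along sublists of l, at all vertices of the cube
   based at x, are bounded by M times the product of the weights. *)
Fixpoint cube_bound l F M x : Prop :=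
  if l is (v, rho) :: l' then
    [/\ cube_bound l' F M x, cube_bound l' F M (x + v) &
        cube_bound l' (fun y a => F (y + v) a - F y a) (M * rho) x]
  else rk_le K (F x) M.

Lemma cube_bound_rk_le l F M x : cube_bound l F M x ->
  rk_le K (fun a => mdiff (F^~ a) (map fst l) x) (M * \prod_(vr <- l) vr.2).
Proof.
elim: l F M x => [|[v rho] l IH] F M x /=; first by rewrite big_nil mulr1.
move=> [_ _ /IH]; rewrite big_cons mulrA/=; congr (rk_le K _ _).
by apply/funext => a; rewrite -mdiff_cons.
Qed.

Lemma cube_bound_rk_le0 l F M x : cube_bound l F M x -> rk_le K (F x) M.
Proof. by elim: l F M x => [|[v rho] l IH] F M x //= [/IH]. Qed.

Lemma cube_bound_mono l F M N x : all (fun vr => 0 <= vr.2) l -> M <= N ->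
  cube_bound l F M x -> cube_bound l F N x.
Proof.
elim: l F M N x => [|[v rho] l IH] F M N x /=; first by move=> _; exact: rk_le_mono.
move=> /andP[r0 l0] MN [H1 H2 H3].
by split; [exact: IH H1|exact: IH H2|apply: IH H3 => //; rewrite ler_wpM2r].
Qed.

Lemma cube_boundD l F G M N x : cube_bound l F M x -> cube_bound l G N x ->
  cube_bound l (fun y a => F y a + G y a) (M + N) x.
Proof.
elim: l F G M N x => [|[v rho] l IH] F G M N x /=; first exact: rk_leD.
move=> [F1 F2 F3] [G1 G2 G3]; split; [exact: IH|exact: IH|].
rewrite mulrDl; have := IH _ _ _ _ _ F3 G3; congr cube_bound.
by apply/funext => y; apply/funext => a; ring.
Qed.

Lemma cube_bound_shift l F M x v :
  cube_bound l (fun y => F (y + v)) M x <-> cube_bound l F M (x + v).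
Proof.
elim: l F M x => [//|[w rho] l IH] F M x /=.
have E : (fun y a => F (y + w + v) a - F (y + v) a) =
    (fun y => (fun y a => F (y + w) a - F y a) (y + v)).
  by apply/funext => y; apply/funext => a; rewrite addrAC.
rewrite E; split=> -[H1 H2 H3]; split.
- exact: (IH F M x).1 H1.
- by rewrite addrAC; exact: (IH F M (x + w)).1 H2.
- exact: (IH (fun y a => F (y + w) a - F y a) (M * rho) x).1 H3.
- exact: (IH F M x).2 H1.
- by apply: (IH F M (x + w)).2; rewrite addrAC.
- exact: (IH (fun y a => F (y + w) a - F y a) (M * rho) x).2 H3.
Qed.

End CubeBound.

(** The discrete product rule has two terms, op of the increment of F with the shifted G and op of F
    with the increment of G, whence one factor 2 for each direction. The shifted argument is the
    reason why [cube_bound] speaks of all vertices. A general bilinear [op] covers pointwise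
    products as well as the product with an element of degree one in the tensor algebra. *)
Lemma cube_boundM (R : realType) (P : zmodType) (A1 A2 A3 : Type)
    (K1 : A1 -> A1 -> R) (K2 : A2 -> A2 -> R) (K3 : A3 -> A3 -> R)
    (op : (A1 -> R) -> (A2 -> R) -> A3 -> R) :
  (forall f f' g a, op (fun b => f b - f' b) g a = op f g a - op f' g a) ->
  (forall f g g' a, op f (fun b => g b - g' b) a = op f g a - op f g' a) ->
  (forall f g C D, rk_le K1 f C -> rk_le K2 g D -> rk_le K3 (op f g) (C * D)) ->
  forall (l : seq (P * R)) F G M N x,
  all (fun vr => 0 <= vr.2) l ->
  cube_bound K1 l F M x -> cube_bound K2 l G N x ->
  cube_bound K3 l (fun y => op (F y) (G y)) (2 ^+ size l * M * N) x.
Proof.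
move=> opBl opBr op_le; elim=> [|[v rho] l IH] F G M N x /=.
  by move=> _; rewrite expr0 mul1r; exact: op_le.
move=> /andP[r0 l0] [F1 F2 F3] [G1 G2 G3].
have M0 := rk_le_ge0 (cube_bound_rk_le0 F1).
have N0 := rk_le_ge0 (cube_bound_rk_le0 G1).
have le : 2 ^+ size l * M * N <= 2 ^+ (size l).+1 * M * N.
  by rewrite ler_wpM2r// ler_wpM2r// exprS ler_peMl ?exprn_ge0// ler1n.
split; [by apply: cube_bound_mono le _ => //; exact: IH|
        by apply: cube_bound_mono le _ => //; exact: IH|].
have G2' : cube_bound K2 l (fun y => G (y + v)) N x by apply/cube_bound_shift.
have := cube_boundD (IH _ _ _ _ _ l0 F3 G2') (IH _ _ _ _ _ l0 F1 G3).
rewrite (_ : _ + _ = 2 ^+ (size l).+1 * M * N * rho); last by rewrite exprS; ring.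
congr cube_bound; apply/funext => y; apply/funext => a.
by rewrite opBl opBr; ring.
Qed.

Section SmoothFeature.
Variables (R : realType) (n : nat) (A : Type) (K : A -> A -> R).
Implicit Types (Phi : 'rV[R]_n -> A -> R) (C : R).

(** Stands for m - 1 bounded derivatives, the last one Lipschitz continuous, of a map into the RKHS
    of [K]. *)
Definition diff_bounded m Phi C : Prop :=
  forall (l : seq 'rV[R]_n) y, (size l <= m)%N ->
    rk_le K (fun a => mdiff (Phi^~ a) l y) (C * \prod_(v <- l) enorm v).

Lemma diff_bounded_step m Phi C v : diff_bounded m.+1 Phi C ->
  diff_bounded m (fun y a => Phi (y + v) a - Phi y a) (C * enorm v).
Proof.
move=> H l y lm; have := H (v :: l) y lm.
rewrite big_cons mulrA; congr (rk_le K _ _); apply/funext => a.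
exact: mdiff_cons.
Qed.

Lemma diff_bounded_shift m Phi C v : diff_bounded m Phi C ->
  diff_bounded m (fun y => Phi (y + v)) C.
Proof.
move=> H l y lm; have := H l (y + v) lm; congr (rk_le K _ _).
by apply/funext => a; rewrite -mdiff_shift.
Qed.

Lemma diff_boundedW m m' Phi C : (m' <= m)%N -> diff_bounded m Phi C ->
  diff_bounded m' Phi C.
Proof. by move=> mm H l y lm; apply: H; exact: leq_trans mm. Qed.

Lemma diff_bounded_mono m Phi C D : C <= D -> diff_bounded m Phi C ->
  diff_bounded m Phi D.
Proof.
move=> CD H l y lm; apply: rk_le_mono (H l y lm); rewrite ler_wpM2r//.
by apply: prodr_ge0 => v _; exact: enorm_ge0.
Qed.

Variables (P : zmodType).

Lemma cube_bound_comp m Phi C (ev : P -> 'rV[R]_n) l x :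
  {morph ev : y z / y + z} -> (size l <= m)%N ->
  diff_bounded m Phi C -> 0 <= C -> all (fun vr => enorm (ev vr.1) <= vr.2) l ->
  cube_bound K l (fun y => Phi (ev y)) C x.
Proof.
move=> evD; elim: l m Phi C x => [|[v rho] l IH] m Phi C x /=.
  by move=> _ H _ _; have := H [::] (ev x) isT; rewrite big_nil mulr1.
case: m => // m lm H C0 /andP[vr lr].
have Cm := IH m.+1 Phi C _ (leqW lm) H C0 lr.
split=> //.
have Hs := diff_bounded_mono (ler_wpM2l C0 vr) (diff_bounded_step (ev v) H).
have r0 : 0 <= C * rho by rewrite mulr_ge0// (le_trans (enorm_ge0 _) vr).
have := IH _ _ _ x lm Hs r0 lr; congr cube_bound.
by apply/funext => y; apply/funext => a; rewrite evD.
Qed.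

(** One order of smoothness pays for the small factor delta. Along v, the function splits into the
    same expression for the increment of [Phi] by ev1 v, and into [Phi] compared at ev2 y + ev1 v
    and ev2 y + ev2 v. At the vertex x + v the two evaluations are at most 2 delta apart. One factor
    2 for each direction covers both effects. In the application, ev1 and ev2 evaluate a path at
    neighbouring grid points. *)
Lemma cube_bound_compB m Phi C (ev1 ev2 : P -> 'rV[R]_n) l (delta : R) x :
  {morph ev1 : y z / y + z} -> {morph ev2 : y z / y + z} -> (size l <= m)%N ->
  diff_bounded m.+1 Phi C -> 0 <= C -> enorm (ev1 x - ev2 x) <= delta ->
  (forall vr, vr \in l -> [/\ enorm (ev1 vr.1) <= vr.2,
     enorm (ev2 vr.1) <= vr.2, vr.2 <= 1 &
     enorm (ev1 vr.1 - ev2 vr.1) <= delta * vr.2]) ->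
  cube_bound K l (fun y a => Phi (ev1 y) a - Phi (ev2 y) a)
    (C * delta * 2 ^+ size l) x.
Proof.
move=> ev1D ev2D; elim: l m Phi C delta x => [|[v rho] l IH] m Phi C delta x /=.
  move=> _ H C0 d0 _; have := H [:: ev1 x - ev2 x] (ev2 x) isT.
  rewrite big_cons big_nil !mulr1; set f1 := (fun a => _); set f2 := (fun a => _).
  have -> : f1 = f2 by apply/funext => a; rewrite /f1/f2/= [ev2 x + _]addrC subrK.
  by apply: rk_le_mono; rewrite ler_wpM2l.
case: m => // m lm H C0 xd Hl.
have [v1 v2 rho1 v12] := Hl (v, rho) (mem_head _ _).
have {}Hl vr : vr \in l -> [/\ enorm (ev1 vr.1) <= vr.2,
     enorm (ev2 vr.1) <= vr.2, vr.2 <= 1 &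
     enorm (ev1 vr.1 - ev2 vr.1) <= delta * vr.2].
  by move=> vl; apply: Hl; rewrite inE vl orbT.
rewrite /= in v1 v2 rho1 v12.
have rho0 : 0 <= rho by rewrite (le_trans (enorm_ge0 _) v1).
have d0 : 0 <= delta by rewrite (le_trans (enorm_ge0 _) xd).
have all0 : all (fun vr => 0 <= vr.2) l.
  by apply/allP => vr /Hl[+ _ _ _]; apply: le_trans; exact: enorm_ge0.
have p0 : 0 <= 2 ^+ size l :> R by rewrite exprn_ge0.
have p1 : 1 <= 2 ^+ size l :> R by rewrite exprn_ege1// ler1n.
have Cd0 : 0 <= C * delta by rewrite mulr_ge0.
split.
- apply: (@cube_bound_mono _ _ _ _ _ _ (C * delta * 2 ^+ size l)) => //.
    by rewrite exprS mulrCA ler_peMl ?mulr_ge0 ?ler1n.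
  exact: (IH m.+1 Phi C delta x (leqW lm)).
- apply: (@cube_bound_mono _ _ _ _ _ _ (C * (delta * 2) * 2 ^+ size l)) => //.
    by rewrite exprS mulrA mulrA.
  apply: (IH m.+1 Phi C (delta * 2) (x + v) (leqW lm)) => //.
    rewrite ev1D ev2D opprD addrACA; apply: le_trans (enormD _ _) _.
    rewrite mulr_natr mulr2n lerD// (le_trans v12)// ler_piMr//.
  move=> vr /Hl[h1 h2 h3 h4]; split=> //; apply: le_trans h4 _.
  rewrite -mulrA ler_wpM2l// ler_peMl ?ler1n// (le_trans (enorm_ge0 _) h1)//.
have Hs : diff_bounded m.+1 (fun y a => Phi (y + ev1 v) a - Phi y a) (C * rho).
  exact: diff_bounded_mono (ler_wpM2l C0 v1) (diff_bounded_step (ev1 v) H).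
have Hw : diff_bounded m (fun y a => Phi (y + ev2 v + (ev1 v - ev2 v)) a - Phi (y + ev2 v) a)
    (C * (delta * rho)).
  apply: diff_bounded_mono (ler_wpM2l C0 v12) _.
  have := diff_bounded_step (ev1 v - ev2 v) (diff_bounded_shift (ev2 v) (diff_boundedW (leqnSn m.+1) H)).
  congr diff_bounded; apply/funext => y; apply/funext => a.
  by rewrite addrAC.
have Cr0 : 0 <= C * rho by rewrite mulr_ge0.
have B1 := IH m _ (C * rho) delta x lm Hs Cr0 xd Hl.
have B2 := @cube_bound_comp m _ (C * (delta * rho)) ev2 l x ev2D lm Hw _ _.
have {}B2 := B2 (mulr_ge0 C0 (mulr_ge0 d0 rho0)) _.
have {}B2 : cube_bound K l (fun y a => Phi (ev2 y + ev2 v + (ev1 v - ev2 v)) a -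
    Phi (ev2 y + ev2 v) a) (C * (delta * rho)) x.
  by apply: B2; apply/allP => vr /Hl[].
have := cube_boundD B1 B2.
have le : C * rho * delta * 2 ^+ size l + C * (delta * rho) <=
    C * delta * 2 ^+ (size l).+1 * rho.
  rewrite exprS; have := ler_wpM2l (mulr_ge0 Cd0 rho0) p1; lra.
move/(cube_bound_mono all0 le); congr cube_bound.
apply/funext => y; apply/funext => a; rewrite ev1D ev2D.
rewrite [ev2 y + ev2 v + _]addrA [_ + ev1 v - ev2 v]addrAC addrK; ring.
Qed.

End SmoothFeature.

Lemma is_derive_o (R : realType) (f : R -> R) (x d : R) :
  (forall eps, 0 < eps -> \forall h \near (0 : R),
     `|f (x + h) - f x - h * d| <= eps * `|h|) ->
  is_derive x 1 f d.
Proof.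
move=> H.
have cv : (fun h => h^-1 *: (f (h *: 1 + x) - f x)) @ 0^' --> d.
  apply/cvgrPdist_le => eps e0.
  have Hn : \forall h \near 0^', `|f (x + h) - f x - h * d| <= eps * `|h|.
    by apply: nbhs_dnbhs; exact: H.
  near=> h.
  have h0 : h != 0 by near: h; exact: nbhs_dnbhs_neq.
  have Hh : `|f (x + h) - f x - h * d| <= eps * `|h| by near: h.
  rewrite distrC -(ler_pM2r (_ : 0 < `|h|)) ?normr_gt0// -normrM.
  apply: le_trans Hh; rewrite scaler1 [h + x]addrC.
  by rewrite mulrBl [_ *: _]mulrC mulfVK// [d * h]mulrC.
split; first by apply/cvg_ex; exists d.
exact: cvg_lim.
Unshelve. all: by end_near. Qed.

(** * From derivatives of feature maps to difference bounds *)

Section MeanValue.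
Variables (R : realType) (n : nat).
Implicit Types (F : 'rV[R]_n -> R) (u y : 'rV[R]_n).

Definition line_derive F F' u : Prop := forall y (s : R),
  is_derive s 1 (fun s => F (y + s *: u)) (F' (y + s *: u)).

Lemma line_derive_mdiff F F' u l :
  line_derive F F' u -> line_derive (mdiff F l) (mdiff F' l) u.
Proof.
move=> H; elim: l => [//|v l IH] y s /=.
have -> : (fun s => mdiff F l (y + s *: u + v) - mdiff F l (y + s *: u)) =
    (fun s => mdiff F l (y + v + s *: u) - mdiff F l (y + s *: u)).
  by apply/funext => t; rewrite addrAC.
by rewrite addrAC; exact: is_deriveB.
Qed.

Lemma line_mvt F F' u (c t : R) y : line_derive F F' u ->
  (forall y, `|F' y| <= c) -> `|F (y + t *: u) - F y| <= c * `|t|.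
Proof.
move=> H Hc.
have mvt a b : a <= b -> `|F (y + b *: u) - F (y + a *: u)| <= c * `|b - a|.
  move=> ab.
  have [||s _ /= ->] := @MVT_segment R (fun s => F (y + s *: u)) (fun s => F' (y + s *: u)) a b ab.
  - by move=> s _; exact: H.
  - by apply: derivable_within_continuous => s _; case: (H y s).
  by rewrite normrM ler_wpM2r.
have [t0|/ltW t0] := leP 0 t; first by have := mvt _ _ t0; rewrite scale0r addr0 subr0.
by have := mvt _ _ t0; rewrite scale0r addr0 sub0r normrN distrC.
Qed.

Variables (A : Type) (K : A -> A -> R).

(** The scalar mean value theorem is applied to each finite combination of values, so that
    derivatives of the functions y -> Phi y a suffice, in place of a derivative with values in a
    Hilbert space. *)
Lemma rk_le_mvt (Phi Phi' : 'rV[R]_n -> A -> R) u l (C : R) :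
  (forall a, line_derive (Phi^~ a) (Phi'^~ a) u) ->
  (forall y, rk_le K (fun a => mdiff (Phi'^~ a) l y) C) ->
  forall y, rk_le K (fun a => mdiff (Phi^~ a) (u :: l) y) C.
Proof.
move=> HD HC y; split; first by case: (HC y).
move=> m a c.
have := @line_mvt (fun y => \sum_i c i * mdiff (Phi^~ (a i)) l y)
  (fun y => \sum_i c i * mdiff (Phi'^~ (a i)) l y) u (C * Num.sqrt (kform K a c)) 1 y.
rewrite scale1r normr1 mulr1 -sumrB (eq_bigr (fun i => c i * mdiff (Phi^~ (a i)) (u :: l) y)); last first.
  by move=> i _; rewrite mulrBr.
apply; last by move=> z; case: (HC z) => _; apply.
move=> z s.
have HL i := line_derive_mdiff l (HD (a i)).
elim: m a c {HC} HL => [|m IH] a c HL.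
  rewrite big_ord0; under eq_fun do rewrite big_ord0; exact: is_derive_cst.
rewrite big_ord_recl; under eq_fun do rewrite big_ord_recl.
have := is_deriveD (is_deriveZ (c ord0) (HL ord0 z s)) (IH (a \o lift ord0) (c \o lift ord0) (fun i => HL (lift ord0 i))).
exact.
Qed.

End MeanValue.

Lemma norm_near0_line (R : realType) n (u : 'rV[R]_n) (U : set 'rV[R]_n) :
  nbhs (0 : 'rV[R]_n) U -> \forall s \near (0 : R), U (s *: u).
Proof.
move=> HU.
have : (fun s : R => s *: u) @ (0 : R) --> (0 : R) *: u.
  by apply: cvgZr_tmp; exact: cvg_id.
by rewrite scale0r; apply.
Qed.

(** Derivatives in the RKHS norm are derivatives at each point a by the reproducing property. The
    mean value inequality trades the two derivatives for two differences, and the Lipschitz bound of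
    the second derivative supplies the third. *)
Lemma assumption_F_diff_bounded (R : realType) n (K : 'rV[R]_n -> 'rV[R]_n -> R)
    (H : rkhs K) : assumption_F H -> exists C, diff_bounded K 3 K C.
Proof.
move=> [L [D1 [D2 [[CD1 CD2 linD1 linD2 linD2'] diff1 diff2 [bK bD1 bD2] [LK LD1 LD2]]]]].
have L0 : 0 <= L by apply: le_trans (bK 0); exact: hnorm_ge0.
have CK a := carrier_kernel H a.
exists L.
have ptwise f a (c : R) : carrier H f -> hnorm H f <= c ->
    `|f a| <= c * Num.sqrt (K a a).
  move=> Cf fc; rewrite (reproducing a Cf); apply: le_trans (dot_le Cf (CK a)) _.
  rewrite {2}/hnorm -(reproducing a (CK a)) ler_wpM2r ?sqrtr_ge0//.
have D1Z x s v a : D1 x (s *: v) a = s * D1 x v a.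
  have := linD1 x s v 0 a; have := linD1 x 1 0 0 a.
  by rewrite scale1r !addr0 mul1r => E; rewrite (_ : D1 x 0 a = 0) ?addr0//; lra.
have D2Z x s w v a : D2 x (s *: w) v a = s * D2 x w v a.
  have := linD2' x s w 0 v a; have := linD2' x 1 0 0 v a.
  by rewrite scale1r !addr0 mul1r => E; rewrite (_ : D2 x 0 v a = 0) ?addr0//; lra.
have der1 u a : line_derive (K^~ a) (fun x => D1 x u a) u.
  move=> y s; apply: is_derive_o => eps e0.
  pose c := enorm u * Num.sqrt (K a a) + 1.
  have c0 : 0 < c by rewrite ltr_wpDl ?mulr_ge0 ?enorm_ge0 ?sqrtr_ge0.
  have := norm_near0_line u (diff1 (y + s *: u) _ (divr_gt0 e0 c0)).
  apply: filterS => h Hh.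
  rewrite scalerDl addrA -D1Z.
  have Cf := carrierB (carrierB (CK (y + s *: u + h *: u)) (CK (y + s *: u))) (CD1 (y + s *: u) (h *: u)).
  have /= := ptwise _ a _ Cf Hh; move=> /le_trans; apply.
  rewrite enormZ; set k := Num.sqrt _.
  have -> : eps / c * (`|h| * enorm u) * k = eps * `|h| * (c^-1 * (enorm u * k)) by ring.
  by rewrite ler_piMr ?mulr_ge0 ?(ltW e0)// ler_pdivrMl// mulr1 lerDl.
have der2 u w a : line_derive (fun x => D1 x u a) (fun x => D2 x w u a) w.
  move=> y s; apply: is_derive_o => eps e0.
  pose c := enorm w * enorm u * Num.sqrt (K a a) + 1.
  have c0 : 0 < c by rewrite ltr_wpDl ?mulr_ge0 ?enorm_ge0 ?sqrtr_ge0.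
  have := norm_near0_line w (diff2 (y + s *: w) _ (divr_gt0 e0 c0)).
  apply: filterS => h /(_ u) Hh.
  rewrite scalerDl addrA -D2Z.
  have Cf := carrierB (carrierB (CD1 (y + s *: w + h *: w) u) (CD1 (y + s *: w) u)) (CD2 (y + s *: w) (h *: w) u).
  have /= := ptwise _ a _ Cf Hh; move=> /le_trans; apply.
  rewrite enormZ; set k := Num.sqrt _.
  have -> : eps / c * (`|h| * enorm w) * enorm u * k =
    eps * `|h| * (c^-1 * (enorm w * enorm u * k)) by ring.
  by rewrite ler_piMr ?mulr_ge0 ?(ltW e0)// ler_pdivrMl// mulr1 lerDl.
have rkB f g c : carrier H f -> carrier H g -> hnorm H (f \- g) <= c ->
    rk_le K (fun a => f a - g a) c.
  by move=> Cf Cg /rk_le_mono; apply; apply: carrier_rk_le; exact: carrierB.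
have b1 v y : rk_le K (fun a => mdiff (K^~ a) [:: v] y) (L * enorm v).
  by apply: rkB => //; apply: le_trans (LK _ _) _; rewrite addrC addKr.
have b1' u v y : rk_le K (fun a => mdiff (fun x => D1 x u a) [:: v] y) (L * enorm v * enorm u).
  by apply: rkB => //; apply: le_trans (LD1 _ _ _) _; rewrite addrC addKr.
have b2' u v w y : rk_le K (fun a => mdiff (fun x => D2 x w u a) [:: v] y)
    (L * enorm v * enorm w * enorm u).
  by apply: rkB => //; apply: le_trans (LD2 _ _ _ _) _; rewrite addrC addKr.
case=> [|u [|v [|w []]]]//= y _; rewrite ?big_cons big_nil ?mulr1.
- exact: rk_le_mono (bK y) (carrier_rk_le (CK y)).
- exact: b1.
- rewrite [enorm u * _]mulrC mulrA.
  by apply: (rk_le_mvt (u := u) (l := [:: v]) (Phi' := fun x a => D1 x u a)).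
- have -> : L * (enorm u * (enorm v * enorm w)) = L * enorm w * enorm v * enorm u by ring.
  apply: (rk_le_mvt (u := u) (l := [:: v; w]) (Phi' := fun x a => D1 x u a)) => //.
  by apply: (rk_le_mvt (u := v) (l := [:: w]) (Phi' := fun x a => D2 x v u a)).
Qed.

Section PartialDerivatives.
Variables (R : realType) (n : nat).
Implicit Types (f h : 'rV[R]_n -> R) (J : seq 'I_n) (x v : 'rV[R]_n).

Lemma shift_quotient f v x (i : 'rV[R]_n) :
  (fun h : R => h^-1 *: (((fun y => f (y + v)) \o shift x) (h *: i) - f (x + v))) =
  (fun h : R => h^-1 *: ((f \o shift (x + v)) (h *: i) - f (x + v))).
Proof. by apply/funext => h /=; rewrite addrA. Qed.

Lemma partial_shift J f v : partial_exists J f ->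
  partial_exists J (fun y => f (y + v)) /\
  partial J (fun y => f (y + v)) = (fun y => partial J f (y + v)).
Proof.
elim: J => [//|i J IH] /= [/IH[E1 E2] Hd]; split.
  by split=> // x; rewrite E2 /derivable shift_quotient; exact: Hd.
by rewrite E2; apply/funext => x; rewrite /derive shift_quotient.
Qed.

Lemma partialB J f h : partial_exists J f -> partial_exists J h ->
  partial_exists J (fun y => f y - h y) /\
  partial J (fun y => f y - h y) = (fun y => partial J f y - partial J h y).
Proof.
elim: J => [//|i J IH] /= [/[swap] df /[swap] -[/[swap] dh + +]].
move=> /[swap] /IH /[apply] -[E1 E2]; split.
  by split=> // x; rewrite E2; apply: derivableB.
by rewrite E2; apply/funext => x; rewrite deriveB.
Qed.

Definition axis (ti : R * 'I_n) : 'rV[R]_n := ti.1 *: delta_mx 0 ti.2.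

(** The head of [l] belongs to the outermost derivative: its difference is moved onto f, where the
    mean value inequality for the partial derivative of lower order applies. So derivatives are
    never interchanged. *)
Lemma partial_mvt (l : seq (R * 'I_n)) f (C : R) :
  partial_exists (map snd l) f ->
  (forall x, `|partial (map snd l) f x| <= C) ->
  forall x, `|mdiff f (map axis l) x| <= C * \prod_(ti <- l) `|ti.1|.
Proof.
elim: l f C => [|[t i] l IH] f C /=; first by move=> _ H x; rewrite big_nil mulr1.
move=> [Ef df] H x; rewrite big_cons mulrA.
rewrite -/(mdiff f (axis (t, i) :: map axis l) x) mdiff_cons.
have [E1 E2] := partial_shift (axis (t, i)) Ef.
have [E3 E4] := partialB E1 Ef.
apply: IH => // y; rewrite E4 E2.
apply: (line_mvt (F' := fun y => 'D_(delta_mx 0 i) (partial (map snd l) f) y)) => //.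
move=> z s.
have Q : (fun h : R => h^-1 *: (((fun s : R => partial (map snd l) f (z + s *: delta_mx 0 i)) \o shift s) (h *: 1) -
      partial (map snd l) f (z + s *: delta_mx 0 i))) =
    (fun h : R => h^-1 *: ((partial (map snd l) f \o shift (z + s *: delta_mx 0 i)) (h *: delta_mx 0 i) -
      partial (map snd l) f (z + s *: delta_mx 0 i))).
  by apply/funext => h /=; rewrite scaler1 scalerDl addrCA.
by split; rewrite /derivable /derive Q//; exact: df.
Qed.

Lemma partial_mdiff (g : 'rV[R]_n -> 'rV[R]_n -> R) J l x :
  (forall x, partial_exists J (g x)) ->
  partial_exists J (fun y => mdiff (g^~ y) l x) /\
  partial J (fun y => mdiff (g^~ y) l x) = (fun y => mdiff (fun x => partial J (g x) y) l x).
Proof.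
move=> H; elim: l x => [|v l IH] x /=; first by split.
have [E1 E2] := IH (x + v); have [E3 E4] := IH x.
by have [E5 E6] := partialB E1 E3; rewrite E6 E2 E4.
Qed.

(** Points and coefficients are the same for all F; this identifies the kernel form of a difference
    with a difference in both variables. *)
Lemma mdiff_comb (l : seq 'rV[R]_n) y : exists m (x : 'I_m -> 'rV[R]_n) (b : 'I_m -> R),
  forall F, mdiff F l y = \sum_i b i * F (x i).
Proof.
elim: l y => [|v l IH] y.
  by exists 1%N, (fun=> y), (fun=> 1) => F; rewrite big_ord1 mul1r.
have [m [x [b E]]] := IH (y + v); have [m' [x' [b' E']]] := IH y.
exists (m + m')%N, (fun i : 'I_(m + m') => match fintype.split i with inl j => x j | inr j => x' j end),
  (fun i : 'I_(m + m') => match fintype.split i with inl j => b j | inr j => - b' j end) => F.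
rewrite /= E E' big_split_ord/= -sumrN; congr (_ + _); apply: eq_bigr => i _.
  by rewrite -/(unsplit (inl i)) unsplitK.
by rewrite -/(unsplit (inr i)) unsplitK mulNr.
Qed.

(* A difference along a vector is a telescoping sum of differences along the axes. *)
Lemma mdiff_axes (A : Type) (K : A -> A -> R) (Phi : 'rV[R]_n -> A -> R)
    (l : seq 'rV[R]_n) (C : R) : 0 <= C ->
  (forall (l' : seq (R * 'I_n)) y, size l' = size l ->
     rk_le K (fun a => mdiff (Phi^~ a) (map axis l') y) (C * \prod_(ti <- l') `|ti.1|)) ->
  forall y, rk_le K (fun a => mdiff (Phi^~ a) l y)
    (C * n%:R ^+ size l * \prod_(v <- l) enorm v).
Proof.
elim: l Phi C => [|v l IH] Phi C C0 H y.
  by have := H [::] y erefl; rewrite !big_nil expr0 !mulr1.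
have step (I : seq 'I_n) z : rk_le K
    (fun a => mdiff (fun x => Phi (x + \sum_(i <- I) v 0 i *: delta_mx 0 i) a - Phi x a) l z)
    ((size I)%:R * (C * n%:R ^+ size l * enorm v * \prod_(v <- l) enorm v)).
  elim: I z => [|i I IHI] z.
    rewrite mul0r (_ : (fun a => _) = (fun=> 0)); first exact: rk_le0.
    apply/funext => a; under eq_fun do rewrite big_nil addr0 subrr.
    by elim: (l) z => //= w l' E z; rewrite !E subrr.
  have Hi : rk_le K (fun a => mdiff (fun x => Phi (x + axis (v 0 i, i)) a - Phi x a) l
      (z + \sum_(i <- I) v 0 i *: delta_mx 0 i))
      (C * enorm v * n%:R ^+ size l * \prod_(v <- l) enorm v).
    apply: (IH (fun x a => Phi (x + axis (v 0 i, i)) a - Phi x a)); first by rewrite mulr_ge0 ?enorm_ge0.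
    move=> l' y' sl'.
    rewrite (_ : (fun a => _) = (fun a => mdiff (Phi^~ a) (map axis ((v 0 i, i) :: l')) y')); last first.
      by apply/funext => a; exact/esym/(mdiff_cons (Phi^~ a)).
    apply: rk_le_mono (H ((v 0 i, i) :: l') y' (congr1 S sl')).
    rewrite big_cons mulrA ler_wpM2r ?ler_wpM2l ?coord_le_enorm//.
    by apply: prodr_ge0 => ? _.
  rewrite [C * enorm v * _]mulrAC in Hi.
  have -> : (size (i :: I))%:R * (C * n%:R ^+ size l * enorm v * \prod_(v <- l) enorm v) =
      C * n%:R ^+ size l * enorm v * (\prod_(v <- l) enorm v) +
      (size I)%:R * (C * n%:R ^+ size l * enorm v * \prod_(v <- l) enorm v).
    by rewrite /= -natr1; ring.
  rewrite (_ : (fun a => _) = (fun a => mdiff (fun x => Phi (x + axis (v 0 i, i)) a - Phi x a) l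
      (z + \sum_(i <- I) v 0 i *: delta_mx 0 i) +
     mdiff (fun x => Phi (x + \sum_(i <- I) v 0 i *: delta_mx 0 i) a - Phi x a) l z)).
    exact: rk_leD.
  apply/funext => a.
  rewrite -mdiff_shift -mdiffD; congr mdiff; apply/funext => x.
  by rewrite big_cons /axis/= [_ + \sum_(_ <- _) _]addrC addrA subrKA.
have := step (enum 'I_n) y.
rewrite size_enum_ord big_cons exprS.
rewrite (_ : n%:R * _ = C * (n%:R * n%:R ^+ size l) * (enorm v * \prod_(v <- l) enorm v)); last by ring.
congr (rk_le K _ _); apply/funext => a.
rewrite (mdiff_cons (Phi^~ a)); congr mdiff; apply/funext => x.
by rewrite big_enum/= -row_sum_delta.
Qed.

End PartialDerivatives.
Arguments axis {R n} ti.

(** The squared RKHS norm of a mixed difference of the feature map is the mixed difference of g with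
    the same steps in both variables. Along the axes it is controlled by the mixed derivatives up to
    order (4, 4); telescoping along the axes then gives all directions. *)
Lemma assumption_G_diff_bounded (R : realType) n (g : 'rV[R]_n -> 'rV[R]_n -> R)
    (H : rkhs g) : assumption_G g -> exists C, 0 <= C /\ diff_bounded g 4 g C.
Proof.
move=> [_ Hex Hbd].
have [C1 [C10 HC1]] : exists C1 : R, 0 <= C1 /\ forall I J : seq 'I_n, (size I <= 4)%N -> (size J <= 4)%N ->
    forall x y, `|mixed_partial I J g x y| <= C1.
  have [C' HC'] : {C' : nat -> nat -> R | forall p q, (p <= 4)%N -> (q <= 4)%N ->
      forall x y : 'rV[R]_n, Num.sqrt (\sum_(I : p.-tuple 'I_n) \sum_(J : q.-tuple 'I_n)
                      mixed_partial I J g x y ^+ 2) <= C' p q}.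
    pose Q p q C := (p <= 4)%N -> (q <= 4)%N ->
      forall x y : 'rV[R]_n, Num.sqrt (\sum_(I : p.-tuple 'I_n) \sum_(J : q.-tuple 'I_n)
                      mixed_partial I J g x y ^+ 2) <= C.
    have ex p q : {C | Q p q C}.
      apply: cid; have [p4|/negP p4] := boolP (p <= 4)%N; last by exists 0.
      have [q4|/negP q4] := boolP (q <= 4)%N; last by exists 0.
      by have [C HC] := Hbd p q p4 q4; exists C.
    by exists (fun p q => sval (ex p q)) => p q; exact: svalP (ex p q).
  exists (\sum_(p < 5) \sum_(q < 5) `|C' p q|); split; first by do 2 (apply: sumr_ge0 => ? _).
  move=> I J sI sJ x y.
  have le1 : `|mixed_partial I J g x y| <= C' (size I) (size J).
    apply: le_trans (HC' _ _ sI sJ x y); rewrite -sqrtr_sqr ler_wsqrtr//.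
    rewrite (bigD1 (in_tuple I))//= (bigD1 (in_tuple J))//= -addrA lerDl addr_ge0//.
      by apply: sumr_ge0 => ? _; exact: sqr_ge0.
    by do 2 (apply: sumr_ge0 => ? _); exact: sqr_ge0.
  apply: le_trans le1 _; apply: le_trans (ler_norm _) _.
  have sI' : (size I < 5)%N by []. have sJ' : (size J < 5)%N by [].
  rewrite (bigD1 (Ordinal sI'))//= (bigD1 (Ordinal sJ'))//= -addrA lerDl addr_ge0//.
    by apply: sumr_ge0.
  by do 2 (apply: sumr_ge0 => ? _).
pose C := Num.sqrt C1.
have ax (l' : seq (R * 'I_n)) y : (size l' <= 4)%N ->
    rk_le g (fun a => mdiff (g^~ a) (map axis l') y) (C * \prod_(ti <- l') `|ti.1|).
  move=> s4.
  have [m [x [b E]]] := mdiff_comb (map axis l') y.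
  have -> : (fun a => mdiff (g^~ a) (map axis l') y) = (fun a => \sum_i b i * g (x i) a).
    by apply/funext => a; rewrite E.
  apply: rk_le_mono (rk_le_comb H x b).
  have P0 : 0 <= \prod_(ti <- l') `|ti.1| by apply: prodr_ge0.
  rewrite -[X in _ <= _ * X](ger0_norm P0) -sqrtr_sqr /C -sqrtrM// ler_wsqrtr//.
  have -> : kform g x b = mdiff (fun y' => mdiff (g^~ y') (map axis l') y) (map axis l') y.
    rewrite E /kform exchange_big/=; apply: eq_bigr => j _.
    by rewrite E big_distrr/=; apply: eq_bigr => i _; rewrite mulrCA mulrA.
  have sz : (size (map snd l') <= 4)%N by rewrite size_map.
  have [E1 E2] := partial_mdiff (map axis l') y (fun x => (Hex [::] (map snd l') isT sz).1 x).
  apply: le_trans (ler_norm _) _; rewrite expr2 mulrA.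
  apply: partial_mvt => // y'; rewrite E2.
  apply: partial_mvt; first exact: (Hex _ _ sz sz).2.
  by move=> x'; exact: HC1.
(* The base n + 1 keeps the powers monotone in the exponent also for n = 0. *)
exists (C * n.+1%:R ^+ 4); split; first by rewrite mulr_ge0 ?sqrtr_ge0 ?exprn_ge0.
move=> l y s4.
have ax' l' y' : size l' = size l -> rk_le g (fun a => mdiff (g^~ a) (map axis l') y')
    (C * \prod_(ti <- l') `|ti.1|) by move=> e; apply: ax; rewrite e.
apply: rk_le_mono (mdiff_axes (sqrtr_ge0 C1) ax' y).
rewrite ler_wpM2r ?ler_wpM2l ?sqrtr_ge0//; first by apply: prodr_ge0 => v _; exact: enorm_ge0.
apply: (@le_trans _ _ (n.+1%:R ^+ size l)).
  by apply: lerXn2r; rewrite ?nnegrE// ler_nat.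
by rewrite ler_weXn2l// ler1n.
Qed.

(** * Riemann-Stieltjes integrals and signatures *)

Lemma real_cauchy_cvg (R : realType) (u : nat -> R) :
  (forall eps, 0 < eps -> exists N, forall m n, (N <= m)%N -> (N <= n)%N ->
     `|u m - u n| <= eps) -> cvg (u @ \oo).
Proof.
move=> H; apply/cauchy_cvgP/cauchy_exP => eps e0.
have [N HN] := H _ (divr_gt0 e0 (ltr0n R 2) : 0 < eps / 2).
exists (u N), N => // m Nm /=.
rewrite /ball/= (le_lt_trans (HN _ _ (leqnn N) Nm))//.
by rewrite ltr_pdivrMr// ltr_pMr// ltr1n.
Qed.

(** * Indefinite Riemann-Stieltjes integrals by sewing *)

Section Sewing.
Variables (R : realType) (T : R).
Hypothesis T_gt0 : 0 < T.
Implicit Types (F h V I : R -> R) (eps delta s t xi : R).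

Definition ucont F : Prop := forall eps, 0 < eps -> exists2 delta, 0 < delta &
  forall s t, 0 <= s <= T -> 0 <= t <= T -> `|s - t| < delta -> `|F s - F t| <= eps.

Definition rcontrolled V h : Prop := forall s t,
  0 <= s -> s <= t -> t <= T -> `|h t - h s| <= V t - V s.

Definition grid n i : R := i%:R / n.+1%:R * T.

Lemma grid0 n : grid n 0 = 0. Proof. by rewrite /grid !mul0r. Qed.

Lemma grid_max n : grid n n.+1 = T.
Proof. by rewrite /grid divff ?mul1r. Qed.

Lemma grid_le n i j : (i <= j)%N -> grid n i <= grid n j.
Proof. by move=> ij; rewrite /grid ler_pM2r// ler_pM2r ?invr_gt0// ler_nat. Qed.

Lemma grid_ge0 n i : 0 <= grid n i.
Proof. by rewrite -(grid0 n) grid_le. Qed.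

Lemma grid_leT n i : (i <= n.+1)%N -> grid n i <= T.
Proof. by move=> ?; rewrite -(grid_max n) grid_le. Qed.

Lemma gridS n i : grid n i.+1 - grid n i = T / n.+1%:R.
Proof. by rewrite /grid -natr1; field; rewrite addrC natr1. Qed.

Lemma mesh_small delta : 0 < delta -> exists N, forall n, (N <= n)%N -> T / n.+1%:R < delta.
Proof.
move=> d0; have [N HN] := natinv_small (divr_gt0 d0 T_gt0).
by exists N => n /HN; rewrite ltr_pdivlMr// mulrC.
Qed.

(** A grid finer than delta, truncated at t, splits [0, t] into short intervals, and the right-hand
    sides telescope. *)
Lemma le_of_cells G (W : R -> R) delta c : 0 < delta ->
  (forall s t, 0 <= s -> s <= t -> t <= T -> t - s < delta ->
     `|G t - G s| <= c * (W t - W s)) ->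
  forall t, 0 <= t <= T -> `|(G t : R) - G 0| <= c * (W t - W 0).
Proof.
move=> d0 H t /andP[t0 tT]; have [N /(_ N (leqnn _)) HN] := mesh_small d0.
pose q i := Num.min (grid N i) t.
have q0 : q 0%N = 0 by rewrite /q grid0 min_l.
have qN : q N.+1 = t by rewrite /q grid_max min_r.
rewrite -q0 -[in `|_|]qN -[in X in _ <= X]qN; elim: N.+1 => [|i IH]; first by rewrite !subrr normr0 mulr0.
have -> : G (q i.+1) - G (q 0%N) = (G (q i.+1) - G (q i)) + (G (q i) - G (q 0%N)) by ring.
apply: le_trans (ler_normD _ _) _.
have g0 := grid_ge0 N i; have gS := grid_le N (leqnSn i); have gd : grid N i.+1 - grid N i < delta by rewrite gridS.
have Hq : `|G (q i.+1) - G (q i)| <= c * (W (q i.+1) - W (q i)).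
  apply: H; rewrite /q.
  - by rewrite le_min g0 t0.
  - by rewrite le_min !ge_min lexx gS !orbT.
  - by rewrite ge_min tT orbT.
  by have [u|u] := leP (grid N i.+1) t; have [v|v] := leP (grid N i) t; lra.
lra.
Qed.

(* I is an indefinite integral of F dh, with an error that adds up over the
   intervals of a partition. *)
Definition sewn V F h I : Prop := forall eps, 0 < eps -> exists2 delta, 0 < delta &
  forall s t xi, 0 <= s -> s <= xi -> xi <= t -> t <= T -> t - s < delta ->
    `|I t - I s - F xi * (h t - h s)| <= eps * (V t - V s).

Definition grid_sum F h n t : R :=
  \sum_(0 <= i < n.+1) F (grid n i) *
    (h (Num.min (grid n i.+1) t) - h (Num.min (grid n i) t)).

(** Only the grid cells that meet [s, t] contribute. The left end of such a cell is within delta of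
    xi, because the mesh and t - s are both below delta / 2, and the increments of V over the cells
    clamped to [s, t] add up to V t - V s. *)
Lemma grid_sum_close V F h eps delta n s t xi : 0 < eps ->
  rcontrolled V h ->
  (forall s t, 0 <= s <= T -> 0 <= t <= T -> `|s - t| < delta -> `|F s - F t| <= eps) ->
  T / n.+1%:R < delta / 2 -> t - s < delta / 2 ->
  0 <= s -> s <= xi -> xi <= t -> t <= T ->
  `|grid_sum F h n t - grid_sum F h n s - F xi * (h t - h s)| <= eps * (V t - V s).
Proof.
move=> e0 Vh HF mesh ts s0 sxi xit tT.
pose cl u := Num.max s (Num.min u t).
have st := le_trans sxi xit.
have clE u : h (Num.min u t) - h (Num.min u s) = h (cl u) - h s.
  rewrite /cl; have [us|/ltW su] := leP u s.
    have ut := le_trans us st; rewrite (min_l ut) (max_l us) !subrr//.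
  by have [ut|/ltW tu] := leP u t; [rewrite max_r|rewrite max_r].
have d0 : 0 < delta by have := divr_gt0 T_gt0 (ltr0Sn R n); lra.
have telesc (G : R -> R) : \sum_(0 <= i < n.+1) (G (cl (grid n i.+1)) - G (cl (grid n i))) = G t - G s.
  rewrite telescope_sumr// grid0 grid_max /cl; congr (G _ - G _).
    by rewrite (min_r tT) max_r.
  by rewrite min_l ?(le_trans s0)// max_l.
rewrite -(telesc h) -(telesc V) /grid_sum -sumrB [F xi * _]big_distrr/= -sumrB [eps * _]big_distrr/=.
apply: le_trans (ler_norm_sum _ _ _) _; rewrite !big_mkord; apply: ler_sum => i _.
set g := grid n i; set g' := grid n i.+1.
have -> : F g * (h (Num.min g' t) - h (Num.min g t)) - F g * (h (Num.min g' s) - h (Num.min g s)) -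
     F xi * (h (cl g') - h (cl g)) = (F g - F xi) * (h (cl g') - h (cl g)).
  have := clE g'; have := clE g; move: (h (Num.min g' t)) (h (Num.min g' s)) => a b.
  move: (h (Num.min g t)) (h (Num.min g s)) => c d H1 H2.
  have -> : c = h (cl g) - h s + d by lra.
  have -> : a = h (cl g') - h s + b by lra.
  ring.
have gg' : g <= g' by exact: grid_le.
have g0 : 0 <= g by exact: grid_ge0.
have gT : g <= T by apply: grid_leT; exact: leqW (ltn_ord i).
have cs u : s <= cl u by rewrite le_max lexx.
have ct u : cl u <= t by rewrite ge_max st ge_min lexx orbT.
have cc : cl g <= cl g'.
  rewrite /cl ge_max !le_max lexx/=; apply/orP; right.
  by rewrite le_min !ge_min gg' lexx orbT.
have [E|ne] := eqVneq (cl g) (cl g'); first by rewrite E !subrr mulr0 normr0 mulr0.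
rewrite normrM ler_pM//.
  apply: HF; rewrite ?g0 ?gT ?(le_trans s0 sxi) ?(le_trans xit tT)//.
  have gS : g' - g < delta / 2 by rewrite /g' /g gridS.
  have gt : g < t.
    rewrite ltNge; apply/negP => tg; move/eqP: ne; apply; rewrite /cl.
    by rewrite !min_r// (le_trans tg).
  have sg : s < g'.
    rewrite ltNge; apply/negP => gs; move/eqP: ne; apply; rewrite /cl.
    by rewrite !max_l// ge_min ?gs ?(le_trans gg' gs).
  by rewrite ltr_norml; apply/andP; split; lra.
by apply: Vh => //; [exact: le_trans (cs _)|exact: le_trans (ct _) tT].
Qed.

(** Over a short interval the increments of two grid sums differ by at most 2 c (V t - V s), both
    being close to F(s) (h t - h s). Adding this up makes the grid sums Cauchy without comparing
    partitions through a refinement. *)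
Lemma sewn_exists V F h : ucont F -> rcontrolled V h ->
  exists I, I 0 = 0 /\ sewn V F h I.
Proof.
move=> UF Vh.
have V0 s t : 0 <= s -> s <= t -> t <= T -> 0 <= V t - V s.
  by move=> s0 st tT; apply: le_trans (Vh _ _ s0 st tT).
have S0 n : grid_sum F h n 0 = 0.
  by rewrite /grid_sum big1 // => i _; rewrite !min_r ?grid_ge0// subrr mulr0.
have close eps : 0 < eps -> exists delta N, 0 < delta /\ forall n, (N <= n)%N -> forall s t xi,
    0 <= s -> s <= xi -> xi <= t -> t <= T -> t - s < delta ->
    `|grid_sum F h n t - grid_sum F h n s - F xi * (h t - h s)| <= eps * (V t - V s).
  move=> e0; have [delta d0 HF] := UF _ e0.
  have d2 : 0 < delta / 2 by rewrite divr_gt0.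
  have [N HN] := mesh_small d2; exists (delta / 2), N; split=> // n Nn s t xi s0 sx xt tT ts.
  exact: (grid_sum_close e0 Vh HF (HN _ Nn)).
have cv t : 0 <= t <= T -> cvg ((fun n => grid_sum F h n t) @ \oo).
  move=> tT; apply: real_cauchy_cvg => eps e0.
  (* The summand 1 avoids a division by zero for a constant control. *)
  have c0 : 0 < V T - V 0 + 1 by rewrite ltr_wpDl ?V0 ?(ltW T_gt0).
  have [delta [N [d0 HN]]] := close (eps / 2 / (V T - V 0 + 1)) (divr_gt0 (divr_gt0 e0 (ltr0n R 2)) c0).
  exists N => m n Nm Nn.
  set c := eps / 2 / _ in HN.
  have c'0 : 0 < c by rewrite divr_gt0 ?divr_gt0.
  have := @le_of_cells (fun s => grid_sum F h m s - grid_sum F h n s) V delta (2 * c) d0 _ t tT.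
  rewrite !S0 !subr0 => H; apply: le_trans (H _) _.
    move=> s u s0 su uT us.
    have := HN _ Nm s u s s0 (lexx _) su uT us; have := HN _ Nn s u s s0 (lexx _) su uT us.
    by rewrite !ler_norml => /andP[? ?] /andP[? ?]; apply/andP; split; lra.
  have -> : 2 * c = eps / (V T - V 0 + 1) by rewrite /c; field; rewrite lt0r_neq0.
  rewrite mulrAC ler_pdivrMr// ler_pM2l//.
  by move/andP: tT => [t0 tT]; have := V0 _ _ t0 tT (lexx T); lra.
exists (fun t => lim ((fun n => grid_sum F h n t) @ \oo)); split.
  by under eq_fun do rewrite S0; apply: cvg_lim => //; exact: cvg_cst.
move=> eps e0; have [delta [N [d0 HN]]] := close eps e0; exists delta => // s t xi s0 sx xt tT ts.
have t0 : 0 <= t <= T by rewrite tT andbT (le_trans s0)// (le_trans sx).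
have s0' : 0 <= s <= T by rewrite s0/= (le_trans sx)// (le_trans xt).
have cvd : (fun n => `|grid_sum F h n t - grid_sum F h n s - F xi * (h t - h s)|) @ \oo -->
   `|lim ((fun n => grid_sum F h n t) @ \oo) - lim ((fun n => grid_sum F h n s) @ \oo) - F xi * (h t - h s)|.
  by apply: cvg_norm; apply: cvgB; [apply: cvgB; exact: cv|exact: cvg_cst].
apply: (cvgr_le_cst _ cvd); exists N => // n /= Nn; exact: HN.
Qed.

Lemma rcontrolled_ge0 V h s t : rcontrolled V h -> 0 <= s -> s <= t -> t <= T ->
  0 <= V t - V s.
Proof. by move=> Vh s0 st tT; apply: le_trans (Vh _ _ s0 st tT). Qed.

Lemma sewn_bounded V F h I B : rcontrolled V h -> sewn V F h I -> I 0 = 0 ->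
  (forall t, 0 <= t <= T -> `|F t| <= B) ->
  forall t, 0 <= t <= T -> `|I t| <= (B + 1) * (V T - V 0).
Proof.
move=> Vh HI I0 FB t tT.
have [delta d0 Hd] := HI 1 ltr01.
have := @le_of_cells I V delta (B + 1) d0 _ t tT; rewrite I0 subr0.
move=> H; apply: le_trans (H _) _.
  move=> u v u0 uv vT uvd.
  have Fu : `|F u| <= B by apply: FB; rewrite u0 (le_trans uv).
  have := Hd u v u u0 (lexx _) uv vT uvd; have := Vh u v u0 uv vT.
  move=> h1 h2; rewrite -(subrK (F u * (h v - h u)) (I v - I u)).
  apply: le_trans (ler_normD _ _) _; rewrite normrM mulrDl addrC lerD//.
  exact: ler_pM.
move/andP: tT => [t0 tT]; rewrite ler_wpM2l//.
  have := FB 0; rewrite lexx (ltW T_gt0) => /(_ isT); have := normr_ge0 (F 0); lra.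
have := rcontrolled_ge0 Vh t0 tT (lexx T); lra.
Qed.

Lemma sewn_ucont V F h I B : rcontrolled V h -> ucont h -> sewn V F h I ->
  (forall t, 0 <= t <= T -> `|F t| <= B) -> ucont I.
Proof.
move=> Vh Uh HI FB eps e0.
have VT0 := rcontrolled_ge0 Vh (lexx 0) (ltW T_gt0) (lexx T).
have B0 : 0 <= B by apply: le_trans (FB 0 _); rewrite ?normr_ge0// lexx ltW.
have c0 : 0 < V T - V 0 + 1 by rewrite ltr_wpDl.
have b0 : 0 < B + 1 by rewrite ltr_wpDl.
have e2 : 0 < eps / 2 by rewrite divr_gt0.
have [d1 d10 H1] := HI _ (divr_gt0 e2 c0).
have [d2 d20 H2] := Uh _ (divr_gt0 e2 b0).
exists (Num.min d1 d2); first by rewrite lt_min d10.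
suff H s t : 0 <= s -> s <= t -> t <= T -> t - s < Num.min d1 d2 -> `|I t - I s| <= eps.
  move=> s t /andP[s0 sT] /andP[t0 tT] std.
  have [st|/ltW ts] := leP s t.
    by rewrite distrC; apply: H => //; apply: le_lt_trans std; rewrite distrC ler_norm.
  by apply: H => //; apply: le_lt_trans std; rewrite ler_norm.
move=> s0 st tT; rewrite lt_min => /andP[st1 st2].
have sT : 0 <= s <= T by rewrite s0 (le_trans st).
have tT' : 0 <= t <= T by rewrite tT (le_trans s0).
have := H1 s t s s0 (lexx _) st tT st1.
have := H2 t s tT' sT; rewrite ger0_norm ?subr_ge0// => /(_ st2) h2 h1.
rewrite -(subrK (F s * (h t - h s)) (I t - I s)).
apply: le_trans (ler_normD _ _) _; rewrite normrM [leRHS](splitr eps) lerD//.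
  apply: le_trans h1 _; rewrite mulrAC ler_pdivrMr// ler_pM2l//.
  have := rcontrolled_ge0 Vh (lexx 0) s0 (le_trans st tT).
  have := rcontrolled_ge0 Vh (le_trans s0 st) tT (lexx T); lra.
apply: (@le_trans _ _ (B * (eps / 2 / (B + 1)))); first exact: ler_pM (FB _ sT) h2.
by rewrite mulrA ler_pdivrMr// mulrC ler_pM2l// lerDl.
Qed.

Lemma sewn_RS V F h I b : rcontrolled V h -> sewn V F h I -> I 0 = 0 ->
  0 <= b <= T -> is_RS_integral F h 0 b (I b).
Proof.
move=> Vh HI I0 /andP[b0 bT] r r0.
have VT0 := rcontrolled_ge0 Vh (lexx 0) b0 bT.
have c0 : 0 < V b - V 0 + 1 by rewrite ltr_wpDl.
have [delta d0 Hd] := HI _ (divr_gt0 r0 c0); exists delta => // s xi ps Hs.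
pose q i := nth b (0 :: s) i.
have qs : q (size s) = b by exact: itv_partition_nth_size ps.
have -> : I b = \sum_(0 <= i < size s) (I (q i.+1) - I (q i)).
  by rewrite telescope_sumr// qs /q/= I0 subr0.
rewrite big_mkord -sumrB.
apply: (@le_lt_trans _ _ (\sum_(0 <= i < size s) r / (V b - V 0 + 1) * (V (q i.+1) - V (q i)))).
  apply: le_trans (ler_norm_sum _ _ _) _; rewrite [leRHS]big_mkord; apply: ler_sum => i _.
  have [lt /andP[l1 l2]] := Hs i (ltn_ord i).
  rewrite distrC; apply: Hd => //.
    by apply: (itv_partition_nth_ge (ltnW (ltn_ord i : (i < (size s))%N) : (i < (size s).+1)%N) ps).
  apply: le_trans bT; apply: (itv_partition_nth_le (m := i.+1) _ ps); exact: ltn_ord i.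
rewrite -big_distrr/= telescope_sumr// qs /q/= mulrAC ltr_pdivrMr// ltr_pM2l//; lra.
Qed.

(** Both limits are compared on one partition fine enough for each; it is uniform, or empty when b =
    0. Uniqueness is what evaluates the choice in [RS_integral]. *)
Lemma RS_integral_unique F h b l l' : 0 <= b ->
  is_RS_integral F h 0 b l -> is_RS_integral F h 0 b l' -> l = l'.
Proof.
move=> b0 H1 H2; apply/eqP; rewrite -subr_eq0 -normr_eq0 eq_le normr_ge0 andbT.
apply/ler_addgt0Pl => eps e0; rewrite addr0.
have e2 : 0 < eps / 2 by rewrite divr_gt0.
have [d1 d10 {}H1] := H1 _ e2; have [d2 d20 {}H2] := H2 _ e2.
have [s [ps ms]] : exists s : seq R, itv_partition 0 b s /\ forall i, (i < size s)%N ->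
    nth b s i - nth b (0 :: s) i < Num.min d1 d2 /\
    nth b (0 :: s) i <= nth b (0 :: s) i <= nth b s i.
  have [->|bn] := eqVneq b 0; first by exists [::].
  have bp : 0 < b by rewrite lt_def bn.
  have dm : 0 < Num.min d1 d2 by rewrite lt_min d10.
  have [N /(_ N (leqnn _)) HN] := natinv_small (divr_gt0 dm bp).
  pose s := mkseq (fun i => i.+1%:R / N.+1%:R * b) N.+1.
  have ns i : (i < N.+1)%N -> nth b s i = i.+1%:R / N.+1%:R * b by move=> iN; rewrite nth_mkseq.
  have n0s i : (i < N.+1)%N -> nth b (0 :: s) i = i%:R / N.+1%:R * b.
    by case: i => [|i] iN /=; rewrite ?mul0r// ns// ltnW.
  have step i : (i < N.+1)%N -> nth b s i - nth b (0 :: s) i = b / N.+1%:R.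
    move=> iN; rewrite ns// n0s// -mulrBl -mulrBl -natr1 addrAC subrr add0r.
    by rewrite mul1r mulrC.
  exists s; split; first split.
  - apply/(pathP b) => i; rewrite size_mkseq => iN.
    by rewrite -subr_gt0 step// divr_gt0.
  - by rewrite (last_nth b) size_mkseq/= ns// divff ?mul1r.
  move=> i; rewrite size_mkseq => iN; split.
    by rewrite step// mulrC -ltr_pdivlMr.
  by rewrite lexx/= -subr_ge0 step// ltW// divr_gt0.
pose xi i := nth b (0 :: s) i.
have ms1 i : (i < size s)%N -> nth b s i - nth b (0 :: s) i < d1 /\
    nth b (0 :: s) i <= xi i <= nth b s i.
  by move=> /ms[]; rewrite lt_min => /andP[].
have ms2 i : (i < size s)%N -> nth b s i - nth b (0 :: s) i < d2 /\
    nth b (0 :: s) i <= xi i <= nth b s i.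
  by move=> /ms[]; rewrite lt_min => /andP[].
have := H1 s xi ps ms1; have := H2 s xi ps ms2.
by rewrite !ltr_norml ler_norml => /andP[? ?] /andP[? ?]; apply/andP; split; lra.
Qed.

Lemma sewn_RS_integral V F h I b : rcontrolled V h -> sewn V F h I -> I 0 = 0 ->
  0 <= b <= T -> RS_integral F h 0 b = I b.
Proof.
move=> Vh HI I0 b0T; have /andP[b0 _] := b0T.
have H := sewn_RS Vh HI I0 b0T.
apply: (RS_integral_unique b0 _ H).
by apply: (getPex (ex_intro _ _ H)).
Qed.

End Sewing.

(** * Signatures of piecewise constant paths *)

Section DiscreteSignature.
Variables (R : realType) (A : Type).
Implicit Types (X : nat -> A -> R) (f : seq A -> R) (x : A -> R).

(* Product with an element x of degree one in the tensor algebra. *)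
Definition snoc_mul f x (w : seq A) : R :=
  if w is a :: w' then f (belast a w') * x (last a w') else 0.

Lemma snoc_mul_rcons f x w a : snoc_mul f x (rcons w a) = f w * x a.
Proof. by case: w => //= b w; rewrite belast_rcons last_rcons. Qed.

(* The signature of the piecewise constant path jumping from X i to X i.+1,
   that is, the tensor product of the factors 1 + (X i.+1 - X i). *)
Fixpoint disc_sig X i : seq A -> R :=
  if i is j.+1 then
    fun w => disc_sig X j w + snoc_mul (disc_sig X j) (fun a => X j.+1 a - X j a) w
  else fun w => (nilp w)%:R.

Variables (T : R).
Hypothesis T_gt0 : 0 < T.

(** Induction on the last letter: the coordinate at [rcons w a] integrates the coordinate at w
    against the a-coordinate of Y, and the recursion of [disc_sig] is the corresponding left-point
    sum. Uniform continuity and boundedness are carried along so that the next integral exists and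
    inherits them. *)
Lemma disc_sig_cvg (Y : R -> A -> R) (V : A -> R -> R) :
  (forall a, rcontrolled T (V a) (Y^~ a)) -> (forall a, ucont T (Y^~ a)) ->
  forall w, [/\ ucont T (fun t => signature Y 0 t w),
    exists B, forall t, 0 <= t <= T -> `|signature Y 0 t w| <= B &
    forall eps, 0 < eps -> exists N, forall n, (N <= n)%N ->
      forall i, (i <= n.+1)%N ->
      `|disc_sig (fun j => Y (grid T n j)) i w - signature Y 0 (grid T n i) w| <= eps].
Proof.
move=> VY UY; elim/last_ind => [|w a [UF [B FB] HF]].
  split.
  - by move=> eps e0; exists 1 => // s t _ _ _; rewrite subrr normr0 ltW.
  - by exists 1 => t _; rewrite normr1.
  move=> eps e0; exists 0%N => n _ i _; rewrite (_ : disc_sig _ _ _ = 1).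
    by rewrite subrr normr0 ltW.
  by elim: i => //= i ->; rewrite addr0.
have [I [I0 HI]] := sewn_exists T_gt0 UF (VY a).
have sigE t : 0 <= t <= T -> signature Y 0 t (rcons w a) = I t.
  move=> tT; rewrite /signature foldl_rcons; exact: (sewn_RS_integral (VY a) HI I0 tT).
split.
- have UI := sewn_ucont T_gt0 (VY a) (UY a) HI FB.
  by move=> eps /UI[d d0 H]; exists d => // s t sT tT; rewrite !sigE//; exact: H.
- exists ((B + 1) * (V a T - V a 0)) => t tT; rewrite sigE//.
  exact: (sewn_bounded T_gt0 (VY a) HI I0 FB).
move=> eps e0.
have VT0 := rcontrolled_ge0 (VY a) (lexx 0) (ltW T_gt0) (lexx T).
pose c := eps / 2 / (V a T - V a 0 + 1).
have c0 : 0 < c by rewrite !divr_gt0// ltr_wpDl.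
have [N1 {}HF] := HF c c0.
have [delta d0 Hd] := HI c c0.
have [N2 HN2] := mesh_small T_gt0 d0.
exists (maxn N1 N2) => n; rewrite geq_max => /andP[Nn1 Nn2].
set X := fun j => _.
(* One c is the error of the coordinate at w, multiplied by an increment of the path; the other
   comes from replacing the integral over a cell by its left-point value. *)
suff key i : (i <= n.+1)%N -> `|disc_sig X i (rcons w a) - I (grid T n i)| <=
    2 * c * (V a (grid T n i) - V a 0).
  move=> i iN; rewrite sigE ?grid_ge0 ?grid_leT//.
  apply: le_trans (key _ iN) _.
  have -> : 2 * c = eps / (V a T - V a 0 + 1).
    by rewrite /c; field; rewrite lt0r_neq0// ltr_wpDl.
  rewrite mulrAC ler_pdivrMr ?ltr_wpDl// ler_pM2l//.
  have := rcontrolled_ge0 (VY a) (grid_ge0 T_gt0 n i) (grid_leT T_gt0 iN) (lexx T); lra.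
elim: i => [_|i IH iN].
  by rewrite grid0 I0 subrr mulr0 subr0; case: (w) => [|? ?]/=; rewrite normr0.
have gg := grid_le T_gt0 n (leqnSn i).
have := IH (ltnW iN); have := HF n Nn1 i (ltnW iN).
have := Hd _ _ _ (grid_ge0 T_gt0 n i) (lexx _) gg (grid_leT T_gt0 iN).
rewrite gridS => /(_ (HN2 _ Nn2)).
have := VY a _ _ (grid_ge0 T_gt0 n i) gg (grid_leT T_gt0 iN).
rewrite /= snoc_mul_rcons /=.
set D := Y (grid T n i.+1) a - Y (grid T n i) a.
rewrite -?/D -?[X i.+1 a - X i a]/D => h1 h2 h3 h4.
set s := signature _ _ _ _ in h2 h3; set f := disc_sig X i w in h3 *.
have -> : disc_sig X i (rcons w a) + f * D - I (grid T n i.+1) =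
   (disc_sig X i (rcons w a) - I (grid T n i)) + (f - s) * D -
   (I (grid T n i.+1) - I (grid T n i) - s * D) by ring.
apply: le_trans (ler_normB _ _) _.
apply: (@le_trans _ _ (`|disc_sig X i (rcons w a) - I (grid T n i)| + `|(f - s) * D| + `|I (grid T n i.+1) - I (grid T n i) - s * D|)).
  by rewrite lerD2r ler_normD.
have h5 : `|(f - s) * D| <= c * (V a (grid T n i.+1) - V a (grid T n i)).
  by rewrite normrM ler_pM.
lra.
Qed.

End DiscreteSignature.

(** * Norm bounds in the tensor algebra *)

Section TensorKernel.
Variables (R : realType) (A : Type) (a0 : A) (g : A -> A -> R).
Hypothesis g_kernel : is_kernel g.
Local Notation TK := (tensor_kernel g).
Variable TV : rkhs TK.
Implicit Types (f : seq A -> R) (x : A -> R) (v w : seq A).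

Lemma tensor_kernel_rcons v w a b : TK (rcons v a) (rcons w b) = TK v w * g a b.
Proof.
rewrite /tensor_kernel !size_rcons eqSS; have [E|_] := eqVneq (size v) (size w).
  by rewrite zip_rcons// !mul1r -cats1 big_cat big_seq1.
by rewrite !mul0r.
Qed.

Lemma tensor_kernel_nil w : TK [::] w = (nilp w)%:R.
Proof. by case: w => [|a w]; rewrite /tensor_kernel/= ?mul0r// big_nil mulr1. Qed.

(** On nonempty words the tensor kernel is the product of the kernels of the prefix and of the last
    letter, so the bound for products applies. Empty words are orthogonal to the others and add a
    square to the form. *)
Lemma rk_le_snoc_mul f x (C D : R) : rk_le TK f C -> rk_le g x D ->
  rk_le TK (snoc_mul f x) (C * D).
Proof.
have TK_kernel := rkhs_kernel TV.
move=> Hf Hx; split; first by rewrite mulr_ge0 ?(rk_le_ge0 Hf) ?(rk_le_ge0 Hx).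
move=> n w c.
pose init v := if v is a :: v' then belast a v' else [::].
(* The default letter [a0] is harmless, since c' vanishes at empty words. *)
pose lst v := if v is a :: v' then last a v' else a0.
have kp (B B' : Type) (m : B' -> B) (K : B -> B -> R) : is_kernel K -> is_kernel (fun y z => K (m y) (m z)).
  by move=> [sK pK]; split=> [y z|k a b]; [exact: sK|exact: (pK k (m \o a))].
have HM := rk_leM (kp _ _ init _ TK_kernel) (kp _ _ lst _ g_kernel)
  (rk_le_pull init Hf) (rk_le_pull lst Hx).
pose c' i := if nilp (w i) then 0 else c i.
pose e i := if nilp (w i) then c i else 0.
have [_ /(_ n w c')] := HM.
have -> : \sum_i c' i * ((f \o init) (w i) * (x \o lst) (w i)) = \sum_i c i * snoc_mul f x (w i).
  by apply: eq_bigr => i _; rewrite /c'; case: (w i) => [|b v]/=; rewrite ?mul0r ?mulr0.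
move/le_trans; apply; rewrite ler_wpM2l ?mulr_ge0 ?(rk_le_ge0 Hf) ?(rk_le_ge0 Hx)//.
apply: ler_wsqrtr.
have -> : kform TK w c = kform (fun y z => TK (init y) (init z) * g (lst y) (lst z)) w c' +
    (\sum_i e i) ^+ 2.
  rewrite /kform expr2 big_distrl/= -big_split/=; apply: eq_bigr => i _.
  rewrite big_distrr/= -big_split/=; apply: eq_bigr => j _.
  rewrite /c' /e; case: (lastP (w i)) => [|v a]; case: (lastP (w j)) => [|v' a'].
  - by rewrite tensor_kernel_nil/=; ring.
  - by rewrite tensor_kernel_nil/= /nilp size_rcons/=; ring.
  - by rewrite TK_kernel.1 tensor_kernel_nil /nilp size_rcons/=; ring.
  rewrite /nilp !size_rcons/= tensor_kernel_rcons.
  have il u b : (init (rcons u b) = u) * (lst (rcons u b) = b).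
    by case: u => //= b' u; rewrite belast_rcons last_rcons.
  by rewrite !il; ring.
by rewrite lerDl sqr_ge0.
Qed.

Lemma rk_le_nil : rk_le TK (fun w => (nilp w)%:R) 1.
Proof.
have := rk_le_diagP TV [::]; rewrite tensor_kernel_nil sqrtr1.
by congr (rk_le TK _ _); apply/funext => w; rewrite tensor_kernel_nil.
Qed.

Lemma snoc_mulBl f f' x w :
  snoc_mul (fun v => f v - f' v) x w = snoc_mul f x w - snoc_mul f' x w.
Proof. by case: w => [|a w] /=; ring. Qed.

Lemma snoc_mulBr f x x' w :
  snoc_mul f (fun a => x a - x' a) w = snoc_mul f x w - snoc_mul f x' w.
Proof. by case: w => [|a w] /=; ring. Qed.

Lemma cube_bound_cst (P : zmodType) (l : seq (P * R)) f (M : R) y :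
  all (fun vr => 0 <= vr.2) l -> rk_le TK f M -> cube_bound TK l (fun=> f) M y.
Proof.
elim: l f M y => [//|[v rho] l IH] f M y /= /andP[r0 l0] Hf; split; [exact: IH|exact: IH|].
have E : (fun (y : P) a => f a - f a) = (fun=> fun=> 0).
  by apply/funext => ?; apply/funext => ?; rewrite subrr.
by rewrite E; apply: IH => //; apply: rk_le0; rewrite mulr_ge0// (rk_le_ge0 Hf).
Qed.

(** A discrete Gronwall argument: by the product rule, each factor 1 + jump multiplies the bound by
    at most 1 + 2^(size l) (U_{n+1} - U_n), which is below the exponential of the second summand. *)
Lemma disc_sig_cube_bound (P : zmodType) (l : seq (P * R)) (X : P -> nat -> A -> R)
    (U : nat -> R) n y :
  all (fun vr => 0 <= vr.2) l ->
  (forall i, (i < n)%N ->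
    cube_bound g l (fun y a => X y i.+1 a - X y i a) (U i.+1 - U i) y) ->
  cube_bound TK l (fun y => disc_sig (X y) n) (expR (2 ^+ size l * (U n - U 0%N))) y.
Proof.
move=> l0; elim: n => [|n IH] H.
  by rewrite subrr mulr0 expR0; apply: cube_bound_cst => //; exact: rk_le_nil.
have {}IH := IH (fun i ni => H i (ltnW ni)).
have := cube_boundM snoc_mulBl snoc_mulBr rk_le_snoc_mul l0 IH (H n (ltnSn n)).
move/(cube_boundD IH); apply: cube_bound_mono => //.
set p := 2 ^+ size l; set a := expR _.
have -> : expR (p * (U n.+1 - U 0%N)) = a * expR (p * (U n.+1 - U n)).
  by rewrite -expRD; congr expR; ring.
have := expR_ge1Dx (p * (U n.+1 - U n)); rewrite -(ler_pM2l (expR_gt0 (p * (U n - U 0%N)))) -/a.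
by apply: le_trans; rewrite le_eqVlt; apply/orP; left; apply/eqP; ring.
Qed.

Lemma disc_sig_le (X : nat -> A -> R) (U : nat -> R) n :
  (forall i, (i < n)%N -> rk_le g (fun a => X i.+1 a - X i a) (U i.+1 - U i)) ->
  rk_le TK (disc_sig X n) (expR (U n - U 0%N)).
Proof.
move=> H.
(* Without directions no difference is taken; [int] is an arbitrary group of base points. *)
have := @disc_sig_cube_bound int [::] (fun=> X) U n 0 isT H.
by rewrite expr0 mul1r.
Qed.

(* Summation by parts: the increments of X' - X are not small in variation, but
   [disc_sig X' n - disc_sig X n - snoc_mul (disc_sig X n) (X' n - X n)] satisfies
   a recursion that involves X' - X itself only. *)
Lemma disc_sig_lip (X X' : nat -> A -> R) (U : nat -> R) n (o : R) : 0 <= o ->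
  (forall i, (i < n)%N -> rk_le g (fun a => X i.+1 a - X i a) (U i.+1 - U i)) ->
  (forall i, (i < n)%N -> rk_le g (fun a => X' i.+1 a - X' i a) (U i.+1 - U i)) ->
  (forall i, (i <= n)%N -> rk_le g (fun a => X' i a - X i a) o) ->
  let E := expR (U n - U 0%N) in
  rk_le TK (fun w => disc_sig X' n w - disc_sig X n w)
    ((E * (1 + 2 * E * (U n - U 0%N)) + E) * o).
Proof.
move=> o0 HX HX' HZ E.
have U0 i : (i < n)%N -> 0 <= U i.+1 - U i by move=> /HX/rk_le_ge0.
have Ule i j : (i <= j)%N -> (j <= n)%N -> U i <= U j.
  elim: j => [|j IH]; first by rewrite leqn0 => /eqP->.
  rewrite leq_eqVlt => /orP[/eqP->//|]; rewrite ltnS => ij jn.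
  by apply: le_trans (IH ij (ltnW jn)) _; rewrite -subr_ge0 U0.
have Sle i : (i <= n)%N -> rk_le TK (disc_sig X i) E.
  move=> lin; have := @disc_sig_le X U i (fun j ji => HX j (leq_trans ji lin)).
  by apply: rk_le_mono; rewrite ler_expR lerD2r Ule.
pose D i w := disc_sig X' i w - disc_sig X i w -
  snoc_mul (disc_sig X i) (fun a => X' i a - X i a) w.
have E1 : 1 <= E by rewrite -expR0 ler_expR subr_ge0 Ule.
have HD i : (i <= n)%N -> rk_le TK (D i) (expR (U i - U 0%N) * (o + 2 * E * o * (U i - U 0%N))).
  elim: i => [_|i IH lin].
    have := rk_leN (rk_le_snoc_mul rk_le_nil (HZ 0%N isT)).
    rewrite subrr expR0 mulr0 addr0; congr (rk_le TK _ _).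
    by apply/funext => w; rewrite /D/= subrr sub0r.
  have {}IH := IH (ltnW lin).
  (* With S the signature of X and Z = X' - X, the recursion is D_{i+1} = D_i + D_i dX' + S_i Z_i
     dX' - S_i dX Z_{i+1}. Each of the last two terms contains one factor of size o and one
     increment, so the errors are summable. *)
  have B1 := rk_le_snoc_mul IH (HX' i lin).
  have B2 := rk_le_snoc_mul (rk_le_snoc_mul (Sle i (ltnW lin)) (HZ i (ltnW lin))) (HX' i lin).
  have B3 := rk_le_snoc_mul (rk_le_snoc_mul (Sle i (ltnW lin)) (HX i lin)) (HZ i.+1 lin).
  have := rk_leB (rk_leD (rk_leD IH B1) B2) B3.
  set f1 := (fun w => _ - _); have -> : f1 = D i.+1.
    by apply/funext => w; rewrite /f1 /D; case: w => [|b w] /=; ring.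
  apply: rk_le_mono.
  set u := U i - U 0%N; set dl := U i.+1 - U i.
  have dl0 : 0 <= dl by exact: U0.
  have u0 : 0 <= u by rewrite subr_ge0 Ule// ltnW.
  have -> : U i.+1 - U 0%N = u + dl by rewrite /u /dl; ring.
  rewrite expRD; set a := expR u; set b := expR dl.
  have a1 : 1 <= a by rewrite -expR0 ler_expR.
  have b1 : 1 + dl <= b by exact: expR_ge1Dx.
  have c0 : 0 <= a * (o + 2 * E * o * u).
    by rewrite mulr_ge0 ?expR_ge0// addr_ge0// !mulr_ge0 ?expR_ge0.
  have h1 := ler_wpM2l c0 b1.
  have ab1 : 1 <= a * b by nra.
  have d0' : 0 <= 2 * E * o * dl by rewrite !mulr_ge0 ?expR_ge0.
  have h2 := ler_wpM2r d0' ab1.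
  lra.
have H1 := HD n (leqnn n); have H2 := rk_le_snoc_mul (Sle n (leqnn n)) (HZ n (leqnn n)).
have := rk_leD H1 H2; rewrite -/E.
have -> : E * (o + 2 * E * o * (U n - U 0%N)) + E * o =
  (E * (1 + 2 * E * (U n - U 0%N)) + E) * o by ring.
by congr (rk_le TK _ _); apply/funext => w; rewrite /D subrK.
Qed.

End TensorKernel.

(** * The signature of tame paths as a feature map *)

Section TamePaths.
Variables (R : realType) (T : R) (n : nat).
Hypothesis T_gt0 : 0 < T.
Implicit Types (gam eta : R -> 'rV[R]_n) (V W : R -> R) (M N : R).

Definition controlled V gam : Prop := forall s t, 0 <= s -> s <= t -> t <= T ->
  enorm (gam t - gam s) <= V t - V s.

Definition path_ucont gam : Prop := forall eps, 0 < eps -> exists2 delta, 0 < delta &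
  forall s t, 0 <= s <= T -> 0 <= t <= T -> `|s - t| < delta ->
  enorm (gam s - gam t) <= eps.

(** M bounds the variation, not the values. A control replaces the 1-variation because one sum of
    controls serves several paths at once; uniform continuity makes the iterated integrals exist. *)
Definition tame M gam : Prop :=
  (exists V, controlled V gam /\ V T - V 0 <= M) /\ path_ucont gam.

Lemma tame_ge0 M gam : tame M gam -> 0 <= M.
Proof.
move=> [[V [cV VM]] _]; apply: le_trans VM.
by apply: le_trans (cV _ _ (lexx 0) (ltW T_gt0) (lexx T)); exact: enorm_ge0.
Qed.

Lemma tame_mono M N gam : M <= N -> tame M gam -> tame N gam.
Proof. by move=> MN [[V [cV VM]] U]; split=> //; exists V; split=> //; exact: le_trans MN. Qed.

Lemma tameD M N gam eta : tame M gam -> tame N eta -> tame (M + N) (gam + eta).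
Proof.
move=> [[V [cV VM]] U] [[W [cW WN]] U']; split.
  exists (fun s => V s + W s); split.
    move=> s t s0 st tT; rewrite !fctE opprD addrACA; apply: le_trans (enormD _ _) _.
    by have := cV s t s0 st tT; have := cW s t s0 st tT; lra.
  lra.
move=> eps e0; have e2 : 0 < eps / 2 by rewrite divr_gt0.
have [d d0 H] := U _ e2; have [d' d'0 H'] := U' _ e2.
exists (Num.min d d') => [|s t sT tT]; first by rewrite lt_min d0.
rewrite lt_min => /andP[h h']; rewrite !fctE opprD addrACA; apply: le_trans (enormD _ _) _.
by rewrite [leRHS]splitr lerD//; [exact: H|exact: H'].
Qed.

Lemma tameZ M c gam : tame M gam -> tame (`|c| * M) (c *: gam).
Proof.
move=> [[V [cV VM]] U]; split.
  exists (fun s => `|c| * V s); split.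
    by move=> s t s0 st tT; rewrite !fctE -scalerBr enormZ -mulrBr ler_wpM2l// cV.
  by rewrite -mulrBr ler_wpM2l.
move=> eps e0; have c0 : 0 < `|c| + 1 by rewrite ltr_wpDl.
have [d d0 H] := U _ (divr_gt0 e0 c0); exists d => // s t sT tT st.
rewrite !fctE -scalerBr enormZ; apply: le_trans (ler_wpM2l _ (H s t sT tT st)) _ => //.
by rewrite mulrA ler_pdivrMr// mulrC ler_pM2l// lerDl.
Qed.

Lemma tame_sup M gam s : tame M gam -> 0 <= s <= T -> enorm (gam s - gam 0) <= M.
Proof.
move=> [[V [cV VM]] _] /andP[s0 sT]; apply: le_trans VM.
have := cV _ _ (lexx 0) s0 sT; have := cV _ _ s0 sT (lexx T).
have := enorm_ge0 (gam T - gam s); lra.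
Qed.

End TamePaths.

Section SignatureFeature.
Variables (R : realType) (T : R) (n : nat).
Hypothesis T_gt0 : 0 < T.
Local Notation path := (R -> 'rV[R]_n).
Variables (g : 'rV[R]_n -> 'rV[R]_n -> R) (Hg : rkhs g) (TV : rkhs (tensor_kernel g)).
Local Notation TK := (tensor_kernel g).
Variables (C : R).
Hypotheses (C_ge0 : 0 <= C) (g_smooth : diff_bounded g 4 g C).
Implicit Types (gam eta : path) (M : R).

Definition static_lift gam (s : R) : 'rV[R]_n -> R := g (gam s - gam 0).

Definition sig gam : seq 'rV[R]_n -> R := signature (static_lift gam) 0 T.

Definition grid_lift gam N (j : nat) : 'rV[R]_n -> R := static_lift gam (grid T N j).

Lemma g_lip u v : rk_le g (fun a => g u a - g v a) (C * enorm (u - v)).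
Proof.
have := @g_smooth [:: u - v] v isT; rewrite big_cons big_nil mulr1.
by congr (rk_le g _ _); apply/funext => a /=; rewrite [v + _]addrC subrK.
Qed.

Lemma rk_le_at f (c : R) a : rk_le g f c -> `|f a| <= c * Num.sqrt (g a a).
Proof.
move=> [_ /(_ 1%N (fun=> a) (fun=> 1))].
by rewrite /kform !big_ord1 !mul1r.
Qed.

Lemma grid_lift_cvg gam M w : tame T M gam ->
  (fun N => disc_sig (grid_lift gam N) N.+1 w) @ \oo --> sig gam w.
Proof.
move=> [[V [cV VM]] U].
have bd a s t : `|static_lift gam t a - static_lift gam s a| <=
    C * Num.sqrt (g a a) * enorm (gam t - gam s).
  have := rk_le_at a (g_lip (gam t - gam 0) (gam s - gam 0)).
  by rewrite opprB addrA subrK mulrAC.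
pose V' a s := C * Num.sqrt (g a a) * V s.
have c0 a : 0 <= C * Num.sqrt (g a a) by rewrite mulr_ge0 ?sqrtr_ge0.
have VY a : rcontrolled T (V' a) (fun s => static_lift gam s a).
  move=> s t s0 st tT; apply: le_trans (bd a s t) _.
  by rewrite -mulrBr ler_wpM2l// cV.
have UY a : ucont T (fun s => static_lift gam s a).
  move=> eps e0; have k0 : 0 < C * Num.sqrt (g a a) + 1 by rewrite ltr_wpDl.
  have [d d0 H] := U _ (divr_gt0 e0 k0); exists d => // s t sT tT st.
  apply: le_trans (bd a t s) _; apply: le_trans (ler_wpM2l (c0 a) (H s t sT tT st)) _.
  by rewrite mulrA ler_pdivrMr// mulrC ler_pM2l// lerDl.
have [_ _ Hcv] := disc_sig_cvg T_gt0 VY UY w.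
apply/cvgrPdist_le => eps e0; have [N HN] := Hcv _ e0.
exists N => // m /= Nm; rewrite distrC.
by have := HN m Nm m.+1 (leqnn _); rewrite grid_max.
Qed.

Lemma sig_rk_le gam M : tame T M gam -> rk_le TK (sig gam) (expR (C * M)).
Proof.
move=> tg; apply: (@rk_le_lim _ _ _ (fun N => disc_sig (grid_lift gam N) N.+1)); last first.
  by move=> w; exact: grid_lift_cvg tg.
apply: nearW => N.
have [[V [cV VM]] _] := tg.
have := @disc_sig_le _ _ 0 g (rkhs_kernel Hg) TV (grid_lift gam N) (fun i => C * V (grid T N i)) N.+1.
move=> /(_ _) H; apply: rk_le_mono (H _).
  by rewrite ler_expR -mulrBr ler_wpM2l// grid0 grid_max.
move=> i iN; rewrite -mulrBr.
apply: rk_le_mono (g_lip _ _); rewrite ler_wpM2l// opprB addrA subrK.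
by apply: cV; rewrite ?grid_ge0 ?grid_le ?grid_leT.
Qed.

Definition sig_lip_cst M : R :=
  (expR (C * (M + M)) * (1 + 2 * expR (C * (M + M)) * (C * (M + M))) + expR (C * (M + M))) *
  (C * 2).

(** U is a common control of both lifted paths. These differ by at most 2 C o, as the initial value
    subtracted in [static_lift] moves too. Only the uniform distance of the paths enters, which the
    p-variation norm dominates. *)
Lemma sig_lip gam gam' M (o : R) : tame T M gam -> tame T M gam' ->
  (forall s, 0 <= s <= T -> enorm (gam' s - gam s) <= o) ->
  rk_le TK (fun w => sig gam' w - sig gam w) (sig_lip_cst M * o).
Proof.
move=> tg tg' Ho.
have M0 := tame_ge0 T_gt0 tg.
have o0 : 0 <= o by apply: le_trans (Ho 0 _); rewrite ?enorm_ge0// lexx ltW.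
apply: (@rk_le_lim _ _ _ (fun N w => disc_sig (grid_lift gam' N) N.+1 w - disc_sig (grid_lift gam N) N.+1 w)); last first.
  by move=> w; apply: cvgB; [exact: grid_lift_cvg tg'|exact: grid_lift_cvg tg].
apply: nearW => N.
have [[V [cV VM]] _] := tg; have [[V' [cV' VM']] _] := tg'.
pose U i := C * (V (grid T N i) + V' (grid T N i)).
have inc (eta : path) W i : controlled T W eta -> (i < N.+1)%N ->
    rk_le g (fun a => grid_lift eta N i.+1 a - grid_lift eta N i a)
      (C * (W (grid T N i.+1) - W (grid T N i))).
  move=> cW iN; apply: rk_le_mono (g_lip _ _); rewrite ler_wpM2l// opprB addrA subrK.
  by apply: cW; rewrite ?grid_ge0 ?grid_le ?grid_leT.
have W0 (eta : path) W i : controlled T W eta -> (i < N.+1)%N ->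
    0 <= W (grid T N i.+1) - W (grid T N i).
  move=> cW iN; apply: le_trans (cW _ _ _ _ _); rewrite ?enorm_ge0 ?grid_ge0 ?grid_le ?grid_leT//.
have Co : 0 <= C * 2 * o by rewrite !mulr_ge0.
have := disc_sig_lip 0 (rkhs_kernel Hg) TV (X := grid_lift gam N) (X' := grid_lift gam' N) (U := U) (n := N.+1) Co.
move=> H; apply: rk_le_mono (H _ _ _).
- rewrite /U grid0 grid_max -mulrBr mulrA ler_wpM2r//.
  have le : C * (V T + V' T - (V 0 + V' 0)) <= C * (M + M) by rewrite ler_wpM2l//; lra.
  have ge : 0 <= C * (V T + V' T - (V 0 + V' 0)).
    rewrite mulr_ge0//.
    have := le_trans (enorm_ge0 _) (cV _ _ (lexx 0) (ltW T_gt0) (lexx T)).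
    have := le_trans (enorm_ge0 _) (cV' _ _ (lexx 0) (ltW T_gt0) (lexx T)); lra.
  rewrite /sig_lip_cst ler_wpM2r ?mulr_ge0//.
  set x := C * _ in le ge *; set y := C * (M + M) in le *.
  have xy : expR x <= expR y by rewrite ler_expR.
  have p : 0 <= 2 * expR x * x by apply: mulr_ge0 => //; rewrite mulr_ge0 ?expR_ge0.
  apply: (lerD _ xy); apply: ler_pM; rewrite ?expR_ge0 ?addr_ge0//.
  by rewrite lerD2l -!mulrA ler_wpM2l// ler_pM ?expR_ge0.
- move=> i iN; apply: rk_le_mono (inc _ V i cV iN).
  by rewrite /U -mulrBr ler_wpM2l//; have := W0 _ _ _ cV' iN; lra.
- move=> i iN; apply: rk_le_mono (inc _ V' i cV' iN).
  by rewrite /U -mulrBr ler_wpM2l//; have := W0 _ _ _ cV iN; lra.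
move=> i iN; apply: rk_le_mono (g_lip _ _).
rewrite -mulrA ler_wpM2l// mulr_natl mulr2n.
have -> : gam' (grid T N i) - gam' 0 - (gam (grid T N i) - gam 0) =
    (gam' (grid T N i) - gam (grid T N i)) - (gam' 0 - gam 0).
  by rewrite !opprD !opprK addrACA.
apply: le_trans (enormB _ _) _; rewrite lerD// Ho//.
  by rewrite grid_ge0 ?grid_leT.
by rewrite lexx ltW.
Qed.

Local Notation good gam := (exists M, tame T M gam).

Variable V1 : lmodType R.
Local Notation P := (V1 * path)%type.

Lemma common_control gam M (L : seq path) : tame T M gam ->
  (forall v, v \in L -> tame T 1 v) ->
  exists W, [/\ controlled T W gam, forall v, v \in L -> controlled T W v &
    W T - W 0 <= M + (size L)%:R].
Proof.
move=> tg; elim: L => [|v L IH] H.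
  by have [[W [cW WM]] _] := tg; exists W; split=> //; rewrite addr0.
have [|W [c1 c2 c3]] := IH; first by move=> w wL; apply: H; rewrite inE wL orbT.
have [[V [cV V1']] _] := H v (mem_head _ _).
have W0 s t : 0 <= s -> s <= t -> t <= T -> 0 <= W t - W s.
  by move=> s0 st tT; apply: le_trans (c1 _ _ s0 st tT); exact: enorm_ge0.
have V0 s t : 0 <= s -> s <= t -> t <= T -> 0 <= V t - V s.
  by move=> s0 st tT; apply: le_trans (cV _ _ s0 st tT); exact: enorm_ge0.
exists (fun s => W s + V s); split.
- move=> s t s0 st tT; have := c1 s t s0 st tT; have := V0 s t s0 st tT; lra.
- move=> w; rewrite inE => /orP[/eqP->|wL] s t s0 st tT.
    by have := cV s t s0 st tT; have := W0 s t s0 st tT; lra.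
  by have := c2 _ wL s t s0 st tT; have := V0 s t s0 st tT; lra.
rewrite /= -natr1; lra.
Qed.

(** Convergence is available at base points in [G] only; stability of [G] under the directions keeps
    all vertices of the cube in it. *)
Lemma cube_bound_lim (P' : zmodType) (A : Type) (K : A -> A -> R) (l : seq (P' * R))
    (G : P' -> Prop) (F : nat -> P' -> A -> R) F' (M : R) x :
  (forall y vr, vr \in l -> G y -> G (y + vr.1)) -> G x ->
  (forall y, G y -> forall a, (fun N => F N y a) @ \oo --> F' y a) ->
  (forall N, cube_bound K l (F N) M x) -> cube_bound K l F' M x.
Proof.
elim: l F F' M x => [|[v rho] l IH] F F' M x Gl Gx HF /=.
  by move=> H; apply: (@rk_le_lim _ _ _ (fun N => F N x)); [exact: nearW|exact: HF].
move=> H.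
have Gl' y vr : vr \in l -> G y -> G (y + vr.1).
  by move=> vl; apply: Gl; rewrite inE vl orbT.
have Gv y : G y -> G (y + v) by apply: (Gl y (v, rho)); exact: mem_head.
split.
- by apply: (IH F) => // N; case: (H N).
- by apply: (IH F) => //; [exact: Gv|move=> N; case: (H N)].
apply: (IH (fun N y a => F N (y + v) a - F N y a)) => //.
  by move=> y Gy a; apply: cvgB; apply: HF => //; exact: Gv.
by move=> N; case: (H N).
Qed.

(* Truncated to 0 off the tame paths so that it lies in the RKHS for every
   argument. *)
Definition tame_sig gam : seq 'rV[R]_n -> R :=
  if `[< exists M, tame T M gam >] then sig gam else fun=> 0.

Lemma tame_sigE gam M : tame T M gam -> tame_sig gam = sig gam.
Proof. by move=> tg; rewrite /tame_sig; case: asboolP => // -[]; exists M. Qed.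

Lemma carrier_tame_sig gam : carrier TV (tame_sig gam).
Proof.
rewrite /tame_sig; case: asboolP => [[M tg]|_]; last exact: carrier0.
exact: (rk_le_carrier TV (sig_rk_le tg)).1.
Qed.

Definition weighted (L : seq (R * P)) : seq (P * R) :=
  [seq (tv.1 *: tv.2, `|tv.1|) | tv <- L].

Lemma weighted_ge0 (L : seq (R * P)) : all (fun vr => 0 <= vr.2) (weighted L).
Proof. by apply/allP => _ /mapP[tv _ ->] /=. Qed.

(** For at most three directions, 2^(size L) is at most 8. One factor 8 comes from the product rule
    along the factors of the discretised signature, the other from the differences of the increments
    of the lifted path, where the fourth order of [g_smooth] is spent. M + 3 bounds a common control
    of the path and of three unit directions. *)
Lemma tame_sig_cube_bound (q : P) M (L : seq (R * P)) :
  tame T M q.2 -> (size L <= 3)%N ->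
  (forall tv, tv \in L -> `|tv.1| <= 1 /\ tame T 1 tv.2.2) ->
  cube_bound TK (weighted L) (fun q => tame_sig q.2) (expR (8 * (C * 8 * (M + 3)))) q.
Proof.
move=> tq L3 HL.
have M0 := tame_ge0 T_gt0 tq.
apply: (@cube_bound_lim _ _ TK _ (fun q => good q.2) (fun N y => disc_sig (grid_lift y.2 N) N.+1)).
- move=> y _ /mapP[tv /HL[_ tv1] ->] [N tN]; exists (N + `|tv.1| * 1).
  exact: (tameD tN (tameZ tv.1 tv1)).
- by exists M.
- by move=> y [N tN] w; rewrite (tame_sigE tN); exact: grid_lift_cvg tN.
move=> N.
have [|W [cW cL WM]] := @common_control q.2 M [seq tv.2.2 | tv <- L] tq.
  by move=> _ /mapP[tv /HL[_ ?] ->].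
pose p : R := 2 ^+ size L.
pose U i := C * p * W (grid T N i).
have p0 : 0 <= p by rewrite exprn_ge0.
have p8 : p <= 8.
  rewrite (_ : 8 = 2 ^+ 3); last by ring.
  by apply: ler_weXn2l => //; rewrite ler1n.
have W0 : 0 <= W T - W 0.
  by apply: le_trans (cW _ _ (lexx 0) (ltW T_gt0) (lexx T)); exact: enorm_ge0.
have sz : size (weighted L) = size L by rewrite size_map.
have := @disc_sig_cube_bound _ _ 0 g (rkhs_kernel Hg) TV P (weighted L)
  (fun y => grid_lift y.2 N) U N.+1 q (weighted_ge0 L).
move=> H; apply: (cube_bound_mono (weighted_ge0 L) _ (H _)).
  rewrite ler_expR sz -/p /U grid0 grid_max -mulrBr ler_pM ?mulr_ge0//.
  rewrite ler_pM ?mulr_ge0 ?ler_wpM2l//; apply: le_trans WM _.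
  by rewrite lerD2l size_map ler_nat.
move=> i iN.
set s1 := grid T N i.+1; set s0 := grid T N i.
have s00 : 0 <= s0 by exact: grid_ge0.
have s1T : s1 <= T by exact: grid_leT.
have s01 : s0 <= s1 by exact: grid_le.
have E : U i.+1 - U i = C * (W s1 - W s0) * 2 ^+ size (weighted L).
  by rewrite sz -/p /U -/s1 -/s0; ring.
rewrite E.
have ss u v w : (u - v - (w - v) : 'rV[R]_n) = u - w by rewrite opprB addrA subrK.
apply: (@cube_bound_compB _ _ _ g P 3 g C (fun y => y.2 s1 - y.2 0) (fun y => y.2 s0 - y.2 0)) => //.
- by move=> y z /=; rewrite !fctE opprD addrACA.
- by move=> y z /=; rewrite !fctE opprD addrACA.
- by rewrite sz.
- by rewrite ss cW.
move=> _ /mapP[tv tvL ->] /=; have [t1 tm] := HL _ tvL.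
rewrite !fctE -!scalerBr !enormZ ss.
have cv : controlled T W tv.2.2 by apply: cL; apply/mapP; exists tv.
split=> //.
- by rewrite ler_piMr// (tame_sup tm)// (le_trans s00)// s1T.
- by rewrite ler_piMr// (tame_sup tm)// s00 (le_trans s01).
- by rewrite mulrC ler_wpM2r// cv.
Qed.

End SignatureFeature.

(** * The product kernel and the functionals of its RKHS *)

Section FeatureKernel.
Variables (R : realType) (B A : Type) (K : A -> A -> R) (H : rkhs K) (S : B -> A -> R).
Hypothesis CS : forall z, carrier H (S z).

(** Cauchy-Schwarz against the combination of the features [S (z i)], whose squared norm is the form
    of the induced kernel. *)
Lemma rk_le_dot_feature F : carrier H F ->
  rk_le (fun z z' => dot H (S z) (S z')) (fun z => dot H F (S z)) (hnorm H F).
Proof.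
move=> CF; split; first exact: hnorm_ge0.
move=> m z c.
have Cs : carrier H (fun x => \sum_i c i * S (z i) x).
  by apply: carrier_sum => i; exact: carrierZ.
have E G : carrier H G -> \sum_i c i * dot H G (S (z i)) =
    dot H G (fun x => \sum_i c i * S (z i) x).
  move=> CG; rewrite dotC// dot_suml//; last by move=> i; exact: carrierZ.
  by apply: eq_bigr => i _; rewrite dotZl// dotC.
rewrite E//; apply: le_trans (dot_le CF Cs) _; rewrite ler_wpM2l ?hnorm_ge0//.
rewrite /hnorm ler_wsqrtr//.
have -> : kform (fun z z' => dot H (S z) (S z')) z c =
    \sum_i c i * dot H (S (z i)) (fun x => \sum_i c i * S (z i) x).
  by apply: eq_bigr => i _; rewrite -E// big_distrr/=; apply: eq_bigr => j _; rewrite mulrA.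
rewrite dot_suml//; last by move=> i; exact: carrierZ.
by apply: ler_sum => i _; rewrite dotZl.
Qed.

Lemma feature_is_kernel : is_kernel (fun z z' => dot H (S z) (S z')).
Proof.
split=> [z z'|m z c]; first exact: dotC.
have Cs : carrier H (fun x => \sum_i c i * S (z i) x).
  by apply: carrier_sum => i; exact: carrierZ.
apply: le_trans (dot_ge0 Cs) _.
rewrite dot_suml//; last by move=> i; exact: carrierZ.
apply: ler_sum => i _; rewrite dotZl// dotC// dot_suml//; last by move=> j; exact: carrierZ.
rewrite big_distrr/=; apply: ler_sum => j _; rewrite dotZl// mulrA (dotC (CS _) (CS (z i))).
exact: lexx.
Qed.

Lemma cube_bound_dot (P : zmodType) (l : seq (P * R)) (F : P -> A -> R) (M : R) x :
  (forall y, carrier H (F y)) -> cube_bound K l F M x ->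
  cube_bound (fun z z' => dot H (S z) (S z')) l (fun y z => dot H (F y) (S z)) M x.
Proof.
elim: l F M x => [|[v rho] l IH] F M x CF /=.
  by move=> /(rk_le_carrier H)[_ FM]; apply: rk_le_mono FM _; exact: rk_le_dot_feature.
move=> [H1 H2 H3]; split; [exact: IH|exact: IH|].
have := IH _ _ _ (fun y => carrierB (CF (y + v)) (CF y)) H3.
by congr cube_bound; apply/funext => y; apply/funext => z; rewrite dotBl.
Qed.

End FeatureKernel.

Lemma mdiff_dot (R : realType) (A : Type) (K : A -> A -> R) (H : rkhs K)
    (P : zmodType) (F : P -> A -> R) (h : A -> R) (l : seq P) (q : P) :
  (forall y, carrier H (F y)) -> carrier H h ->
  carrier H (fun z => mdiff (F^~ z) l q) /\
  mdiff (fun y => dot H h (F y)) l q = dot H h (fun z => mdiff (F^~ z) l q).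
Proof.
move=> CF Ch; elim: l q => [|v l IH] q /=; first by split.
have [C1 E1] := IH (q + v); have [C2 E2] := IH q.
by rewrite E1 E2 dotBr//; split=> //; exact: carrierB.
Qed.

Section PathFeature.
Variables (R : realType) (T : R) (m n : nat).
Hypothesis T_gt0 : 0 < T.
Local Notation V1 := 'rV[R]_m.
Local Notation V2 := 'rV[R]_n.
Local Notation P := (V1 * (R -> V2))%type.
Variables (k : V1 -> V1 -> R) (Hk : rkhs k) (l : V2 -> V2 -> R) (Hl : rkhs l).
Variables (g : V2 -> V2 -> R) (Hg : rkhs g) (TV : rkhs (tensor_kernel g)).
Variables (Ck Cl Cg : R).
Hypotheses (Cg0 : 0 <= Cg) (k_smooth : diff_bounded k 3 k Ck).
Hypotheses (l_smooth : diff_bounded l 3 l Cl) (g_smooth : diff_bounded g 4 g Cg).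
Variables (B : Type) (pt : B -> V1) (ga : B -> R -> V2).
Local Notation S := (tame_sig T g).

Definition path_kernel (z z' : B) : R :=
  k (pt z) (pt z') * (l (ga z 0) (ga z' 0) * dot TV (S (ga z)) (S (ga z'))).

(** Here q runs through a vector space of time-space vectors and paths, so that differences in
    arbitrary directions are defined; z stays in the domain of the kernel. *)
Definition path_feature (q : P) (z : B) : R :=
  k q.1 (pt z) * (l (q.2 0) (ga z 0) * dot TV (S q.2) (S (ga z))).

Definition unit_dir (v : P) : Prop :=
  [/\ enorm v.1 <= 1, enorm (v.2 0) <= 1 & tame T 1 v.2].

Let CS q : carrier TV (S q).
Proof. exact: carrier_tame_sig Cg0 g_smooth q. Qed.

Let K1 (z z' : B) := k (pt z) (pt z').
Let K2 (z z' : B) := l (ga z 0) (ga z' 0).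
Let K3 (z z' : B) := dot TV (S (ga z)) (S (ga z')).

Lemma kernel_pull (A A' : Type) (f : A' -> A) (K : A -> A -> R) :
  is_kernel K -> is_kernel (fun y z => K (f y) (f z)).
Proof. by move=> [sK pK]; split=> [y z|j a b]; [exact: sK|exact: (pK j (f \o a))]. Qed.

Lemma kernelM (A : Type) (K K' : A -> A -> R) : is_kernel K -> is_kernel K' ->
  is_kernel (fun y z => K y z * K' y z).
Proof.
move=> kK kK'; split=> [y z|j a b]; first by rewrite kK.1 kK'.1.
exact: psd_schur (kform_psd kK a) (kform_psd kK' a) b.
Qed.

Let kK1 : is_kernel K1. Proof. exact/kernel_pull/rkhs_kernel. Qed.
Let kK2 : is_kernel K2.
Proof. exact: (kernel_pull (fun z => ga z 0) (rkhs_kernel Hl)). Qed.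
Let kK3 : is_kernel K3.
Proof. by apply: feature_is_kernel => z; exact: CS. Qed.

Lemma diff_bounded_pull (A A' : Type) j N (f : A' -> A) (K : A -> A -> R) Phi C :
  @diff_bounded R j A K N Phi C ->
  diff_bounded (fun y z => K (f y) (f z)) N (fun x z => Phi x (f z)) C.
Proof. by move=> H L y LN; exact: (rk_le_pull f (H L y LN)). Qed.

Let Ck0 : 0 <= Ck.
Proof. by have := k_smooth 0 (leq0n 3 : (size [::] <= 3)%N) => /rk_le_ge0; rewrite big_nil mulr1. Qed.

Let Cl0 : 0 <= Cl.
Proof. by have := l_smooth 0 (leq0n 3 : (size [::] <= 3)%N) => /rk_le_ge0; rewrite big_nil mulr1. Qed.

(** The product rule is applied twice to the factors k, l and the signature kernel, and each
    application costs 2^(size L), at most 8. *)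
Lemma path_feature_cube_bound (q : P) M (L : seq (R * P)) :
  tame T M q.2 -> (size L <= 3)%N ->
  (forall tv, tv \in L -> `|tv.1| <= 1 /\ unit_dir tv.2) ->
  cube_bound path_kernel (weighted L) path_feature
    (8 * Ck * (8 * Cl * expR (8 * (Cg * 8 * (M + 3))))) q.
Proof.
move=> tq L3 HL.
have w0 := weighted_ge0 L.
have sz : size (weighted L) = size L by rewrite size_map.
have B1 : cube_bound K1 (weighted L) (fun y z => k y.1 (pt z)) Ck q.
  apply: (@cube_bound_comp _ _ _ K1 P 3 (fun x z => k x (pt z)) Ck fst) => //.
  - by rewrite sz.
  - exact: (diff_bounded_pull pt k_smooth).
  apply/allP => _ /mapP[tv /HL[_ [v1 _ _]] ->] /=.
  by rewrite enormZ ler_piMr.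
have B2 : cube_bound K2 (weighted L) (fun y z => l (y.2 0) (ga z 0)) Cl q.
  apply: (@cube_bound_comp _ _ _ K2 P 3 (fun x z => l x (ga z 0)) Cl (fun y => y.2 0)) => //.
  - by rewrite sz.
  - exact: (diff_bounded_pull (fun z => ga z 0) l_smooth).
  apply/allP => _ /mapP[tv /HL[_ [_ v2 _]] ->] /=.
  by rewrite fctE enormZ ler_piMr.
have B3 : cube_bound K3 (weighted L) (fun y z => dot TV (S y.2) (S (ga z)))
    (expR (8 * (Cg * 8 * (M + 3)))) q.
  apply: (cube_bound_dot (fun z => CS (ga z)) (fun y : P => CS y.2)).
  apply: (tame_sig_cube_bound T_gt0 Hg TV Cg0 g_smooth tq L3).
  by move=> tv /HL[? []].
have p0 : 0 <= 2 ^+ size (weighted L) :> R by rewrite exprn_ge0.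
have p8 : 2 ^+ size (weighted L) <= 8 :> R.
  rewrite (_ : 8 = 2 ^+ 3); last by ring.
  by rewrite sz; apply: ler_weXn2l => //; rewrite ler1n.
have B23 := @cube_boundM _ P _ _ _ K2 K3 (fun z z' => K2 z z' * K3 z z') (fun f h z => f z * h z)
  _ _ (fun f h C D => @rk_leM _ _ K2 K3 f h C D kK2 kK3) (weighted L) _ _ _ _ q w0 B2 B3.
have {}B23 := B23 (fun f f' h z => mulrBl _ _ _) (fun f h h' z => mulrBr _ _ _).
have B123 := @cube_boundM _ P _ _ _ K1 _ path_kernel (fun f h z => f z * h z)
  _ _ (fun f h C D => @rk_leM _ _ K1 _ f h C D kK1 (kernelM kK2 kK3)) (weighted L) _ _ _ _ q w0 B1 B23.
have {}B123 := B123 (fun f f' h z => mulrBl _ _ _) (fun f h h' z => mulrBr _ _ _).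
apply: cube_bound_mono w0 _ B123.
have e0 := expR_ge0 (8 * (Cg * 8 * (M + 3))).
apply: ler_pM; rewrite ?mulr_ge0// ?ler_wpM2r//.
Qed.

Definition feature_lip_cst M : R :=
  Ck * (Cl * expR (Cg * M)) + Ck * (Cl * expR (Cg * M)) + Ck * (Cl * sig_lip_cst Cg M).

Lemma path_feature_lip (q q' : P) M (o : R) : tame T M q.2 -> tame T M q'.2 ->
  (forall s, 0 <= s <= T -> enorm (q'.2 s - q.2 s) <= o) -> enorm (q'.1 - q.1) <= o ->
  rk_le path_kernel (fun z => path_feature q' z - path_feature q z)
    (feature_lip_cst M * o).
Proof.
move=> tq tq' Ho Ho1.
have lipk : rk_le K1 (fun z => k q'.1 (pt z) - k q.1 (pt z)) (Ck * o).
  have := @k_smooth [:: q'.1 - q.1] q.1 isT; rewrite big_cons big_nil mulr1.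
  move=> /(rk_le_pull pt)/(rk_le_mono (ler_wpM2l Ck0 Ho1)); congr (rk_le K1 _ _).
  by apply/funext => z /=; rewrite [q.1 + _]addrC subrK.
have bk (y : P) : rk_le K1 (fun z => k y.1 (pt z)) Ck.
  by have := @k_smooth [::] y.1 isT; rewrite big_nil mulr1 => /(rk_le_pull pt).
have H0 : enorm (q'.2 0 - q.2 0) <= o by apply: Ho; rewrite lexx ltW.
have lipl : rk_le K2 (fun z => l (q'.2 0) (ga z 0) - l (q.2 0) (ga z 0)) (Cl * o).
  have := @l_smooth [:: q'.2 0 - q.2 0] (q.2 0) isT; rewrite big_cons big_nil mulr1.
  move=> /(rk_le_pull (fun z => ga z 0))/(rk_le_mono (ler_wpM2l Cl0 H0)).
  congr (rk_le K2 _ _).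
  by apply/funext => z /=; rewrite [q.2 0 + _]addrC subrK.
have bl (y : P) : rk_le K2 (fun z => l (y.2 0) (ga z 0)) Cl.
  have := @l_smooth [::] (y.2 0) isT; rewrite big_nil mulr1.
  by move=> /(rk_le_pull (fun z => ga z 0)).
have b3 F C : rk_le (tensor_kernel g) F C -> rk_le K3 (fun z => dot TV F (S (ga z))) C.
  move=> /(rk_le_carrier TV)[CF FC]; apply: rk_le_mono FC _.
  by apply: rk_le_dot_feature => // z; exact: CS.
have bS (y : P) : tame T M y.2 -> rk_le K3 (fun z => dot TV (S y.2) (S (ga z))) (expR (Cg * M)).
  by move=> ty; apply: b3; rewrite (tame_sigE g ty); exact: sig_rk_le ty.
have lipS : rk_le K3 (fun z => dot TV (S q'.2) (S (ga z)) - dot TV (S q.2) (S (ga z))) (sig_lip_cst Cg M * o).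
  have := b3 _ _ (sig_lip T_gt0 Hg TV Cg0 g_smooth tq tq' Ho).
  congr (rk_le K3 _ _); apply/funext => z.
  by rewrite (tame_sigE g tq') (tame_sigE g tq) dotBl// -?(tame_sigE g tq') -?(tame_sigE g tq)//; exact: CS.
have k23 := kernelM kK2 kK3.
have H1 := rk_leM kK1 k23 lipk (rk_leM kK2 kK3 (bl q') (bS q' tq')).
have H2 := rk_leM kK1 k23 (bk q) (rk_leM kK2 kK3 lipl (bS q' tq')).
have H3 := rk_leM kK1 k23 (bk q) (rk_leM kK2 kK3 (bl q) lipS).
have := rk_leD (rk_leD H1 H2) H3.
have -> : Ck * o * (Cl * expR (Cg * M)) + Ck * (Cl * o * expR (Cg * M)) +
  Ck * (Cl * (sig_lip_cst Cg M * o)) = feature_lip_cst M * o.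
  by rewrite /feature_lip_cst; ring.
congr (rk_le path_kernel _ _); apply/funext => z; rewrite /path_feature; ring.
Qed.

Variables (KB : B -> B -> R) (KBE : KB = path_kernel) (H : rkhs KB).

Let rk_le_carrierB f C : rk_le path_kernel f C -> carrier H f /\ hnorm H f <= C.
Proof. by rewrite -KBE; exact: rk_le_carrier. Qed.

Lemma carrier_path_feature (q : P) : carrier H (path_feature q).
Proof.
have [[M tq]|nt] := pselect (exists M, tame T M q.2).
  have /cube_bound_rk_le0 := @path_feature_cube_bound q M [::] tq isT (fun tv h => False_rect _ (notF h)).
  by move=> /rk_le_carrierB[].
rewrite (_ : path_feature q = fun=> 0); first exact: carrier0.
apply/funext => z; rewrite /path_feature /tame_sig asboolF// dot0l; first by rewrite !mulr0.
exact: CS.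
Qed.

Definition functional (h : B -> R) (q : P) : R := dot H h (path_feature q).

Definition mdiff_cst M : R := 8 * Ck * (8 * Cl * expR (8 * (Cg * 8 * (M + 3)))).

Lemma mdiff_cst_ge0 M : 0 <= mdiff_cst M.
Proof. by rewrite /mdiff_cst !mulr_ge0 ?expR_ge0. Qed.

Lemma functional_mdiff h (q : P) M (L : seq (R * P)) :
  carrier H h -> tame T M q.2 -> (size L <= 3)%N ->
  (forall tv, tv \in L -> `|tv.1| <= 1 /\ unit_dir tv.2) ->
  `|mdiff (functional h) [seq tv.1 *: tv.2 | tv <- L] q| <=
    mdiff_cst M * hnorm H h * \prod_(tv <- L) `|tv.1|.
Proof.
move=> Ch tq L3 HL.
have := cube_bound_rk_le (path_feature_cube_bound tq L3 HL).
rewrite -map_comp big_map => /rk_le_carrierB[Cf fC].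
have [_ ->] := mdiff_dot [seq tv.1 *: tv.2 | tv <- L] q carrier_path_feature Ch.
apply: le_trans (dot_le Ch Cf) _; rewrite mulrAC [X in _ <= X]mulrC.
by rewrite ler_wpM2l ?hnorm_ge0.
Qed.

Lemma functional_lip h (q q' : P) M (o : R) :
  carrier H h -> tame T M q.2 -> tame T M q'.2 ->
  (forall s, 0 <= s <= T -> enorm (q'.2 s - q.2 s) <= o) -> enorm (q'.1 - q.1) <= o ->
  `|functional h q' - functional h q| <= feature_lip_cst M * hnorm H h * o.
Proof.
move=> Ch tq tq' Ho Ho1.
have /rk_le_carrierB[Cf fC] := path_feature_lip tq tq' Ho Ho1.
rewrite /functional -dotBr//; try exact: carrier_path_feature.
apply: le_trans (dot_le Ch Cf) _; rewrite mulrAC [X in _ <= X]mulrC.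
by rewrite ler_wpM2l ?hnorm_ge0.
Qed.

End PathFeature.

(** * Derivatives from mixed differences *)

(* A function that is additive up to a bilinear error is differentiable at 0 with
   an explicit rate; applied to h |-> U (q + h v) - U q, where the second mixed
   differences of U are known but no derivative of U is. *)
Lemma quasi_additive_derivable (R : realType) (a : R -> R) (C C' tau : R) :
  0 < tau -> 0 <= C -> 0 <= C' ->
  (forall h k, `|h| <= tau -> `|k| <= tau -> `|a (h + k) - a h - a k| <= C * `|h| * `|k|) ->
  (forall h, `|h| <= tau -> `|a h| <= C' * `|h|) ->
  exists D, forall h, `|h| <= tau -> `|a h - D * h| <= 2 * C * h ^+ 2.
Proof.
move=> tau0 C0 C'0 Ha Ba.
have a0 : a 0 = 0.
  by have := Ba 0; rewrite normr0 mulr0 => /(_ (ltW tau0)); rewrite normr_le0 => /eqP.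
(* Splitting off one step u at a time costs C (j u) u, and the sum over j < m is below C (m u)^2. *)
have mul u m : 0 <= u -> m%:R * u <= tau -> `|a (m%:R * u) - m%:R * a u| <= C * (m%:R * u) ^+ 2.
  move=> u0; elim: m => [|m IH] mt.
    by rewrite !mul0r a0 subr0 normr0 expr0n mulr0.
  have m0 : 0 <= m%:R * u by rewrite mulr_ge0.
  have mu : m%:R * u <= tau by apply: le_trans mt; rewrite ler_wpM2r// ler_nat.
  have ut : u <= tau.
    by apply: le_trans mt; rewrite ler_peMl// ler1n.
  have := Ha (m%:R * u) u; rewrite (ger0_norm m0) (ger0_norm u0) => /(_ mu ut) h1.
  have h2 := IH mu.
  rewrite -natr1 !mulrDl !mul1r.
  have -> : a (m%:R * u + u) - (m%:R * a u + a u) = (a (m%:R * u + u) - a (m%:R * u) - a u) +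
    (a (m%:R * u) - m%:R * a u) by ring.
  apply: le_trans (ler_normD _ _) _.
  have h3 : 0 <= C * u ^+ 2 by rewrite mulr_ge0 ?sqr_ge0.
  have h4 : 0 <= C * (m%:R * u) * u by rewrite !mulr_ge0.
  have h5 : C * (m%:R * u + u) ^+ 2 = C * (m%:R * u) ^+ 2 + 2 * (C * (m%:R * u) * u) + C * u ^+ 2 by ring.
  lra.
(* Along dyadic steps the quotients D i are Cauchy with rate C u_i; their limit is the
   derivative. *)
pose u i : R := tau / 2 ^+ i.
have u0 i : 0 < u i by rewrite divr_gt0// exprn_gt0.
have uS i j : u i = (2 ^ j)%:R * u (i + j)%N.
  by rewrite /u exprD natrX; field; rewrite !expf_neq0.
have ule i : u i <= tau by rewrite ler_pdivrMr ?exprn_gt0// ler_peMr ?(ltW tau0)// exprn_ege1// ler1n.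
pose D i := a (u i) / u i.
have ucv : u @ \oo --> (0 : R).
  have -> : u = (fun i => tau * (2^-1) ^+ i) by apply/funext => i; rewrite /u exprVn.
  rewrite -(mulr0 tau); apply: cvgMr.
  by apply: cvg_expr; rewrite ger0_norm// invf_lt1// ltr1n.
have Dij i j : `|D i - D (i + j)%N| <= C * u i.
  have := mul (u (i + j)%N) (2 ^ j)%N (ltW (u0 _)); rewrite -uS => /(_ (ule i)) h.
  have E : a (u i) - (2 ^ j)%:R * a (u (i + j)%N) = (D i - D (i + j)%N) * u i.
    have E1 : a (u i) = D i * u i by rewrite /D mulfVK ?lt0r_neq0.
    have E2 : a (u (i + j)%N) = D (i + j)%N * u (i + j)%N by rewrite /D mulfVK ?lt0r_neq0.
    by rewrite E1 E2 mulrBl (uS i j); ring.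
  by rewrite -(ler_pM2r (u0 i)) -mulrA -expr2; move: h; rewrite E normrM (gtr0_norm (u0 i)).
have cvD : cvg (D @ \oo).
  apply: real_cauchy_cvg => eps e0.
  have c0 : 0 < 2 * C + 1 by rewrite ltr_wpDl ?mulr_ge0.
  have /cvgrPdist_lt/(_ _ (divr_gt0 e0 c0))[N _ /(_ N (leqnn _))] := ucv.
  rewrite sub0r normrN (gtr0_norm (u0 N)) ltr_pdivlMr// => uN.
  exists N => m n Nm Nn.
  have := Dij N (m - N)%N; have := Dij N (n - N)%N; rewrite !subnKC// => h1 h2.
  have -> : D m - D n = (D N - D n) - (D N - D m) by ring.
  apply: le_trans (ler_normB _ _) _; have := u0 N; nra.
exists (lim (D @ \oo)).
have pos h : 0 <= h -> h <= tau -> `|a h - lim (D @ \oo) * h| <= C * h ^+ 2.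
  move=> h0 ht.
  have cv1 : (fun i => `|a h - D i * h| - (2 * C' + C * tau) * u i) @ \oo -->
      `|a h - lim (D @ \oo) * h| - (2 * C' + C * tau) * 0.
    apply: cvgB; last by apply: cvgMr.
    apply: cvg_norm; apply: cvgB; first exact: cvg_cst.
    by apply: cvgMl.
  rewrite mulr0 subr0 in cv1; apply: (cvgr_le_cst _ cv1); apply: nearW => i.
  (* A nonnegative h is a multiple of u_i up to a remainder of at most u_i, whose contribution
     vanishes with i by the Lipschitz bound. *)
  pose m := Num.truncn (h / u i).
  have /andP[m1 m2] : m%:R <= h / u i < m.+1%:R by apply: truncn_itv; rewrite divr_ge0// ltW.
  have hu : m%:R * u i <= h by rewrite -ler_pdivlMr.
  have hu' : h - m%:R * u i <= u i.
    by move: m2; rewrite ltr_pdivrMr// -natr1 mulrDl mul1r => /ltW; lra.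
  have mu0 : 0 <= m%:R * u i by rewrite mulr_ge0// ltW.
  have h1 := mul (u i) m (ltW (u0 i)) (le_trans hu ht).
  have d0 : 0 <= h - m%:R * u i by rewrite subr_ge0.
  have Eh : m%:R * u i + (h - m%:R * u i) = h by ring.
  have := Ha (m%:R * u i) (h - m%:R * u i); rewrite Eh (ger0_norm mu0) (ger0_norm d0) => h2.
  have {}h2 := h2 (le_trans hu ht) (le_trans hu' (ule i)).
  have := Ba (h - m%:R * u i); rewrite (ger0_norm d0) => /(_ (le_trans hu' (ule i))) h3.
  have := Ba (u i); rewrite (gtr0_norm (u0 i)) => /(_ (ule i)) h4.
  have E : m%:R * a (u i) = D i * (m%:R * u i) by rewrite mulrCA /D mulfVK ?lt0r_neq0.
  have h5 : `|D i * (h - m%:R * u i)| <= C' * u i.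
    rewrite normrM (ger0_norm d0); apply: ler_pM => //.
    by rewrite /D normrM normfV (gtr0_norm (u0 i)) ler_pdivrMr.
  have -> : a h - D i * h = (a h - a (m%:R * u i) - a (h - m%:R * u i)) + a (h - m%:R * u i) +
     (a (m%:R * u i) - m%:R * a (u i)) - D i * (h - m%:R * u i).
    by rewrite E; ring.
  have n1 := ler_normB ((a h - a (m%:R * u i) - a (h - m%:R * u i)) + a (h - m%:R * u i) +
     (a (m%:R * u i) - m%:R * a (u i))) (D i * (h - m%:R * u i)).
  have n2 := ler_normD ((a h - a (m%:R * u i) - a (h - m%:R * u i)) + a (h - m%:R * u i))
     (a (m%:R * u i) - m%:R * a (u i)).
  have n3 := ler_normD (a h - a (m%:R * u i) - a (h - m%:R * u i)) (a (h - m%:R * u i)).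
  have b1 : C * (m%:R * u i) * (h - m%:R * u i) <= C * tau * u i.
    apply: ler_pM => //; first by rewrite mulr_ge0.
    by rewrite ler_wpM2l// (le_trans hu).
  have b2 : C' * (h - m%:R * u i) <= C' * u i by rewrite ler_wpM2l.
  have b3 : C * (m%:R * u i) ^+ 2 <= C * h ^+ 2.
    by rewrite ler_wpM2l// ler_pXn2r ?nnegrE.
  lra.
move=> h ht.
have Ch0 : 0 <= C * h ^+ 2 by rewrite mulr_ge0 ?sqr_ge0.
have [h0|/ltW h0] := leP 0 h.
  by rewrite ger0_norm// in ht; apply: le_trans (pos _ h0 ht) _; lra.
have nh : 0 <= - h by rewrite oppr_ge0.
rewrite ler0_norm// in ht.
have h1 := pos _ nh ht.
(* The defect of additivity at h and - h relates the two signs and doubles the constant. *)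
have := Ha h (- h); rewrite subrr a0 normrN (ler0_norm h0) => /(_ ht ht) h2.
have -> : a h - lim (D @ \oo) * h = - (0 - a h - a (- h)) - (a (- h) - lim (D @ \oo) * - h) by ring.
apply: le_trans (ler_normB _ _) _; rewrite normrN.
rewrite sqrrN in h1; have : C * - h * - h = C * h ^+ 2 by ring.
lra.
Qed.

Lemma cvg_quotient (R : realType) (phi : R -> R) (D K tau : R) : 0 < tau -> 0 <= K ->
  (forall h, `|h| <= tau -> `|phi h - D * h| <= K * h ^+ 2) ->
  (fun h => h^-1 * phi h) @ 0^' --> D.
Proof.
move=> t0 K0 H; apply/cvgrPdist_le => eps e0.
have K1 : 0 < K + 1 by rewrite ltr_wpDl.
have m0 : 0 < Num.min tau (eps / (K + 1)) by rewrite lt_min t0 divr_gt0.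
near=> h.
have h0 : h != 0 by near: h; exact: nbhs_dnbhs_neq.
have hm : `|h| < Num.min tau (eps / (K + 1)).
  by near: h; exact: dnbhs0_lt.
move: hm; rewrite lt_min => /andP[/ltW ht he].
have hp : 0 < `|h| by rewrite normr_gt0.
have E : D - h^-1 * phi h = - (h^-1 * (phi h - D * h)) by field.
rewrite E normrN normrM normfV ler_pdivrMl//.
apply: le_trans (H _ ht) _; rewrite -(real_normK (num_real h)) expr2 mulrCA ler_pM2l//.
by rewrite ltr_pdivlMr// in he; have := normr_ge0 h; nra.
Unshelve. all: by end_near. Qed.

Lemma sub_shuffle (V : zmodType) (x y z t : V) : x - t - (y - t) - (z - t) = x - y - (z - t).
Proof. by rewrite opprB addrA subrK. Qed.

Section SmoothFunctional.
Variables (R : realType) (T : R) (m n : nat).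
Hypothesis T_gt0 : 0 < T.
Local Notation P := ('rV[R]_m * (R -> 'rV[R]_n))%type.
Implicit Types (U : P -> R) (q v : P) (c : R -> R).

Definition tame_pt (q : P) : Prop := exists M, tame T M q.2.

Definition tame_dir N (v : P) : Prop := 0 < N /\ unit_dir T (N^-1 *: v).

(* Bounds on mixed differences replace derivatives: order j + 1 makes the
   difference quotients of order j converge with a rate. *)
Definition smooth j U c : Prop := (forall M, 0 <= c M) /\
  forall M q (L : seq (R * P)), tame T M q.2 -> (size L <= j)%N ->
  (forall tv, tv \in L -> `|tv.1| <= 1 /\ unit_dir T tv.2) ->
  `|mdiff U [seq tv.1 *: tv.2 | tv <- L] q| <= c M * \prod_(tv <- L) `|tv.1|.

Definition dir_derive v U q : R := lim ((fun h => h^-1 * (U (q + h *: v) - U q)) @ 0^').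

Lemma tame_ptD q v (s : R) N : tame_dir N v -> tame_pt q -> tame_pt (q + s *: v).
Proof.
move=> [N0 [_ _ tv]] [M tq]; exists (M + `|s| * (`|N| * 1)).
have := tameZ N tv; have -> : N *: (N^-1 *: v).2 = v.2.
  by rewrite /= scalerA divff ?scale1r ?lt0r_neq0.
by move=> tv'; exact: (tameD tq (tameZ s tv')).
Qed.

Lemma rescale_dir N v (h : R) : tame_dir N v -> h *: v = (h * N) *: (N^-1 *: v).
Proof. by move=> [N0 _]; rewrite scalerA mulfK// lt0r_neq0. Qed.

(** Second differences of Y along v are the defect of additivity of h -> Y (q + h v) - Y q. The
    factor N^2 undoes the normalisation of both steps. *)
Lemma rate_ex (Y : P -> R) q v N (C : R) : tame_dir N v -> 0 <= C ->
  (forall h k, `|h| <= 1 -> `|k| <= 1 ->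
    `|mdiff Y [:: h *: (N^-1 *: v); k *: (N^-1 *: v)] q| <= C * `|h| * `|k|) ->
  (exists C', 0 <= C' /\ forall h, `|h| <= 1 ->
    `|mdiff Y [:: h *: (N^-1 *: v)] q| <= C' * `|h|) ->
  (fun h => h^-1 * (Y (q + h *: v) - Y q)) @ 0^' --> dir_derive v Y q /\
  forall h, `|h| <= N^-1 ->
    `|Y (q + h *: v) - Y q - dir_derive v Y q * h| <= 2 * (C * N ^+ 2) * h ^+ 2.
Proof.
move=> tv C0 H2 [C' [C'0 H1]]; have N0 := tv.1.
have hN h : `|h| <= N^-1 -> `|h * N| <= 1.
  by move=> hN; rewrite normrM (gtr0_norm N0) -ler_pdivlMr// mul1r.
have [|||h k hh kk|h hh|D HD] := @quasi_additive_derivable R (fun h => Y (q + h *: v) - Y q)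
    (C * N ^+ 2) (C' * N) N^-1.
- by rewrite invr_gt0.
- by rewrite mulr_ge0 ?sqr_ge0.
- by rewrite mulr_ge0// ltW.
- have := H2 _ _ (hN h hh) (hN k kk); rewrite -!(rescale_dir _ tv) /=.
  rewrite -[q + h *: v + k *: v]addrA -scalerDl !normrM (gtr0_norm N0) => H.
  rewrite sub_shuffle; apply: le_trans H _.
  by rewrite le_eqVlt; apply/orP; left; apply/eqP; ring.
- have := H1 _ (hN h hh); rewrite -!(rescale_dir _ tv) /= normrM (gtr0_norm N0) => H.
  by apply: le_trans H _; rewrite le_eqVlt; apply/orP; left; apply/eqP; ring.
have K0 : 0 <= 2 * (C * N ^+ 2) by apply: mulr_ge0 => //; apply: mulr_ge0 => //; exact: sqr_ge0.
have Ni : 0 < N^-1 by rewrite invr_gt0.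
have cv := cvg_quotient Ni K0 HD.
by rewrite /dir_derive (cvg_lim _ cv).
Qed.

Lemma dir_derive_rate j U c M q v N : smooth j.+2 U c -> tame_dir N v -> tame T M q.2 ->
  (fun h => h^-1 * (U (q + h *: v) - U q)) @ 0^' --> dir_derive v U q /\
  forall h, `|h| <= N^-1 ->
    `|U (q + h *: v) - U q - dir_derive v U q * h| <= 2 * (c M * N ^+ 2) * h ^+ 2.
Proof.
move=> [c0 sU] tv tq; apply: rate_ex => //.
  move=> h k h1 k1; have := sU M q [:: (h, N^-1 *: v); (k, N^-1 *: v)] tq isT.
  rewrite !big_cons big_nil mulr1 mulrA; apply.
  by move=> _ /[!inE] /orP[]/eqP->; split=> //; exact: tv.2.
exists (c M); split=> // h h1; have := sU M q [:: (h, N^-1 *: v)] tq isT.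
rewrite !big_cons big_nil mulr1; apply.
by move=> _ /[!inE] /eqP->; split=> //; exact: tv.2.
Qed.

Lemma cvg_mdiff (I : Type) (F : set_system I) (FF : Filter F) (G : P -> Prop)
    (f : I -> P -> R) (f' : P -> R) (L : seq P) q :
  (forall y v, v \in L -> G y -> G (y + v)) -> G q ->
  (forall y, G y -> (fun i => f i y) @ F --> f' y) ->
  (fun i => mdiff (f i) L q) @ F --> mdiff f' L q.
Proof.
elim: L q => [|v L IH] q GL Gq Hf /=; first exact: Hf.
apply: cvgB; apply: IH => //.
- by move=> y w wL; apply: GL; rewrite inE wL orbT.
- by apply: GL => //; exact: mem_head.
- by move=> y w wL; apply: GL; rewrite inE wL orbT.
Qed.

Lemma unit_tame_dir v : unit_dir T v -> tame_dir 1 v.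
Proof. by move=> uv; split=> //; rewrite invr1 scale1r. Qed.

(** A mixed difference of the derivative is a limit of mixed differences of U with one more step h
    v, divided by h. That step contributes |h| N to the bound, so the quotients are bounded
    uniformly in h. *)
Lemma smooth_dir_derive j U c v N : tame_dir N v -> smooth j.+2 U c ->
  smooth j.+1 (dir_derive v U) (fun M => c M * N).
Proof.
move=> tv sU; have [c0 bU] := sU; split=> [M|M q L tq Lj HL].
  by rewrite mulr_ge0// ltW// tv.1.
have cv : (fun h => `|mdiff (fun y => h^-1 * (U (y + h *: v) - U y)) [seq tv.1 *: tv.2 | tv <- L] q|)
    @ 0^' --> `|mdiff (dir_derive v U) [seq tv.1 *: tv.2 | tv <- L] q|.
  apply: cvg_norm; apply: (@cvg_mdiff _ _ _ tame_pt).
  - by move=> y _ /mapP[w /HL[_ uw] ->]; apply: tame_ptD; exact: unit_tame_dir.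
  - by exists M.
  by move=> y [M' ty]; case: (dir_derive_rate sU tv ty).
have N0 := tv.1.
apply: (cvgr_le_cst _ cv); near=> h.
have h0 : h != 0 by near: h; exact: nbhs_dnbhs_neq.
have hN : `|h * N| <= 1.
  rewrite normrM (gtr0_norm N0) -ler_pdivlMr// mul1r.
  by near: h; apply: dnbhs0_le; rewrite invr_gt0.
rewrite mdiffZ -mdiff_cons normrM normfV.
have := bU M q ((h * N, N^-1 *: v) :: L) tq Lj.
rewrite big_cons/= -(rescale_dir _ tv) => H.
rewrite ler_pdivrMl ?normr_gt0//; apply: le_trans (H _) _.
  move=> w; rewrite inE => /orP[/eqP->|]; last exact: HL.
  by split; [exact: hN|exact: tv.2].
rewrite normrM (gtr0_norm N0) le_eqVlt; apply/orP; left; apply/eqP; ring.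
Unshelve. all: by end_near. Qed.

Fixpoint dir_derives (vs : seq P) U : P -> R :=
  if vs is v :: vs' then dir_derive v (dir_derives vs' U) else U.

(** For two directions, each of the two derivatives costs 2 c N^3 s. Dividing the second error by s
    is affordable because the second differences of Z = U(. + s v1) - U carry a factor s already;
    this is where the bound of order three enters. *)
Lemma dir_derives_approx U c M q (vs : seq P) N (s : R) :
  smooth 3 U c -> 1 <= N -> (size vs <= 2)%N -> (forall v, v \in vs -> tame_dir N v) ->
  tame T M q.2 -> 0 < s -> s <= N^-1 ->
  `|dir_derives vs U q - s ^- size vs * mdiff U (map ( *:%R s) vs) q| <= 4 * N ^+ 3 * c M * s.
Proof.
move=> sU N1 + Hvs tq s0 sN; have [c0 bU] := sU; have cM0 := c0 M.
have N0 : 0 < N by apply: lt_le_trans N1.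
have sn : `|s| <= N^-1 by rewrite gtr0_norm.
have sN1 : `|s * N| <= 1.
  by rewrite normrM (gtr0_norm N0) -ler_pdivlMr// mul1r.
have rhs0 : 0 <= 4 * N ^+ 3 * c M * s.
  by rewrite !mulr_ge0 ?exprn_ge0// ltW.
have rate1 Y D (C : R) : 0 <= C -> `|Y - D * s| <= C * s ^+ 2 -> `|D - s^-1 * Y| <= C * s.
  move=> C0 H; have -> : D - s^-1 * Y = - (s^-1 * (Y - D * s)) by field; rewrite lt0r_neq0.
  rewrite normrN normrM normfV (gtr0_norm s0) ler_pdivrMl// (le_trans H)//.
  by rewrite le_eqVlt; apply/orP; left; apply/eqP; ring.
case: vs Hvs => [|v1 [|v2 [|//]]] Hvs _ /=.
- by rewrite expr0 invr1 mul1r subrr normr0.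
- have tv1 := Hvs v1 (mem_head _ _).
  rewrite expr1; apply: (@le_trans _ _ (2 * (c M * N ^+ 2) * s)).
    apply: rate1; first by do ?[done | exact: ltW | apply: mulr_ge0].
    by have [_] := dir_derive_rate sU tv1 tq; apply.
  have : c M * N ^+ 2 <= c M * N ^+ 3 by rewrite ler_wpM2l// ler_weXn2l.
  have : 0 <= c M * N ^+ 2 by do ?[done | exact: ltW | apply: mulr_ge0].
  by move=> h1 h2; rewrite ler_wpM2r ?(ltW s0)//; lra.
have tv1 := Hvs v1 (mem_head _ _).
have tv2 : tame_dir N v2 by apply: Hvs; rewrite !inE eqxx orbT.
set Y := dir_derive v2 U.
have sY : smooth 2 Y (fun M => c M * N) by exact: smooth_dir_derive.
have [_ /(_ s sn) r1] := dir_derive_rate sY tv1 tq.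
have {}r1 := rate1 _ _ _ _ r1.
have {}r1 : `|dir_derive v1 Y q - s^-1 * (Y (q + s *: v1) - Y q)| <= 2 * (c M * N * N ^+ 2) * s.
  by apply: r1; do ?[done | exact: ltW | apply: mulr_ge0].
pose Z y := U (y + s *: v1) - U y.
have as1 : `|s * N| = s * N by rewrite gtr0_norm// mulr_gt0.
have Cs0 : 0 <= c M * (s * N) by do ?[done | exact: ltW | apply: mulr_ge0].
have Z2 h k : `|h| <= 1 -> `|k| <= 1 ->
    `|mdiff Z [:: h *: (N^-1 *: v2); k *: (N^-1 *: v2)] q| <= c M * (s * N) * `|h| * `|k|.
  move=> h1 k1; rewrite -mdiff_cons (rescale_dir _ tv1).
  have := bU M q [:: (s * N, N^-1 *: v1); (h, N^-1 *: v2); (k, N^-1 *: v2)] tq isT.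
  rewrite !big_cons big_nil mulr1 as1 => H; apply: le_trans (H _) _.
    by move=> w; rewrite !inE => /or3P[]/eqP->; split=> //; do ?[exact: tv1.2 | exact: tv2.2].
  by rewrite !mulrA.
have Z1 : exists C', 0 <= C' /\ forall h, `|h| <= 1 ->
    `|mdiff Z [:: h *: (N^-1 *: v2)] q| <= C' * `|h|.
  exists (c M * (s * N)); split=> // h h1; rewrite -mdiff_cons (rescale_dir _ tv1).
  have := bU M q [:: (s * N, N^-1 *: v1); (h, N^-1 *: v2)] tq isT.
  rewrite !big_cons big_nil mulr1 as1 => H; apply: le_trans (H _) _.
    by move=> w; rewrite !inE => /orP[]/eqP->; split=> //; do ?[exact: tv1.2 | exact: tv2.2].
  by rewrite le_eqVlt; apply/orP; left; apply/eqP => /=; ring.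
have [cvZ /(_ s sn) rZ] := rate_ex tv2 Cs0 Z2 Z1.
have DZ : dir_derive v2 Z q = Y (q + s *: v1) - Y q.
  have [M' tq'] := tame_ptD s tv1 (ex_intro _ M tq).
  have [cv1 _] := dir_derive_rate sU tv2 tq'; have [cv2 _] := dir_derive_rate sU tv2 tq.
  apply: cvg_lim => //; rewrite (_ : (fun h => _) = (fun h => h^-1 * (U (q + s *: v1 + h *: v2) - U (q + s *: v1)) -
      h^-1 * (U (q + h *: v2) - U q))).
    exact: cvgB.
  by apply/funext => h; rewrite /Z [q + h *: v2 + _]addrAC; ring.
rewrite DZ in rZ; have {}rZ := rate1 _ _ _ _ rZ.
have {}rZ : `|(Y (q + s *: v1) - Y q) - s^-1 * (Z (q + s *: v2) - Z q)| <=
    2 * (c M * (s * N) * N ^+ 2) * s.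
  by apply: rZ; do ?[done | exact: ltW | apply: mulr_ge0].
have EZ : s ^- 2 * (U (q + s *: v1 + s *: v2) - U (q + s *: v1) - (U (q + s *: v2) - U q)) =
    s^-1 * (s^-1 * (Z (q + s *: v2) - Z q)).
  by rewrite /Z [q + s *: v2 + _]addrAC; field; rewrite lt0r_neq0.
rewrite EZ.
have -> : dir_derive v1 Y q - s^-1 * (s^-1 * (Z (q + s *: v2) - Z q)) =
   (dir_derive v1 Y q - s^-1 * (Y (q + s *: v1) - Y q)) +
   s^-1 * ((Y (q + s *: v1) - Y q) - s^-1 * (Z (q + s *: v2) - Z q)) by ring.
apply: le_trans (ler_normD _ _) _.
have -> : 4 * N ^+ 3 * c M * s = 2 * (c M * N * N ^+ 2) * s + s^-1 * (2 * (c M * (s * N) * N ^+ 2) * s).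
  by field; rewrite lt0r_neq0.
by rewrite lerD// normrM normfV (gtr0_norm s0) ler_wpM2l// invr_ge0 ltW.
Qed.

Definition near_pt (o : R) (q q' : P) : Prop :=
  (forall s, 0 <= s <= T -> enorm (q'.2 s - q.2 s) <= o) /\ enorm (q'.1 - q.1) <= o.

Lemma near_ptD o o' q q' v v' : near_pt o q q' -> near_pt o' v v' ->
  near_pt (o + o') (q + v) (q' + v').
Proof.
move=> [H1 H2] [H3 H4]; split=> [s sT|] /=.
  rewrite fctE opprD addrACA; apply: le_trans (enormD _ _) _.
  by apply: lerD; [exact: H1|exact: H3].
rewrite opprD addrACA; apply: le_trans (enormD _ _) _; exact: lerD.
Qed.

Lemma near_ptZ o (s : R) v v' : near_pt o v v' -> near_pt (`|s| * o) (s *: v) (s *: v').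
Proof.
move=> [H1 H2]; split=> [t tT|] /=.
  by rewrite fctE -scalerBr enormZ ler_wpM2l// H1.
by rewrite -scalerBr enormZ ler_wpM2l.
Qed.

(** The 2^(size L) vertices of both cubes have variation at most Mb, where U is Lipschitz, and each
    direction adds at most o' to the distance of corresponding vertices. *)
Lemma mdiff_near U (Mb c : R) (L : seq (P * P)) q q' (M N o o' : R) :
  (forall q q' o, tame T Mb q.2 -> tame T Mb q'.2 -> near_pt o q q' ->
     `|U q' - U q| <= c * o) ->
  0 <= c -> 0 <= N -> M + (size L)%:R * N <= Mb -> tame T M q.2 -> tame T M q'.2 -> near_pt o q q' ->
  (forall vv, vv \in L -> [/\ tame T N vv.1.2, tame T N vv.2.2 & near_pt o' vv.1 vv.2]) ->
  `|mdiff U (map snd L) q' - mdiff U (map fst L) q| <= 2 ^+ size L * (c * (o + (size L)%:R * o')).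
Proof.
move=> HU c0 N0; elim: L q q' M o => [|[v v'] L IH] q q' M o MN tq tq' qq' HL.
  rewrite /= mul0r addr0 in MN.
  by rewrite expr0 mul1r mul0r addr0; apply: HU => //; apply: tame_mono MN _.
have [/= tv tv' vv'] := HL _ (mem_head _ _).
have o'0 : 0 <= o' by apply: le_trans vv'.2; exact: enorm_ge0.
have {}HL vv : vv \in L -> [/\ tame T N vv.1.2, tame T N vv.2.2 & near_pt o' vv.1 vv.2].
  by move=> vL; apply: HL; rewrite inE vL orbT.
have E : (size ((v, v') :: L))%:R = (size L)%:R + 1 :> R by rewrite /= -natr1.
rewrite E in MN *.
have L0 : 0 <= (size L)%:R :> R by [].
have MN1 : M + N + (size L)%:R * N <= Mb by lra.
have MN2 : M + (size L)%:R * N <= Mb by lra.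
have H1 := IH (q + v) (q' + v') (M + N) (o + o') MN1 (tameD tq tv) (tameD tq' tv') (near_ptD qq' vv') HL.
have H2 := IH q q' M o MN2 tq tq' qq' HL.
rewrite /=.
have -> : mdiff U (map snd L) (q' + v') - mdiff U (map snd L) q' -
   (mdiff U (map fst L) (q + v) - mdiff U (map fst L) q) =
   (mdiff U (map snd L) (q' + v') - mdiff U (map fst L) (q + v)) -
   (mdiff U (map snd L) q' - mdiff U (map fst L) q) by ring.
apply: le_trans (ler_normB _ _) _; apply: le_trans (lerD H1 H2) _.
rewrite exprS; set p := 2 ^+ size L.
have p0 : 0 <= p by rewrite exprn_ge0.
have co : 0 <= c * o' by rewrite mulr_ge0.
have pco : 0 <= p * (c * o') by rewrite mulr_ge0.
lra.
Qed.

(** Both derivatives are replaced by difference quotients with the same step s, at an error linear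
    in s; the quotients are compared through the Lipschitz bound. In use, s is fixed before o and
    o', which must be small against the power of s in the denominator. *)
Lemma dir_derives_near U c M N (Mb c2 : R) (vs vs' : seq P) q q' (s o o' : R) :
  smooth 3 U c -> 1 <= N -> M + N *+ 2 <= Mb -> 0 <= c2 ->
  (forall q q' o, tame T Mb q.2 -> tame T Mb q'.2 -> near_pt o q q' ->
     `|U q' - U q| <= c2 * o) ->
  tame T M q.2 -> tame T M q'.2 -> near_pt o q q' ->
  size vs = size vs' -> (size vs <= 2)%N -> 0 < s -> s <= N^-1 -> 0 <= o' ->
  (forall vv, vv \in zip vs vs' ->
     [/\ tame_dir N vv.1, tame_dir N vv.2 & near_pt o' vv.1 vv.2]) ->
  `|dir_derives vs' U q' - dir_derives vs U q| <=
    8 * N ^+ 3 * c M * s + s ^- size vs * (4 * (c2 * (o + 2 * s * o'))).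
Proof.
move=> sU N1 MN c20 HU tq tq' qq' sz vs2 s0 sN o'0 Hz.
have N0 : 0 < N by apply: lt_le_trans N1.
have o0 : 0 <= o by apply: le_trans qq'.2; exact: enorm_ge0.
have z1 : vs = map fst (zip vs vs') by rewrite -/(unzip1 _) unzip1_zip// sz.
have z2 : vs' = map snd (zip vs vs') by rewrite -/(unzip2 _) unzip2_zip// sz.
have t1 v : v \in vs -> tame_dir N v by rewrite z1 => /mapP[vv /Hz[? _ _] ->].
have t2 v : v \in vs' -> tame_dir N v by rewrite z2 => /mapP[vv /Hz[_ ? _] ->].
have A1 := dir_derives_approx sU N1 vs2 t1 tq s0 sN.
have vs2' : (size vs' <= 2)%N by rewrite -sz.
have A2 := dir_derives_approx sU N1 vs2' t2 tq' s0 sN.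
pose L := [seq (s *: vv.1, s *: vv.2) | vv <- zip vs vs'].
have sL : size L = size vs by rewrite size_map size_zip -sz minnn.
have L1 : map fst L = map ( *:%R s) vs by rewrite [in RHS]z1 /L -!map_comp.
have L2 : map snd L = map ( *:%R s) vs' by rewrite [in RHS]z2 /L -!map_comp.
have tdir v : tame_dir N v -> tame T 1 (s *: v).2.
  move=> tv; rewrite (rescale_dir s tv); have [_ _ tv'] := tv.2.
  have := tameZ (s * N) tv'; apply: tame_mono.
  by rewrite mulr1 ger0_norm ?mulr_ge0 ?(ltW s0) ?(ltW N0)// -ler_pdivlMr// mul1r.
have B : `|mdiff U (map snd L) q' - mdiff U (map fst L) q| <=
    2 ^+ size L * (c2 * (o + (size L)%:R * (s * o'))).
  apply: (@mdiff_near U Mb c2 L q q' M 1) => //.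
    rewrite sL; apply: le_trans MN; rewrite lerD2l mulr1 mulr2n.
    apply: (@le_trans _ _ 2); [by rewrite ler_nat|lra].
  move=> _ /mapP[vv /Hz[d1 d2 nv] ->]; split=> /=.
  - exact: (tdir vv.1 d1).
  - exact: (tdir vv.2 d2).
  by have := near_ptZ s nv; rewrite (gtr0_norm s0).
rewrite L1 L2 sL in B.
have s'0 : 0 < s ^- size vs by rewrite invr_gt0 exprn_gt0.
rewrite -sz in A2.
have -> : dir_derives vs' U q' - dir_derives vs U q =
  (dir_derives vs' U q' - s ^- size vs * mdiff U (map ( *:%R s) vs') q') -
  (dir_derives vs U q - s ^- size vs * mdiff U (map ( *:%R s) vs) q) +
  s ^- size vs * (mdiff U (map ( *:%R s) vs') q' - mdiff U (map ( *:%R s) vs) q) by ring.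
apply: le_trans (ler_normD _ _) _; apply: lerD.
  by apply: le_trans (ler_normB _ _) _; have := lerD A2 A1; lra.
rewrite normrM (gtr0_norm s'0) ler_pM2l//; apply: le_trans B _.
have c0 : 0 <= c2 * (o + 2 * (s * o')) by rewrite mulr_ge0// addr_ge0// !mulr_ge0// ltW.
have so : 0 <= s * o' by rewrite mulr_ge0// ltW.
apply: ler_pM.
- by rewrite exprn_ge0.
- by rewrite mulr_ge0// addr_ge0// mulr_ge0.
- rewrite (_ : 4 = 2 ^+ 2); last by ring.
  by apply: ler_weXn2l => //; rewrite ler1n.
by rewrite ler_wpM2l// lerD2l -mulrA ler_wpM2r// ler_nat.
Qed.

End SmoothFunctional.

(** * The path space *)

Section VariationControl.
Variables (R : realType) (n : nat).
Implicit Types (gam : R -> 'rV[R]_n) (s : seq R).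

Fixpoint var_sum (q : R) gam a s : R :=
  if s is x :: s' then enorm (gam x - gam a) `^ q + var_sum q gam x s' else 0.

Lemma var_sumE q gam (a b : R) s :
  \sum_(i < size s) enorm (gam (nth b s i) - gam (nth b (a :: s) i)) `^ q =
  var_sum q gam a s.
Proof.
elim: s a => [|x s IH] a; first by rewrite big_ord0.
by rewrite big_ord_recl /= -IH.
Qed.

Lemma pvarE q a b gam : pvar q a b gam =
  (ereal_sup [set (var_sum q gam a s)%:E | s in [set s | itv_partition a b s]] `^ q^-1)%E.
Proof.
rewrite /pvar; congr (ereal_sup _ `^ _)%E; apply/seteqP; split=> _ [s ps <-];
  by exists s => //; rewrite var_sumE.
Qed.

Lemma var_sum_ge0 q gam a s : 0 <= var_sum q gam a s.
Proof. by elim: s a => //= x s IH a; rewrite addr_ge0 ?powR_ge0. Qed.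

Lemma var_sum_rcons gam a s x :
  var_sum 1 gam a (rcons s x) = var_sum 1 gam a s + enorm (gam x - gam (last a s)).
Proof.
elim: s a => [|y s IH] a /=; first by rewrite powRr1 ?enorm_ge0// addr0 add0r.
by rewrite IH addrA.
Qed.

Lemma itv_partition_rcons a b c s : itv_partition a b s -> b < c ->
  itv_partition a c (rcons s c).
Proof.
by move=> [ps /eqP sb] bc; split; rewrite ?rcons_path ?ps ?sb ?bc// last_rcons.
Qed.

Lemma pvar_ge_sum q a b gam s : 0 < q -> itv_partition a b s ->
  ((var_sum q gam a s `^ q^-1)%:E <= pvar q a b gam)%E.
Proof.
move=> q0 ps; rewrite pvarE -poweR_EFin.
have ub : ((var_sum q gam a s)%:E <=
    ereal_sup [set (var_sum q gam a s)%:E | s in [set s | itv_partition a b s]])%E.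
  by apply: ereal_sup_ubound; exists s.
apply: gt0_ler_poweR => //.
- by rewrite invr_ge0 ltW.
- by rewrite in_itv/= lee_fin var_sum_ge0 leey.
by rewrite in_itv/= leey andbT (le_trans _ ub)// lee_fin var_sum_ge0.
Qed.

Lemma enorm_le_pvar q (T s : R) gam : 0 < q -> 0 <= s <= T ->
  ((enorm (gam s - gam 0))%:E <= pvar q 0 T gam)%E.
Proof.
move=> q0 /andP[s0 sT].
have powK (x : R) : 0 <= x -> (x `^ q) `^ q^-1 = x.
  by move=> x0; rewrite -powRrM divff ?powRr1// lt0r_neq0.
have le1 (x y : R) : 0 <= x -> 0 <= y -> x <= (x `^ q + y) `^ q^-1.
  move=> x0 y0; rewrite -{1}(powK x x0); apply: ge0_ler_powR.
  - by rewrite invr_ge0 ltW.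
  - by rewrite nnegrE powR_ge0.
  - by rewrite nnegrE addr_ge0 ?powR_ge0.
  by rewrite lerDl.
have [s_eq|sn] := eqVneq s 0.
  rewrite s_eq subrr enorm0 pvarE; exact: poweR_ge0.
have sp : 0 < s by rewrite lt_def sn.
have [->|sTn] := eqVneq s T.
  have T0 : 0 < T by apply: lt_le_trans sT.
  apply: le_trans (pvar_ge_sum gam q0 (itv_partition1 T0)).
  by rewrite lee_fin le1 ?enorm_ge0.
have sT' : s < T by rewrite lt_neqAle sTn.
apply: le_trans (pvar_ge_sum gam q0 (itv_partition_rcons (itv_partition1 sp) sT')).
by rewrite lee_fin /= le1 ?enorm_ge0// addr0 powR_ge0.
Qed.

(** The control is the variation function, V t being the supremum of the variation sums over
    partitions of [0, t]. Appending t to a partition of [0, s] bounds its increments from below. *)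
Lemma pvar1_controlled (T M : R) gam : 0 < T -> (pvar 1 0 T gam <= M%:E)%E ->
  exists V, controlled T V gam /\ V T - V 0 <= M.
Proof.
move=> T0 pM.
have TM s : itv_partition 0 T s -> var_sum 1 gam 0 s <= M.
  move=> ps; rewrite -lee_fin; apply: le_trans pM.
  apply: le_trans (pvar_ge_sum gam ltr01 ps).
  by rewrite lee_fin invr1 powRr1// var_sum_ge0.
pose A t := [set var_sum 1 gam 0 s | s in [set s | itv_partition 0 t s]].
have part t : 0 <= t -> exists s, itv_partition 0 t s.
  rewrite le_eqVlt => /orP[/eqP<-|t0]; first by exists [::].
  by exists [:: t]; exact: itv_partition1.
have ext (u t x : R) : u < t -> A u x -> A t (x + enorm (gam t - gam u)).
  move=> ut [p pp <-]; exists (rcons p t); first exact: itv_partition_rcons pp ut.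
  by rewrite var_sum_rcons; case: pp => _ /eqP->.
have bd t : t <= T -> ubound (A t) M.
  rewrite le_eqVlt => /orP[/eqP->|tT] x Ax.
    by move: Ax => [p pp <-]; exact: TM.
  have [p pp E] := ext _ _ _ tT Ax.
  by have := TM p pp; rewrite E; have := enorm_ge0 (gam T - gam t); lra.
have hs t : 0 <= t -> t <= T -> has_sup (A t).
  move=> t0 tT; split; last by exists M; exact: bd.
  by have [p pp] := part t t0; exists (var_sum 1 gam 0 p), p.
exists (fun t => sup (A t)); split.
  move=> s t s0 st tT; have [->|ne] := eqVneq s t; first by rewrite !subrr enorm0.
  have slt : s < t by rewrite lt_neqAle ne.
  rewrite lerBrDl addrC -lerBrDl.
  apply: ge_sup; first by have [] := hs s s0 (le_trans st tT).
  move=> x Ax; rewrite lerBrDl addrC; apply: ub_le_sup; first by have [] := hs t (le_trans s0 st) tT.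
  exact: ext.
have h1 : sup (A T) <= M.
  by apply: ge_sup; [have [] := hs T (ltW T0) (lexx T)|exact: bd].
have h2 : 0 <= sup (A 0).
  by apply: ub_le_sup; [have [] := hs 0 (lexx 0) (ltW T0)|exists [::]].
lra.
Qed.

Lemma continuous_path_ucont (T : R) gam : {within `[0, T]%classic, continuous gam} ->
  path_ucont T gam.
Proof.
move=> /subspace_continuousP cg eps e0.
have coord (v : 'rV[R]_n) i : `|v 0 i| <= `|v|.
  by rewrite [leRHS]mx_normrE; exact: (le_bigmax _ (fun ij => `|v ij.1 ij.2|) (0, i)).
(* Continuity is stated in the maximum norm, uniform continuity in the Euclidean one. *)
have en (v : 'rV[R]_n) : enorm v <= n%:R * `|v|.
  apply: le_trans (enorm_le_sum v) _.
  by rewrite mulr_natl -[X in _ <= _ *+ X]card_ord -sumr_const; apply: ler_sum => i _.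
have nn : 0 < n%:R + 1 :> R by rewrite ltr_wpDl.
have e2 : 0 < eps / 2 / (n%:R + 1) by rewrite !divr_gt0.
pose Q (delta u : R) := 0 <= u <= T -> forall t, 0 <= t <= T -> `|u - t| < delta -> enorm (gam u - gam t) <= eps.
have : \forall delta \near 0^'+, `[0, T]%classic `<=` Q delta.
  have /compact_near_coveringP := @segment_compact R 0 T; apply => x xT.
  have /cvgrPdist_le/(_ _ e2) := cg x xT.
  rewrite near_withinE => /nbhs_ballP[r /= r0 Hr].
  exists (ball x (r / 2), [set d | d < r / 2]) => /=.
    split; first by apply: nbhsx_ballx; rewrite divr_gt0.
    by apply: nbhs_right_lt; rewrite divr_gt0.
  move=> [u d] /= [xs dr] uT t tT ut.
  have xs' : `|x - u| < r by apply: lt_le_trans xs _; rewrite ler_pdivrMr// ler_peMr ?ler1n// ltW.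
  have xt : `|x - t| < r.
    rewrite (_ : x - t = (x - u) + (u - t)); last by ring.
    apply: le_lt_trans (ler_normD _ _) _; move: xs; rewrite /ball/= => xs; lra.
  have b y : 0 <= y <= T -> `|x - y| < r -> enorm (gam x - gam y) <= eps / 2.
    move=> yT xy; apply: le_trans (en _) _.
    have := Hr y xy; rewrite /= in_itv/= => /(_ yT) H.
    apply: le_trans (ler_wpM2l _ H) _ => //.
    by rewrite mulrA ler_pdivrMr// mulrC ler_pM2l ?divr_gt0// lerDl.
  have -> : gam u - gam t = (gam x - gam t) - (gam x - gam u) by rewrite opprB [RHS]addrC addrA subrK.
  apply: le_trans (enormB _ _) _; rewrite [leRHS]splitr lerD// b//.
have T0 : (0 : R) < 1 by [].
move=> [r /= r0 Hr]; exists (r / 2) => [|s t sT tT st]; first by rewrite divr_gt0.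
have := Hr (r / 2); rewrite /ball_/= sub0r normrN gtr0_norm ?divr_gt0// => H.
have lt1 : r / 2 < r by rewrite ltr_pdivrMr// ltr_pMr// ltr1n.
have sT' : `[0, T]%classic s by rewrite /= in_itv.
exact: (H lt1 isT s sT' sT t tT st).
Qed.

End VariationControl.

Lemma pvar_norm1_tame (R : realType) n (T M : R) (gam : R -> 'rV[R]_n) : 0 < T ->
  {within `[0, T]%classic, continuous gam} -> (pvar_norm 1 0 T gam <= M%:E)%E ->
  tame T M gam /\ forall s, 0 <= s <= T -> enorm (gam s) <= M.
Proof.
move=> T0 cg pM.
have pv0 : (0 <= pvar 1 0 T gam)%E by rewrite pvarE poweR_ge0.
have [v pv] : exists v : R, pvar 1 0 T gam = v%:E.
  exists (fine (pvar 1 0 T gam)); rewrite fineK// ge0_fin_numE//.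
  apply: le_lt_trans (ltry M); apply: le_trans pM; rewrite leeDr// lee_fin.
  exact: enorm_ge0.
rewrite /pvar_norm pv -EFinD lee_fin in pM.
have v0 : 0 <= v by rewrite -lee_fin -pv.
have [V [cV VM]] : exists V, controlled T V gam /\ V T - V 0 <= v.
  by apply: pvar1_controlled => //; rewrite pv.
have e0 := enorm_ge0 (gam 0).
split; first by split; [exists V; split=> //; lra|exact: continuous_path_ucont].
move=> s /andP[s0 sT]; rewrite -(subrK (gam 0) (gam s)).
apply: le_trans (enormD _ _) _.
have := cV 0 s (lexx 0) s0 sT; have := cV s T s0 sT (lexx T).
have := enorm_ge0 (gam T - gam s); lra.
Qed.

Lemma BV0_tame (R : realType) e (T : R) (gam : path_type R e) : 0 < T -> BV0 T gam ->
  exists2 N, 0 < N & (pvar_norm 1 0 T gam <= N%:E)%E.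
Proof.
move=> T0 [_ cg pv _].
have pv0 : (0 <= pvar 1 0 T gam)%E by rewrite pvarE poweR_ge0.
have f0 : 0 <= fine (pvar 1 0 T gam) by rewrite fine_ge0.
exists (enorm (gam 0) + fine (pvar 1 0 T gam) + 1).
  by rewrite ltr_wpDl// addr_ge0// enorm_ge0.
by rewrite /pvar_norm -{1}(fineK (_ : pvar 1 0 T gam \is a fin_num)) ?ge0_fin_numE// -EFinD lee_fin lerDl.
Qed.

Section Frozen.
Variables (R : realType) (T : R) (e : nat).
Hypothesis T_gt0 : 0 < T.
Implicit Types (eta : path_type R e).

Lemma enorm_row_le (v : 'rV[R]_e.+1) :
  enorm (\row_j (if j == 0 then 0 else v 0 j)) <= enorm v.
Proof.
rewrite /enorm ler_wsqrtr//; apply: ler_sum => i _; rewrite mxE.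
by case: ifP => _ //; rewrite expr0n sqr_ge0.
Qed.

Lemma frozenB (s t u t' : R) eta :
  enorm (frozen_direction t eta s - frozen_direction t' eta u) <=
  enorm (eta (Num.max t s) - eta (Num.max t' u)).
Proof.
apply: le_trans (enorm_row_le _); rewrite le_eqVlt; apply/orP; left; apply/eqP.
congr enorm; apply/rowP => j; rewrite !mxE; case: ifP => _ //; exact: subr0.
Qed.

Lemma max_itv (t s : R) : 0 <= t <= T -> 0 <= s <= T -> 0 <= Num.max t s <= T.
Proof. by move=> /andP[t0 tT] /andP[s0 sT]; rewrite le_max t0 ge_max tT. Qed.

Lemma frozen_tame (N t : R) eta : 0 <= t <= T -> tame T N eta ->
  tame T N (frozen_direction t eta).
Proof.
move=> tT [[V [cV VM]] U]; have /andP[t0 t1] := tT; split.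
  exists (fun s => V (Num.max t s)); split.
    move=> s u s0 su uT; apply: le_trans (frozenB _ _ _ _ _) _.
    have m1 : 0 <= Num.max t s <= T by apply: max_itv => //; rewrite s0 (le_trans su).
    have m2 : 0 <= Num.max t u <= T by apply: max_itv => //; rewrite uT (le_trans s0).
    case/andP: m1 => m1 _; case/andP: m2 => _ m2.
    by apply: cV => //; rewrite ge_max !le_max lexx su orbT.
  rewrite (max_r t1) (max_l t0).
  have := cV 0 t (lexx 0) t0 t1; have := enorm_ge0 (eta t - eta 0); lra.
move=> eps e0; have [d d0 H] := U _ e0; exists d => // s u sT uT su.
apply: le_trans (frozenB _ _ _ _ _) _; apply: H; [exact: max_itv|exact: max_itv|].
apply: le_lt_trans su.
have h1 := ler_norm (s - u); have h2 := ler_norm (u - s); rewrite distrC in h2.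
by have [a|a] := leP t s; have [b|b] := leP t u; rewrite ler_norml; apply/andP; split; lra.
Qed.

Lemma frozen_enorm_le (N t s : R) eta : 0 <= t <= T -> 0 <= s <= T ->
  (forall u, 0 <= u <= T -> enorm (eta u) <= N) -> enorm (frozen_direction t eta s) <= N.
Proof.
by move=> tT sT H; apply: le_trans (enorm_row_le _) _; apply: H; exact: max_itv.
Qed.

Lemma frozen_near (eps t : R) eta : 0 < eps -> 0 <= t <= T -> path_ucont T eta ->
  exists2 delta, 0 < delta & forall t', 0 <= t' <= T -> `|t' - t| < delta ->
    forall s, 0 <= s <= T ->
    enorm (frozen_direction t' eta s - frozen_direction t eta s) <= eps.
Proof.
move=> e0 tT U; have [d d0 H] := U _ e0; exists d => // t' t'T tt' s sT.
apply: le_trans (frozenB _ _ _ _ _) _; apply: H; [exact: max_itv|exact: max_itv|].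
apply: le_lt_trans tt'.
have h1 := ler_norm (t' - t); have h2 := ler_norm (t - t'); rewrite distrC in h2.
by have [a|a] := leP t' s; have [b|b] := leP t s; rewrite ler_norml; apply/andP; split; lra.
Qed.

End Frozen.

Section PathTopology.
Variables (R : realType) (T p : R) (d e : nat).
Hypotheses (T_gt0 : 0 < T) (p_gt1 : 1 < p).

(* The uniform topology on paths is coarser than that of [odist], which spares
   the triangle inequality for the p-variation. *)
Definition sup_ball (rho : R) (w z : ppoint R d e) : Prop := exists2 r, r < rho &
  [/\ `|ptime z - ptime w| <= r, enorm (pspace z - pspace w) <= r &
      forall s, 0 <= s <= T -> enorm (ppath z s - ppath w s) <= r].

(** The slack r < rho makes [sup_ball] open: half of the gap rho - r is an admissible radius at each
    of its points, because the p-variation norm dominates the supremum norm. *)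
Lemma sup_ball_nbhs (rho : R) (w : ospace T p d e) : 0 < rho ->
  nbhs w (sup_ball rho w : set (ospace T p d e)).
Proof.
move=> r0; apply/open_nbhs_nbhs; split; last first.
  exists 0 => //; split; first by rewrite subrr normr0.
  - by rewrite subrr enorm0.
  by move=> s _; rewrite subrr enorm0.
move=> z [r rr [h1 h2 h3]]; have e0 : 0 < (rho - r) / 2 by rewrite divr_gt0// subr_gt0.
exists ((rho - r) / 2) => // y zy.
have p0 : 0 < p by apply: lt_trans p_gt1.
have pv0 : (0 <= pvar p 0 T (fun s => (ppath z s - ppath y s)%R))%E by rewrite pvarE poweR_ge0.
have {}zy := ltW zy; rewrite /odist in zy.
have n0 : (0 <= pvar_norm p 0 T (fun s => (ppath z s - ppath y s)%R))%E.
  by rewrite adde_ge0// lee_fin enorm_ge0.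
have a1 : `|ptime z - ptime y| <= (rho - r) / 2.
  rewrite -lee_fin; apply: le_trans zy; rewrite -addeA leeDl// adde_ge0// lee_fin.
  exact: enorm_ge0.
have a2 : enorm (pspace z - pspace y) <= (rho - r) / 2.
  rewrite -lee_fin; apply: le_trans zy; rewrite [X in (_ <= X + _)%E]addeC -addeA leeDl//.
  by rewrite adde_ge0// lee_fin.
have a3 s : 0 <= s <= T -> enorm (ppath z s - ppath y s) <= (rho - r) / 2.
  move=> sT; rewrite -lee_fin; apply: le_trans zy.
  apply: (@le_trans _ _ (pvar_norm p 0 T (fun s => (ppath z s - ppath y s)%R))); last first.
    by rewrite leeDr// adde_ge0// lee_fin ?enorm_ge0.
  rewrite /pvar_norm; apply: le_trans (leeD (lexx _) (enorm_le_pvar _ p0 sT)).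
  rewrite -EFinD lee_fin.
  have := enormD (ppath z 0 - ppath y 0) ((ppath z s - ppath y s) - (ppath z 0 - ppath y 0)).
  by rewrite addrC subrK.
exists (r + (rho - r) / 2); first by lra.
split.
- rewrite (_ : ptime y - ptime w = (ptime z - ptime w) - (ptime z - ptime y)); last by ring.
  by apply: le_trans (ler_normB _ _) _; rewrite lerD.
- rewrite (_ : pspace y - pspace w = (pspace z - pspace w) - (pspace z - pspace y)).
    by apply: le_trans (enormB _ _) _; rewrite lerD.
  by rewrite opprB [RHS]addrC addrA subrK.
move=> s sT.
rewrite (_ : ppath y s - ppath w s = (ppath z s - ppath w s) - (ppath z s - ppath y s)).
  by apply: le_trans (enormB _ _) _; rewrite lerD ?h3 ?a3.
by rewrite opprB [RHS]addrC addrA subrK.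
Qed.

End PathTopology.

(** * Derivatives of the extended functionals *)

Section DirectionalDerivatives.
Variables (R : realType) (T : R) (m n : nat).
Hypothesis T_gt0 : 0 < T.
Local Notation P := ('rV[R]_m * (R -> 'rV[R]_n))%type.
Implicit Types (U : P -> R) (q v : P) (c : R -> R) (vs : seq P).

Lemma smooth_dir_derives U c N vs : smooth T 3 U c -> (size vs <= 2)%N ->
  (forall v, v \in vs -> tame_dir T N v) ->
  smooth T (3 - size vs) (dir_derives vs U) (fun M => c M * N ^+ size vs).
Proof.
move=> sU; case: vs => [|v1 [|v2 [|//]]] _ Hvs /=.
- by rewrite subn0; under eq_fun do rewrite expr0 mulr1.
- under eq_fun do rewrite expr1; apply: smooth_dir_derive sU => //.
  by apply: Hvs; exact: mem_head.
have sY : smooth T 2 (dir_derive v2 U) (fun M => c M * N).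
  by apply: smooth_dir_derive sU => //; apply: Hvs; rewrite !inE eqxx orbT.
under eq_fun do rewrite expr2 mulrA; apply: smooth_dir_derive sY => //.
by apply: Hvs; exact: mem_head.
Qed.

Lemma dir_derives_le U c N vs M q : smooth T 3 U c -> (size vs <= 2)%N ->
  (forall v, v \in vs -> tame_dir T N v) -> tame T M q.2 ->
  `|dir_derives vs U q| <= c M * N ^+ size vs.
Proof.
move=> sU vs2 Hvs tq; have [_ H] := smooth_dir_derives sU vs2 Hvs.
by have := H M q [::] tq (leq0n _); rewrite big_nil mulr1; apply.
Qed.

Lemma dir_derives_cvg U c N v vs q : smooth T 3 U c -> (size (v :: vs) <= 2)%N ->
  (forall w, w \in v :: vs -> tame_dir T N w) -> tame_pt T q ->
  (fun h => h^-1 * (dir_derives vs U (q + h *: v) - dir_derives vs U q)) @ 0^' -->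
  dir_derives (v :: vs) U q.
Proof.
move=> sU vs2 Hvs [M tq].
have sY := smooth_dir_derives sU (ltnW vs2 : (size vs <= 2)%N) (fun w wv => Hvs w (mem_behead (s := v :: vs) wv)).
have [j E] : exists j, (3 - size vs)%N = j.+2.
  by exists (1 - size vs)%N; move: vs2 => /=; case: (size vs) => [|[|]].
rewrite E in sY; have [] := dir_derive_rate sY (Hvs v (mem_head _ _)) tq.
by [].
Qed.

Lemma dir_derives_lin U U' W c c' (a N : R) vs : smooth T 3 U c -> smooth T 3 U' c' ->
  (forall q, tame_pt T q -> W q = a * U q + U' q) -> (size vs <= 2)%N ->
  (forall v, v \in vs -> tame_dir T N v) -> forall q, tame_pt T q ->
  dir_derives vs W q = a * dir_derives vs U q + dir_derives vs U' q.
Proof.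
move=> sU sU' HW; elim: vs => [|v vs IH] vs2 Hvs q tq; first exact: HW.
have {}IH := IH (ltnW vs2) (fun w wv => Hvs w (mem_behead (s := v :: vs) wv)).
have tv := Hvs v (mem_head _ _).
have cv1 := dir_derives_cvg sU vs2 Hvs tq.
have cv2 := dir_derives_cvg sU' vs2 Hvs tq.
rewrite [LHS]/= {1}/dir_derive; apply: cvg_lim => //.
rewrite (_ : (fun h => _) = (fun h => a * (h^-1 * (dir_derives vs U (q + h *: v) - dir_derives vs U q)) +
   h^-1 * (dir_derives vs U' (q + h *: v) - dir_derives vs U' q))).
  by apply: cvgD => //; apply: cvgMr.
apply/funext => h; rewrite !IH//; first by ring.
exact: (tame_ptD h tv tq).
Qed.

End DirectionalDerivatives.

Section IteratedDerivatives.
Variables (R : realType) (T : R) (d e : nat).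
Implicit Types (u v : ppoint R d e -> R) (w : ppoint R d e).

Lemma iter_derivB (sts : seq (step R d e)) u v w :
  iter_deriv_exists T sts u w -> iter_deriv_exists T sts v w ->
  iter_deriv T sts (u \- v) w = iter_deriv T sts u w - iter_deriv T sts v w.
Proof.
elim: sts w => [//|st sts IH] w /= [nu [eu du]] [nv [ev dv]].
have E h : iter_deriv_exists T sts u (shift_pt st h w) ->
    iter_deriv_exists T sts v (shift_pt st h w) ->
    diff_quotient st (iter_deriv T sts (u \- v)) w h =
    diff_quotient st (iter_deriv T sts u) w h - diff_quotient st (iter_deriv T sts v) w h.
  by move=> h1 h2; rewrite /diff_quotient !IH//; ring.
have lim_sub (F : set_system R) (FF : ProperFilter F) :
   cvg (diff_quotient st (iter_deriv T sts u) w @ F) ->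
   cvg (diff_quotient st (iter_deriv T sts v) w @ F) ->
   (\forall h \near F, iter_deriv_exists T sts u (shift_pt st h w) /\
      iter_deriv_exists T sts v (shift_pt st h w)) ->
   lim (diff_quotient st (iter_deriv T sts (u \- v)) w @ F) =
   lim (diff_quotient st (iter_deriv T sts u) w @ F) - lim (diff_quotient st (iter_deriv T sts v) w @ F).
  move=> cu cv Hn; apply: cvg_lim => //.
  have cs : (fun h => diff_quotient st (iter_deriv T sts u) w h -
     diff_quotient st (iter_deriv T sts v) w h) @ F -->
     lim (diff_quotient st (iter_deriv T sts u) w @ F) - lim (diff_quotient st (iter_deriv T sts v) w @ F).
    exact: cvgB.
  apply: (cvg_trans _ cs); apply: near_eq_cvg.
  by apply: filterS Hn => h [h1 h2]; rewrite E.
rewrite /deriv1; rewrite /deriv1_exists in du dv.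
move: nu nv du dv; case: (is_time st) => nu nv du dv; last first.
  apply: lim_sub; [exact: du|exact: dv|].
  by near=> h; split; near: h.
have [wT|_] := ltP (ptime w) T; last by rewrite subrr.
apply: lim_sub; [exact: du|exact: dv|].
have tn : \forall h \near (0 : R)^'+, ptime w + h <= T.
  have tw0 : 0 < T - ptime w by rewrite subr_gt0.
  by have := nbhs_right_le tw0; apply: filterS => h; rewrite lerBrDl.
near=> h.
have h3 : ptime w + h <= T by near: h.
have h1 : ptime w + h <= T -> iter_deriv_exists T sts u (shift_pt st h w) by near: h.
have h2 : ptime w + h <= T -> iter_deriv_exists T sts v (shift_pt st h w) by near: h.
by split; [exact: h1|exact: h2].
Unshelve. all: by end_near. Qed.

Lemma frozen_scale (c t : R) (eta : path_type R e) s :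
  frozen_direction t (c *: eta) s = c *: frozen_direction t eta s.
Proof. by apply/rowP => j; rewrite !mxE; case: ifP; rewrite ?mulr0. Qed.

Lemma dnbhs0_mul (c : R) : c != 0 -> (fun h => c * h) @ 0^' --> (0 : R)^'.
Proof.
move=> c0 A [r /= r0 HA]; exists (r / `|c|); first by rewrite /= divr_gt0 ?normr_gt0.
move=> h; rewrite /= sub0r normrN ltr_pdivlMr ?normr_gt0// => hr h0.
apply: HA; last by rewrite mulf_neq0.
by rewrite /= sub0r normrN normrM mulrC.
Qed.

(** Substituting c h for h in the difference quotient gives one factor c for each pathwise
    derivative; linearity in the direction is not involved. This transfers bounds over unit
    directions to arbitrary ones. *)
Lemma iter_deriv_scale (c : R) (sts : seq (step R d e)) (etas : seq (path_type R e)) u w : c != 0 ->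
  (forall st, List.In st sts -> ~~ is_time st) ->
  iter_deriv_exists T (sts ++ map (@Step_path R d e) etas) u w ->
  iter_deriv T (sts ++ map (@Step_path R d e) (map ( *:%R c) etas)) u w =
  c ^+ size etas * iter_deriv T (sts ++ map (@Step_path R d e) etas) u w.
Proof.
move=> c0; elim: sts w => [|st sts IH] w Hst /=.
  elim: etas w => [|eta etas IH] w; first by rewrite expr0 mul1r.
  move=> /= [nu [eu du]]; rewrite /deriv1/=; rewrite /deriv1_exists/= in du.
  set F := iter_deriv T (map _ etas) u in IH du *.
  have sh h : shift_pt (Step_path d (c *: eta)) h w = shift_pt (Step_path d eta) (c * h) w.
    congr PPoint; apply/funext => s; rewrite frozen_scale scalerA mulrC//.
  have cv : (fun h => c ^+ size etas * c * diff_quotient (Step_path d eta) F w (c * h)) @ 0^' -->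
      c ^+ size etas * c * lim (diff_quotient (Step_path d eta) F w @ 0^').
    by apply: cvgMr; apply: (cvg_comp _ _ (dnbhs0_mul c0)); exact: du.
  rewrite exprSr; apply: cvg_lim => //; apply: (cvg_trans _ cv); apply: near_eq_cvg.
  have nu' := dnbhs0_mul c0 nu; near=> h.
  have h0 : h != 0 by near: h; exact: nbhs_dnbhs_neq.
  rewrite /diff_quotient sh !IH//; last by near: h; exact: nu'.
  by rewrite invfM; field; rewrite h0 c0.
move=> [nu [eu du]].
have nst : is_time st = false by apply/negbTE/Hst; left.
have Hst' st' : List.In st' sts -> ~~ is_time st' by move=> h; apply: Hst; right.
rewrite /deriv1 nst; rewrite /deriv1_exists nst in du; rewrite nst in nu.
set F := iter_deriv T (sts ++ map _ etas) u in IH du *.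
have cv : (fun h => c ^+ size etas * diff_quotient st F w h) @ 0^' -->
    c ^+ size etas * lim (diff_quotient st F w @ 0^').
  by apply: cvgMr; exact: du.
apply: cvg_lim => //; apply: (cvg_trans _ cv); apply: near_eq_cvg; near=> h.
rewrite /diff_quotient !IH//; last by near: h.
by rewrite -mulrBr mulrCA.
Unshelve. all: by end_near. Qed.

End IteratedDerivatives.

Section StepDirection.
Variables (R : realType) (T : R) (d e : nat).
Hypothesis T_gt0 : 0 < T.
Local Notation P := ('rV[R]_(1 + d) * (R -> 'rV[R]_e.+1))%type.

Definition pt_of (w : ppoint R d e) : P :=
  (row_mx (const_mx (ptime w)) (pspace w), ppath w).

Definition dir_of (t : R) (st : step R d e) : P :=
  match st with
  | Step_t => (row_mx (const_mx 1) 0, 0)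
  | Step_x i => (row_mx 0 (delta_mx 0 i), 0)
  | Step_path eta => (0, frozen_direction t eta)
  end.

Lemma pt_of_shift st h w :
  pt_of (shift_pt st h w) = pt_of w + h *: dir_of (ptime w) st.
Proof.
case: st => [|i|eta]; rewrite /pt_of /shift_pt /=; congr pair => /=.
- rewrite scale_row_mx add_row_mx scaler0 addr0; congr row_mx.
  by apply/rowP => j; rewrite !mxE mulr1.
- by rewrite scaler0 addr0.
- by rewrite scale_row_mx add_row_mx scaler0 addr0.
- by rewrite scaler0 addr0.
by rewrite scaler0 addr0.
Qed.

Definition good_step (N : R) (st : step R d e) : Prop :=
  if st is Step_path eta then
    tame T N eta /\ forall s, 0 <= s <= T -> enorm (eta s) <= N
  else True.

Lemma tame0 : tame T 0 (0 : R -> 'rV[R]_e.+1).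
Proof.
split.
  exists (fun=> 0); split; last by rewrite subrr.
  by move=> s t _ _ _; rewrite !subrr enorm0.
by move=> eps e0; exists 1 => // s t _ _ _; rewrite subrr enorm0 ltW.
Qed.

Lemma enorm_row_mx (n1 n2 : nat) (u : 'rV[R]_n1) (v : 'rV[R]_n2) :
  enorm (row_mx u v) = Num.sqrt (\sum_i u 0 i ^+ 2 + \sum_i v 0 i ^+ 2).
Proof.
rewrite /enorm; congr Num.sqrt; rewrite big_split_ord /=.
by congr (_ + _); apply: eq_bigr => i _; rewrite ?row_mxEl ?row_mxEr.
Qed.

Lemma tame_dir_of (t N : R) st : 1 <= N -> 0 <= t <= T -> good_step N st ->
  tame_dir T N (dir_of t st).
Proof.
move=> N1 tT; have N0 : 0 < N by apply: lt_le_trans N1.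
have Ni : `|N^-1| = N^-1 by rewrite gtr0_norm// invr_gt0.
have Ni1 : N^-1 <= 1 by rewrite invf_le1.
have zero m' : N^-1 *: (0 : 'rV[R]_m') = 0 by rewrite scaler0.
have z2 : tame T 1 (N^-1 *: (0 : R -> 'rV[R]_e.+1)).
  by rewrite scaler0; apply: tame_mono tame0.
have sumz m' : \sum_(i < m') (0 : 'rV[R]_m') 0 i ^+ 2 = 0.
  by rewrite big1// => i _; rewrite mxE expr0n.
case: st => [_|i _|eta [te be]]; split=> //; split=> //=.
- rewrite enormZ Ni enorm_row_mx sumz addr0 big_ord1 mxE expr1n sqrtr1 mulr1//.
- by rewrite scaler0 enorm0.
- rewrite enormZ Ni enorm_row_mx sumz add0r (bigD1 i)//= mxE !eqxx expr1n big1 ?addr0 ?sqrtr1 ?mulr1//.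
  by move=> j /negPf ji; rewrite mxE ji andbF expr0n.
- by rewrite scaler0 enorm0.
- by rewrite scaler0 enorm0.
- rewrite fctE enormZ Ni ler_pdivrMl// mulr1.
  by apply: (frozen_enorm_le tT _ be); rewrite lexx ltW.
have := tameZ N^-1 (frozen_tame tT te); rewrite Ni mulVf//; exact: lt0r_neq0.
Qed.

End StepDirection.

Section Extension.
Variables (R : realType) (T p : R) (d e : nat).
Hypotheses (T_gt0 : 0 < T) (p_gt1 : 1 < p).
Local Notation V1 := 'rV[R]_(1 + d).
Local Notation V2 := 'rV[R]_e.+1.
Variables (X : set (ospace T p d e)) (r : R).
Hypotheses (X_Omega : X `<=` @Omega R T d e) (X_bounded : forall w : ppoint R d e, X w ->
   (pvar_norm 1 0 T (ppath w) <= r%:E)%E).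
Variables (k : V1 -> V1 -> R) (Hk : rkhs k) (l : V2 -> V2 -> R) (Hl : rkhs l).
Variables (g : V2 -> V2 -> R) (Hg : rkhs g) (TV : rkhs (tensor_kernel g)).
Variables (Ck Cl Cg : R).
Hypotheses (Cg0 : 0 <= Cg) (k_smooth : diff_bounded k 3 k Ck).
Hypotheses (l_smooth : diff_bounded l 3 l Cl) (g_smooth : diff_bounded g 4 g Cg).
Variable H : rkhs (restricted_kernel (X := X) (kappa T k l TV)).
Local Notation B := {w : ppoint R d e | X w}.
Implicit Types (h f : B -> R) (w : ppoint R d e) (sts : seq (step R d e)).

Let pt (z : B) : V1 := (pt_of (sval z)).1.
Let ga (z : B) := ppath (sval z).

Lemma X_tame w : X w -> tame T r (ppath w) /\ forall s, 0 <= s <= T -> enorm (ppath w s) <= r.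
Proof.
move=> Xw; have [[_ [_ cg _ _]] _] := X_Omega Xw.
exact: pvar_norm1_tame (X_bounded Xw).
Qed.

Let X_tame2 w : X w -> tame T r (pt_of w).2.
Proof. by move=> /X_tame[]. Qed.

Lemma X_time w : X w -> 0 <= ptime w <= T.
Proof. by move=> Xw; have [[]] := X_Omega Xw. Qed.

Let KBE : restricted_kernel (X := X) (kappa T k l TV) = path_kernel T k l TV pt ga.
Proof.
apply/funext => z; apply/funext => z'.
have [tz _] := X_tame (svalP z); have [tz' _] := X_tame (svalP z').
by rewrite /restricted_kernel /path_kernel (tame_sigE g tz) (tame_sigE g tz').
Qed.

Definition ext_functional h := functional T k l TV pt ga H h.
Local Notation U := ext_functional.

Lemma ext_functional_smooth h : carrier H h ->
  smooth T 3 (U h) (fun M => mdiff_cst Ck Cl Cg M * hnorm H h).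
Proof.
move=> Ch; split=> [M|M q L tq L3 HL].
  by apply: mulr_ge0; [exact: (mdiff_cst_ge0 _ k_smooth l_smooth)|exact: hnorm_ge0].
exact: (functional_mdiff T_gt0 Hk Hl Hg Cg0 k_smooth l_smooth g_smooth KBE Ch tq L3 HL).
Qed.

Lemma ext_functional_lip h M q q' (o : R) : carrier H h -> tame T M q.2 -> tame T M q'.2 ->
  near_pt T o q q' -> `|U h q' - U h q| <= feature_lip_cst Ck Cl Cg M * hnorm H h * o.
Proof.
move=> Ch tq tq' [n1 n2].
exact: (functional_lip T_gt0 Hk Hl Hg Cg0 k_smooth l_smooth g_smooth KBE Ch tq tq' n1 n2).
Qed.

Lemma ext_functional_lin (c : R) f h q : carrier H f -> carrier H h ->
  U (fun z => c * f z + h z) q = c * U f q + U h q.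
Proof.
move=> Cf Ch; apply: dotP => //.
exact: (carrier_path_feature T_gt0 Hk Hl Hg Cg0 k_smooth l_smooth g_smooth KBE).
Qed.

Lemma extensionE h w : tame_pt T (pt_of w) -> extension H h w = U h (pt_of w).
Proof.
move=> [M tw]; rewrite /extension /ext_functional /functional; congr dot; apply/funext => z.
have [tz _] := X_tame (svalP z).
by rewrite /path_feature (tame_sigE g tw) (tame_sigE g tz).
Qed.

(** The index set has the time derivative only on its own. In all other lists the time of the point
    never moves, so the directions stay frozen at one time. *)
Definition admissible N sts : Prop :=
  [/\ forall st, List.In st sts -> good_step T N st, (size sts <= 2)%N &
      sts = [:: @Step_t R d e] \/ forall st, List.In st sts -> ~~ is_time st].

Lemma ptime_shift st (h : R) w : ~~ is_time st -> ptime (shift_pt st h w) = ptime w.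
Proof. by case: st. Qed.

Lemma tame_dirs N sts (t : R) : 1 <= N -> 0 <= t <= T ->
  (forall st, List.In st sts -> good_step T N st) ->
  forall v, v \in map (dir_of t) sts -> tame_dir T N v.
Proof.
move=> N1 tT; elim: sts => [//|st sts IH] Hst v /=; rewrite inE => /orP[/eqP->|].
  by apply: tame_dir_of => //; apply: Hst; left.
by apply: IH => st' h; apply: Hst; right.
Qed.

(** Steps other than time keep the time of the point, so the same frozen directions occur along a
    whole difference quotient, and the derivatives become directional ones along fixed vectors. For
    the time step, the two-sided limit exists because the functional lives on a vector space, and it
    gives the right derivative; at t = T the conventional value 0 remains. *)
Lemma iter_deriv_extension N sts h w : 1 <= N -> admissible N sts -> carrier H h ->
  0 <= ptime w <= T -> tame_pt T (pt_of w) ->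
  iter_deriv_exists T sts (extension H h) w /\
  iter_deriv T sts (extension H h) w =
    if has (@is_time R d e) sts && ~~ (ptime w < T) then 0
    else dir_derives (map (dir_of (ptime w)) sts) (U h) (pt_of w).
Proof.
move=> N1 [good s2 kind] Ch wT tw; have sU := ext_functional_smooth Ch.
case: kind => [->|]; last first.
  elim: sts good s2 w wT tw => [|st sts IH] good s2 w wT tw nt; first by split=> //=; rewrite extensionE.
  have good' st' : List.In st' sts -> good_step T N st' by move=> i; apply: good; right.
  have nt' st' : List.In st' sts -> ~~ is_time st' by move=> i; apply: nt; right.
  have nst : is_time st = false by apply/negbTE/nt; left.
  have hf : has (@is_time R d e) sts = false.
    elim: (sts) nt' => //= st' sts' E nt'.
    by rewrite (negbTE (nt' st' (or_introl erefl))) E// => x i; apply: nt'; right.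
  have tds := tame_dirs N1 wT good.
  have sh (s : R) : tame_pt T (pt_of (shift_pt st s w)).
    rewrite pt_of_shift; apply: tame_ptD tw; apply: tds; exact: mem_head.
  have wTs (s : R) : 0 <= ptime (shift_pt st s w) <= T by rewrite ptime_shift ?nst.
  have IHs (s : R) := IH good' (ltnW s2) _ (wTs s) (sh s) nt'.
  have IH0 := IH good' (ltnW s2) w wT tw nt'.
  have cv := @dir_derives_cvg R T _ _ (U h) _ N (dir_of (ptime w) st) (map (dir_of (ptime w)) sts)
    (pt_of w) sU _ tds tw.
  have {}cv := cv (_ : (size (map (dir_of (ptime w)) (st :: sts)) <= 2)%N).
  have {}cv : diff_quotient st (iter_deriv T sts (extension H h)) w @ 0^' -->
      dir_derives (map (dir_of (ptime w)) (st :: sts)) (U h) (pt_of w).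
    rewrite (_ : diff_quotient st _ w = (fun s => s^-1 * (dir_derives (map (dir_of (ptime w)) sts) (U h) (pt_of w + s *: dir_of (ptime w) st) -
       dir_derives (map (dir_of (ptime w)) sts) (U h) (pt_of w)))).
      by apply: cv; rewrite size_map.
    apply/funext => s; rewrite /diff_quotient (IHs s).2 IH0.2 hf/=.
    by rewrite ptime_shift ?nst// pt_of_shift.
  rewrite /= nst hf /=; split.
    split; first by apply: nearW => s; exact: (IHs s).1.
    split; first exact: IH0.1.
    by rewrite /deriv1_exists nst; apply/cvg_ex; eexists; exact: cv.
  by rewrite /deriv1 nst; exact: (cvg_lim _ cv).
have good' : forall st, List.In st [:: @Step_t R d e] -> good_step T N st.
  by move=> st [<-|].
have tds := tame_dirs N1 wT good'.
have cv := @dir_derives_cvg R T _ _ (U h) _ N (dir_of (ptime w) (@Step_t R d e)) [::]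
    (pt_of w) sU isT tds tw.
have {}cv : diff_quotient (@Step_t R d e) (extension H h) w @ 0^' -->
      dir_derives (map (dir_of (ptime w)) [:: @Step_t R d e]) (U h) (pt_of w).
  rewrite (_ : diff_quotient _ _ w = (fun s => s^-1 * (U h (pt_of w + s *: dir_of (ptime w) (@Step_t R d e)) - U h (pt_of w)))) //.
  apply/funext => s; rewrite /diff_quotient !extensionE ?pt_of_shift//.
  by apply: tame_ptD tw; apply: tds; exact: mem_head.
have {}cv := cvg_dnbhs_at_right cv.
rewrite /= /deriv1_exists /deriv1 /=; split.
  by split; [exact: nearW|split=> // _; apply/cvg_ex; eexists; exact: cv].
by case: ifP => //= _; exact: (cvg_lim _ cv).
Qed.

Local Notation D sts h w := (iter_deriv T sts (extension H h) w).

Lemma X_tame_pt w : X w -> tame_pt T (pt_of w).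
Proof. by move=> /X_tame[tw _]; exists r. Qed.

Lemma ext_deriv_lin N sts (c : R) f h w : 1 <= N -> admissible N sts -> X w ->
  carrier H f -> carrier H h ->
  D sts (fun z => c * f z + h z) w = c * D sts f w + D sts h w.
Proof.
move=> N1 adm Xw Cf Ch; have tw := X_tame_pt Xw; have wT := X_time Xw.
have Cc := carrierP c Cf Ch.
rewrite (iter_deriv_extension N1 adm Cf wT tw).2 (iter_deriv_extension N1 adm Ch wT tw).2.
rewrite (iter_deriv_extension N1 adm Cc wT tw).2; case: ifP => _; first by rewrite mulr0 addr0.
have [good s2 _] := adm.
apply: (dir_derives_lin (ext_functional_smooth Cf) (ext_functional_smooth Ch) _ _ (tame_dirs N1 wT good) tw).
  by move=> q _; exact: ext_functional_lin.
by rewrite size_map.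
Qed.

Lemma ext_deriv_le N sts h w : 1 <= N -> admissible N sts -> X w -> carrier H h ->
  `|D sts h w| <= mdiff_cst Ck Cl Cg r * N ^+ 2 * hnorm H h.
Proof.
move=> N1 adm Xw Ch; have tw := X_tame_pt Xw; have wT := X_time Xw.
have [good s2 _] := adm.
have m0 : 0 <= mdiff_cst Ck Cl Cg r by exact: (mdiff_cst_ge0 _ k_smooth l_smooth).
have N0 : 0 <= N by apply: le_trans N1.
rewrite (iter_deriv_extension N1 adm Ch wT tw).2; case: ifP => _.
  rewrite normr0; apply: mulr_ge0; last exact: hnorm_ge0.
  by apply: mulr_ge0 => //; exact: exprn_ge0.
have sz : (size (map (dir_of (ptime w)) sts) <= 2)%N by rewrite size_map.
have := dir_derives_le (ext_functional_smooth Ch) sz (tame_dirs N1 wT good) (X_tame2 Xw).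
move=> /le_trans; apply; rewrite mulrAC ler_wpM2r ?hnorm_ge0// ler_wpM2l//.
exact: ler_weXn2l.
Qed.

Lemma dirs_near N sts (t o : R) : 0 < o -> 0 <= t <= T ->
  (forall st, List.In st sts -> good_step T N st) ->
  exists2 delta, 0 < delta & forall t', 0 <= t' <= T -> `|t' - t| < delta ->
    forall vv, vv \in zip (map (dir_of t) sts) (map (dir_of t') sts) -> near_pt T o vv.1 vv.2.
Proof.
move=> o0 tT; elim: sts => [|st sts IH] good; first by exists 1.
have [|d1 d10 H1] := IH; first by move=> st' i; apply: good; right.
have same (v : V1 * (R -> V2)) : near_pt T o v v.
  by split=> [s _|]; rewrite subrr enorm0 ltW.
have [d2 d20 H2] : exists2 delta, 0 < delta & forall t', 0 <= t' <= T -> `|t' - t| < delta ->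
    near_pt T o (dir_of t st) (dir_of t' st).
  have := good st (or_introl erefl); case: (st) => [_|i _|eta [te _]]; [by exists 1|by exists 1|].
  have [d2 d20 H2] := frozen_near o0 tT te.2.
  exists d2 => // t' t'T tt'; split=> [s sT|]; first exact: H2.
  by rewrite subrr enorm0 ltW.
exists (Num.min d1 d2); first by rewrite lt_min d10.
move=> t' t'T; rewrite lt_min => /andP[h1 h2] vv /=; rewrite inE => /orP[/eqP->|].
  exact: H2.
exact: H1.
Qed.

(** The radius does not depend on h. This uniformity is needed because the estimate is later applied
    to the errors of the minimisers, which vary with the collocation points. *)
Lemma ext_deriv_cont N sts w (eps : R) : 1 <= N -> admissible N sts -> 0 < eps -> X w ->
  (has (@is_time R d e) sts -> ptime w < T) ->
  exists2 rho, 0 < rho & forall w', X w' -> (has (@is_time R d e) sts -> ptime w' < T) ->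
    sup_ball T rho w w' -> forall h, carrier H h ->
    `|D sts h w' - D sts h w| <= eps * hnorm H h.
Proof.
move=> N1 adm e0 Xw tmw; have tw := X_tame_pt Xw; have wT := X_time Xw.
have [good s2 _] := adm.
have N0 : 0 < N by apply: lt_le_trans N1.
pose m0 := mdiff_cst Ck Cl Cg r.
have m00 : 0 <= m0 by exact: (mdiff_cst_ge0 _ k_smooth l_smooth).
pose fl := `|feature_lip_cst Ck Cl Cg (r + N *+ 2)|.
have fl0 : 0 <= fl by exact: normr_ge0.
have c10 : 0 < 8 * N ^+ 3 * m0 + 1.
  by apply: ltr_wpDl => //; apply: mulr_ge0 => //; apply: mulr_ge0 => //; exact/exprn_ge0/ltW.
(* The step s makes the error of the difference quotients at most eps / 2; then o makes their change
   between the two points at most eps / 2. *)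
pose s := Num.min N^-1 (eps / 2 / (8 * N ^+ 3 * m0 + 1)).
have s0 : 0 < s by rewrite lt_min invr_gt0 N0 !divr_gt0.
have sN : s <= N^-1 by rewrite ge_min lexx.
have b1 : 8 * N ^+ 3 * m0 * s <= eps / 2.
  apply: (@le_trans _ _ ((8 * N ^+ 3 * m0 + 1) * s)); first by rewrite ler_wpM2r ?lerDl// ltW.
  by rewrite mulrC -ler_pdivlMr// ge_min lexx orbT.
pose j := size sts.
pose c3 := s ^- j * (4 * (fl * (1 + 2 * s))) + 1.
have c3' : 0 <= s ^- j * (4 * (fl * (1 + 2 * s))).
  apply: mulr_ge0; first by rewrite invr_ge0; exact/exprn_ge0/ltW.
  by apply: mulr_ge0 => //; apply: mulr_ge0 => //; apply: addr_ge0 => //; apply: mulr_ge0 => //; exact: ltW.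
have c30 : 0 < c3 by rewrite ltr_wpDl.
pose o := eps / 2 / c3.
have o0 : 0 < o by rewrite !divr_gt0.
have b2 : s ^- j * (4 * (fl * (1 + 2 * s))) * o <= eps / 2.
  apply: (@le_trans _ _ (c3 * o)); first by rewrite ler_wpM2r ?lerDl// ltW.
  by rewrite /o mulrC divfK// lt0r_neq0.
have [delta d0 Hd] := dirs_near o0 wT good.
(* Time and space form one vector, and each may move by o / 2. *)
exists (Num.min (o / 2) delta); first by rewrite lt_min d0 divr_gt0.
move=> w' Xw' tmw' [r0]; rewrite lt_min => /andP[ro rd] [h1 h2 h3] h Ch.
have tw' := X_tame_pt Xw'; have wT' := X_time Xw'.
have nearq : near_pt T o (pt_of w) (pt_of w').
  split=> [u uT|] /=; first by apply: le_trans (h3 u uT) _; lra.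
  rewrite opp_row_mx add_row_mx.
  rewrite (_ : row_mx _ _ = row_mx (const_mx (ptime w') - const_mx (ptime w)) 0 + row_mx 0 (pspace w' - pspace w)).
    apply: le_trans (enormD _ _) _.
    have E1 : enorm (row_mx (const_mx (ptime w') - const_mx (ptime w) : 'rV[R]_1) (0 : 'rV[R]_d)) = `|ptime w' - ptime w|.
      rewrite enorm_row_mx [X in _ + X]big1 ?addr0; last by move=> i _; rewrite mxE expr0n.
      by rewrite big_ord1 !mxE sqrtr_sqr.
    have E2 : enorm (row_mx (0 : 'rV[R]_1) (pspace w' - pspace w)) = enorm (pspace w' - pspace w).
      rewrite enorm_row_mx [X in X + _]big1 ?add0r//.
      by move=> i _; rewrite mxE expr0n.
    by rewrite E1 E2; lra.
  by rewrite add_row_mx addr0 add0r.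
rewrite (iter_deriv_extension N1 adm Ch wT tw).2 (iter_deriv_extension N1 adm Ch wT' tw').2.
have nT v : (has (@is_time R d e) sts -> ptime v < T) ->
    has (@is_time R d e) sts && ~~ (ptime v < T) = false.
  by case: has => //= /(_ isT) ->.
rewrite !nT//.
have t'close : `|ptime w' - ptime w| < delta by apply: le_lt_trans rd.
have lipU q q' o' : tame T (r + N *+ 2) q.2 -> tame T (r + N *+ 2) q'.2 -> near_pt T o' q q' ->
    `|ext_functional h q' - ext_functional h q| <= fl * hnorm H h * o'.
  move=> tq tq' nq; have o'0 : 0 <= o' by apply: le_trans nq.2; exact: enorm_ge0.
  apply: le_trans (ext_functional_lip Ch tq tq' nq) _.
  by rewrite ler_wpM2r// ler_wpM2r ?hnorm_ge0// ler_norm.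
have c20 : 0 <= fl * hnorm H h by rewrite mulr_ge0 ?hnorm_ge0.
have sz1 : size (map (dir_of (ptime w)) sts) = size (map (dir_of (ptime w')) sts).
  by rewrite !size_map.
have sz2 : (size (map (dir_of (ptime w)) sts) <= 2)%N by rewrite size_map.
have Hz vv : vv \in zip (map (dir_of (ptime w)) sts) (map (dir_of (ptime w')) sts) ->
    [/\ tame_dir T N vv.1, tame_dir T N vv.2 & near_pt T o vv.1 vv.2].
  move=> vz; split; last exact: Hd wT' t'close _ vz.
  - apply: (tame_dirs N1 wT good).
    have := map_f fst vz; rewrite -/(unzip1 _) unzip1_zip// sz1//.
  - apply: (tame_dirs N1 wT' good).
    have := map_f snd vz; rewrite -/(unzip2 _) unzip2_zip// sz1//.
have := dir_derives_near (ext_functional_smooth Ch) N1 (lexx (r + N *+ 2)) c20 lipU (X_tame2 Xw)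
  (X_tame2 Xw') nearq sz1 sz2 s0 sN (ltW o0) Hz.
move=> /le_trans; apply; rewrite size_map -/j -/m0.
have h0 := hnorm_ge0 H h.
have -> : 8 * N ^+ 3 * (m0 * hnorm H h) * s + s ^- j * (4 * (fl * hnorm H h * (o + 2 * s * o))) =
   (8 * N ^+ 3 * m0 * s + s ^- j * (4 * (fl * (1 + 2 * s))) * o) * hnorm H h by ring.
by rewrite ler_wpM2r//; lra.
Qed.

Lemma admissible_steps N (n : midx) (I : (ord_x n).-tuple 'I_d) (etas : (ord_g n).-tuple (path_type R e)) :
  in_N n -> (forall i, good_step T N (@Step_path R d e (tnth etas i))) ->
  admissible N (steps I etas) /\ has (@is_time R d e) (steps I etas) = (ord_t n != 0)%N.
Proof.
move=> nN Hg'.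
have ge st : List.In st (map (@Step_path R d e) etas) -> good_step T N st /\ ~~ is_time st.
  suff ge' (s : seq (path_type R e)) : (forall eta, eta \in s -> good_step T N (@Step_path R d e eta)) ->
      List.In st (map (@Step_path R d e) s) -> good_step T N st /\ ~~ is_time st.
    by apply: ge' => eta /tnthP[i ->]; exact: Hg'.
  elim: s => [//|eta s IH] Hs /= [<-|]; first by split=> //; apply: Hs; exact: mem_head.
  by apply: IH => eta' i; apply: Hs; rewrite inE i orbT.
have gx st : List.In st (map (@Step_x R d e) I) -> good_step T N st /\ ~~ is_time st.
  by elim: (tval I) => [//|x s IH] /= [<-|].
have inor st (s1 s2 : seq (step R d e)) : List.In st (s1 ++ s2) -> List.In st s1 \/ List.In st s2.
  by elim: s1 => [|x s1 IH] /=; [right|case=> [|/IH[]]; tauto].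
have ht (s1 s2 : seq (step R d e)) : has (@is_time R d e) (s1 ++ s2) = has (@is_time R d e) s1 || has (@is_time R d e) s2.
  exact: has_cat.
have hn (s : seq (step R d e)) : (forall st, List.In st s -> ~~ is_time st) -> has (@is_time R d e) s = false.
  elim: s => //= st s IH Hs; rewrite (negbTE (Hs st (or_introl erefl))) IH// => st' i.
  by apply: Hs; right.
have hasE : has (@is_time R d e) (steps I etas) = (ord_t n != 0)%N.
  rewrite /steps !ht [X in _ || (X || _)]hn; last by move=> st /gx[].
  rewrite [X in _ || (_ || X)]hn; last by move=> st /ge[].
  by case: (ord_t n) => [|m] /=; rewrite ?orbF.
split=> //; split.
- rewrite /steps => st /inor[|/inor[]]; last 2 first.
  - by move=> /gx[].
  - by move=> /ge[].
  by elim: (ord_t n) => [//|m IH] /= [<-|].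
- rewrite /steps !size_cat size_nseq !size_map !size_tuple.
  by move: nN; rewrite /in_N => /orP[/and3P[h1 /eqP-> /eqP->]|/andP[/eqP-> h]]; rewrite ?addn0 ?add0n// (leq_trans h1).
move: nN; rewrite /in_N => /orP[/and3P[h1 /eqP x0 /eqP g0]|/andP[/eqP t0 h]].
  move: (h1); rewrite leq_eqVlt => /orP[/eqP t1|]; last rewrite ltnS leqn0 => /eqP t0.
    left; rewrite /steps t1.
    have -> : tval I = [::] by apply: size0nil; rewrite size_tuple.
    have -> : tval etas = [::] by apply: size0nil; rewrite size_tuple.
    by [].
  by right => st; rewrite /steps t0/= => /inor[/gx[]|/ge[]].
by right => st; rewrite /steps t0/= => /inor[/gx[]|/ge[]].
Qed.

End Extension.

(** * Optimal recovery *)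

(** Let D be the subspace of all f with <v_i, f> = o(|v_i|); it contains the representers of the
    functionals in L. The projection g of h onto the closure of D has the same values as h under L,
    so uniqueness gives g = h, and h is a limit of elements f of D. Then |v_i|^2 = <v_i, f> + <v_i,
    h - f> is at most eps |v_i|. Measuring smallness relative to |v_i| dispenses with an a priori
    bound. *)
Lemma hilbert_weak_strong (R : realType) (A I : Type) (K : A -> A -> R) (H : rkhs K)
    (F : set_system I) (FF : Filter F) (v : I -> A -> R) (h : A -> R)
    (L : set ((A -> R) -> R)) :
  carrier H h -> (\forall i \near F, carrier H (v i) /\ dot H (v i) (v i) = dot H (v i) h) ->
  (forall L0, L L0 ->
     [/\ forall c f f', carrier H f -> carrier H f' ->
           L0 (fun x => c * f x + f' x) = c * L0 f + L0 f',
         exists2 M, 0 <= M & forall f, carrier H f -> `|L0 f| <= M * hnorm H f &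
         forall eps, 0 < eps -> \forall i \near F, `|L0 (v i)| <= eps * hnorm H (v i)]) ->
  (forall f, carrier H f -> (forall L0, L L0 -> L0 f = L0 h) -> f = h) ->
  forall eps, 0 < eps -> \forall i \near F, hnorm H (v i) <= eps.
Proof.
move=> Ch vF HL uniq eps e0.
pose D f := carrier H f /\
  forall eps, 0 < eps -> \forall i \near F, `|dot H (v i) f| <= eps * hnorm H (v i).
have D_rep L0 : L L0 -> exists2 g, D g & forall f, carrier H f -> L0 f = dot H g f.
  move=> /HL[lin [M M0 bnd] small].
  have lin0 : L0 (fun=> 0) = 0.
    have /eqP := bnd _ (carrier0 H); rewrite hnorm0 mulr0 normr_le0.
    by move=> /eqP/eqP.
  have [|c f f' s t|f s|g [Cg _ gE _]] :=
    @riesz_graph _ _ _ H (fun f s => carrier H f /\ s = L0 f) M M0.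
  - by split; [exact: carrier0|rewrite lin0].
  - by move=> [Cf ->] [Cf' ->]; split; [exact: carrierP|rewrite lin].
  - by move=> [Cf ->]; split=> //; exact: bnd.
  exists g; last by move=> f Cf; rewrite (gE f (L0 f)).
  split=> // eps' e'0; near=> i.
  have [Cv _] : carrier H (v i) /\ dot H (v i) (v i) = dot H (v i) h by near: i.
  rewrite dotC// (gE (v i) (L0 (v i)))//.
  by near: i; exact: small.
have [|c f f' s t|f s|g [Cg _ gE gD]] :=
  @riesz_graph _ _ _ H (fun f s => D f /\ s = dot H h f) (hnorm H h) (hnorm_ge0 H h).
- split; last by rewrite dot0r.
  split; first exact: carrier0.
  move=> eps' e'0; near=> i.
  have [Cv _] : carrier H (v i) /\ dot H (v i) (v i) = dot H (v i) h by near: i.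
  by rewrite dot0r// normr0 mulr_ge0 ?hnorm_ge0// ltW.
- move=> [[Cf Df] ->] [[Cf' Df'] ->]; split; last first.
    by rewrite dotDr ?dotZr//; exact: carrierZ.
  split; first exact: carrierP.
  move=> eps' e'0; have c0 : 0 < 2 * (`|c| + 1) by rewrite mulr_gt0// ltr_wpDl.
  near=> i.
  have [Cv _] : carrier H (v i) /\ dot H (v i) (v i) = dot H (v i) h by near: i.
  rewrite dotDr ?dotZr//; last exact: carrierZ.
  apply: le_trans (ler_normD _ _) _; rewrite normrM.
  have h1 : `|dot H (v i) f| <= eps' / (2 * (`|c| + 1)) * hnorm H (v i).
    by near: i; apply: Df; rewrite divr_gt0.
  have h2 : `|dot H (v i) f'| <= eps' / 2 * hnorm H (v i).
    by near: i; apply: Df'; rewrite divr_gt0.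
  have h3 : `|c| * `|dot H (v i) f| <= (`|c| + 1) * (eps' / (2 * (`|c| + 1)) * hnorm H (v i)).
    by apply: ler_pM => //; rewrite lerDl.
  have h4 : (`|c| + 1) * (eps' / (2 * (`|c| + 1)) * hnorm H (v i)) = eps' / 2 * hnorm H (v i).
    by field; rewrite gt_eqF// ltr_wpDl.
  by lra.
- by move=> [[Cf _] ->]; split=> //; exact: dot_le.
(* Each L0 has a representer in D, and g and h have the same inner products with elements of D. *)
have {}uniq : g = h.
  apply: uniq => // L0 LL0; have [g0 Dg0 E] := D_rep _ LL0.
  have [Cg0 _] := Dg0.
  by rewrite !E// dotC// (gE g0 (dot H h g0))// dotC.
rewrite {}uniq in gD.
have e20 : 0 < eps / 2 by rewrite divr_gt0.
have [f [s [[[Cf Df] _] hf]]] := gD _ e20.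
near=> i.
have [Cv E] : carrier H (v i) /\ dot H (v i) (v i) = dot H (v i) h by near: i.
have h1 : `|dot H (v i) f| <= eps / 2 * hnorm H (v i) by near: i; exact: Df.
have Chf := carrierB Ch Cf.
have h2 := dot_le Cv Chf; rewrite dotBr// in h2.
have v0 := hnorm_ge0 H (v i).
have h3 : hnorm H (v i) * hnorm H (fun x => h x - f x) <= hnorm H (v i) * (eps / 2).
  by rewrite ler_wpM2l// ltW.
have h4 := hnorm_sqr Cv; rewrite E in h4.
have h5 : hnorm H (v i) ^+ 2 <= eps * hnorm H (v i).
  have := ler_norm (dot H (v i) h - dot H (v i) f); have := ler_norm (dot H (v i) f).
  by lra.
have [|v1] := leP (hnorm H (v i)) 0; first by move/le_trans; apply; exact: ltW.
by move: h5; rewrite expr2 ler_pM2r.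
Unshelve. all: by end_near.
Qed.

(** * Unit directions and the norm of the function space *)

Section UnitDirections.
Variables (R : realType) (T : R) (e : nat).
Hypothesis T_gt0 : 0 < T.
Implicit Types gam : path_type R e.

Lemma pvar1_le n (gam : R -> 'rV[R]_n) v : 0 <= v ->
  (pvar 1 0 T gam <= v%:E)%E <-> forall s, itv_partition 0 T s -> var_sum 1 gam 0 s <= v.
Proof.
move=> v0; split=> [pv s ps|Hv].
  rewrite -lee_fin; apply: le_trans pv; apply: le_trans (pvar_ge_sum gam ltr01 ps).
  by rewrite invr1 powRr1// var_sum_ge0.
rewrite pvarE invr1 poweRe1; first by apply: ge_ereal_sup => _ [s ps <-]; rewrite lee_fin Hv.
apply: (@le_trans _ _ (var_sum 1 gam 0 [:: T])%:E); first by rewrite lee_fin var_sum_ge0.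
by apply: ereal_sup_ubound; exists [:: T] => //; split; rewrite /= ?T_gt0 ?eqxx.
Qed.

Lemma pvar_norm1Z n (c N : R) (gam : R -> 'rV[R]_n) : 0 < c ->
  (pvar_norm 1 0 T gam <= N%:E)%E -> (pvar_norm 1 0 T (c *: gam) <= (c * N)%:E)%E.
Proof.
move=> c0 pN; have g0 := enorm_ge0 (gam 0).
have pN' : (pvar 1 0 T gam <= (N - enorm (gam 0))%:E)%E.
  by rewrite EFinB leeBrDl.
have v0 : 0 <= N - enorm (gam 0).
  by rewrite -lee_fin; apply: le_trans pN'; rewrite pvarE poweR_ge0.
have cc : `|c| = c by rewrite gtr0_norm.
rewrite /pvar_norm [enorm _]enormZ cc -leeBrDl// -EFinB -mulrBr.
have vc : 0 <= c * (N - enorm (gam 0)) by rewrite mulr_ge0// ltW.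
apply: (pvar1_le _ vc).2 => s ps; have -> : var_sum 1 (c *: gam) 0 s = c * var_sum 1 gam 0 s.
  elim: (s) (0 : R) => [|x s' IH] a /=; first by rewrite mulr0.
  by rewrite IH mulrDr -[(c *: gam) x - _]/(c *: gam x - c *: gam a) -scalerBr enormZ cc !powRr1// ?mulr_ge0 ?enorm_ge0// ltW.
by rewrite ler_pM2l//; exact: (pvar1_le _ v0).1.
Qed.

Lemma BV0Z c gam : 0 < c -> BV0 T gam -> BV0 T (c *: gam).
Proof.
move=> c0 bv; have [N N0 pN] := BV0_tame T_gt0 bv; case: bv => h1 h2 h3 h4; split.
- by move=> s; rewrite /GRing.scale/= [in LHS]h1.
- by move=> s; apply: continuousZr; exact: h2.
- have := pvar_norm1Z c0 pN => h; apply: le_lt_trans (ltry (c * N)).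
  by apply: le_trans h; rewrite leeDr// lee_fin enorm_ge0.
- by case: h4 => h; [left|right] => s t s0 st tT; rewrite /GRing.scale/= !mxE ltr_pM2l//; exact: h.
Qed.

Lemma unit_scale m (etas : m.-tuple (path_type R e)) : (forall i, BV0 T (tnth etas i)) ->
  exists2 N, 0 < N & exists2 etas' : m.-tuple (path_type R e),
    unit_directions T etas' & tval etas = map ( *:%R N) etas'.
Proof.
move=> bv; have /choice[N HN] i : exists N, 0 < N /\ (pvar_norm 1 0 T (tnth etas i) <= N%:E)%E.
  by have [N N0 pN] := BV0_tame T_gt0 (bv i); exists N.
(* The summand 1 keeps the common factor positive for the empty tuple. *)
pose M := 1 + \sum_i N i.
have N0 : 0 <= \sum_i N i by apply: sumr_ge0 => i _; apply: ltW; exact: (HN i).1.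
have M0 : 0 < M by apply: ltr_wpDr.
exists M => //; exists (map_tuple ( *:%R M^-1) etas); last first.
  by rewrite /= -map_comp map_id_in// => gam _ /=; rewrite scalerA divff ?scale1r// gt_eqF.
have M1 : 0 < M^-1 by rewrite invr_gt0.
move=> i; rewrite tnth_map; split; first exact: BV0Z.
apply: le_trans (pvar_norm1Z M1 (HN i).2) _.
rewrite lee_fin mulrC ler_pdivrMr// mul1r /M (bigD1 i)//= addrCA lerDl addr_ge0//.
by apply: sumr_ge0 => j _; apply: ltW; exact: (HN j).1.
Qed.
End UnitDirections.

Section NormN.
Variables (R : realType) (T p : R) (d e : nat).
Hypothesis T_gt0 : 0 < T.
Variable X : set (ospace T p d e).
Implicit Types (u v : ppoint R d e -> R) (w : ppoint R d e) (n : midx).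
Local Notation path := (path_type R e).

Definition derivs_le (delta : R) u := forall n (I : (ord_x n).-tuple 'I_d)
  (etas : (ord_g n).-tuple path) w, in_N n -> X w -> unit_directions T etas ->
  `|iter_deriv T (steps I etas) u w| <= delta.

(** Real bounds on single derivatives stand in for the extended-real [normN]; on the function space
    both measure the same distance up to [normN_cst]. *)
Definition derivs_close (delta : R) u v := forall n (I : (ord_x n).-tuple 'I_d)
  (etas : (ord_g n).-tuple path) w, in_N n -> X w -> unit_directions T etas ->
  `|iter_deriv T (steps I etas) u w - iter_deriv T (steps I etas) v w| <= delta.

Lemma derivs_closeC delta u v : derivs_close delta u v -> derivs_close delta v u.
Proof. by move=> uv n I etas w nN Xw ue; rewrite distrC uv. Qed.

Lemma derivs_close_trans d1 d2 v u z : derivs_close d1 u v -> derivs_close d2 v z ->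
  derivs_close (d1 + d2) u z.
Proof.
move=> uv vz n I etas w nN Xw ue; have h1 := uv n I etas w nN Xw ue.
have h2 := vz n I etas w nN Xw ue.
by apply: le_trans (lerD h1 h2); apply: le_trans (ler_normD _ _); rewrite addrA subrK.
Qed.

Lemma derivs_closeE delta u v : in_CN X u -> in_CN X v ->
  derivs_le delta (u \- v) <-> derivs_close delta u v.
Proof.
move=> [Cu _] [Cv _]; have E n (I : (ord_x n).-tuple 'I_d) (etas : (ord_g n).-tuple path) w :
    in_N n -> X w -> unit_directions T etas -> iter_deriv T (steps I etas) (u \- v) w =
    iter_deriv T (steps I etas) u w - iter_deriv T (steps I etas) v w.
  move=> nN Xw ue; apply: iter_derivB.
    by have [ex _] := Cu n I etas nN (fun i => (ue i).1); exact: ex.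
  by have [ex _] := Cv n I etas nN (fun i => (ue i).1); exact: ex.
by split=> uv n I etas w nN Xw ue; have := uv n I etas w nN Xw ue; rewrite E.
Qed.

Lemma sqrt_sum_le (I : finType) (x : I -> R) c : (forall i, `|x i| <= c) ->
  Num.sqrt (\sum_i x i ^+ 2) <= #|I|%:R * c.
Proof.
move=> xc; have [j _|I0] := pickP (fun _ : I => true); last first.
  by rewrite big_pred0// sqrtr0 (eq_card0 I0) mul0r.
have c0 : 0 <= c by apply: le_trans (xc j).
have h : 0 <= #|I|%:R * c by rewrite mulr_ge0.
rewrite -[leRHS]ger0_norm// -sqrtr_sqr ler_wsqrtr// exprMn.
apply: (@le_trans _ _ (\sum_(i : I) c ^+ 2)).
  by apply: ler_sum => i _; rewrite -real_normK ?num_real// lerXn2r ?nnegrE.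
rewrite sumr_const -[_ *+ _]mulr_natl ler_wpM2r ?sqr_ge0// -natrX ler_nat.
by rewrite -[leqLHS]expn1; apply: leq_pexp2l => //; apply/card_gt0P; exists j.
Qed.

Definition normN_cst : R := \sum_(n : midx | in_N n) #|{:(ord_x n).-tuple 'I_d}|%:R.

Lemma normN_le delta u : 0 <= delta -> derivs_le delta u ->
  (normN X u <= (normN_cst * delta)%:E)%E.
Proof.
move=> d0 ud; rewrite /normN /normN_cst mulr_suml -sumEFin; apply: lee_sum => n nN.
apply: ge_ereal_sup => _ [w Xw [etas ue <-]]; rewrite lee_fin.
by apply: sqrt_sum_le => I; exact: ud.
Qed.

Hypothesis X0 : exists w, X w.
Hypothesis path0 : exists gam : path, BV0 T gam /\ (pvar_norm 1 0 T gam <= 1)%E.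

(** The supremum of an empty set is -oo, so a point of X and a tuple of unit directions have to be
    exhibited. *)
Lemma normN_term_ge0 n u : (0 <= ereal_sup [set (Num.sqrt (\sum_(I : (ord_x n).-tuple 'I_d)
   iter_deriv T (steps I etas) u w ^+ 2))%:E | w in X & etas in @unit_directions _ T e (ord_g n)])%E.
Proof.
have [w Xw] := X0; have [gam gamP] := path0.
have ue : unit_directions T [tuple of nseq (ord_g n) gam].
  by move=> i; rewrite tnth_nseq.
apply: le_trans (ereal_sup_ubound _); last by exists w => //; exists [tuple of nseq (ord_g n) gam].
by rewrite lee_fin sqrtr_ge0.
Qed.

Lemma normN_ge0 u : (0 <= normN X u)%E.
Proof. by apply: sume_ge0 => n _; exact: normN_term_ge0. Qed.

Lemma normN_ge delta u : (normN X u <= delta%:E)%E -> derivs_le delta u.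
Proof.
move=> ud n I etas w nN Xw ue; rewrite -lee_fin; apply: le_trans ud.
rewrite /normN (bigD1 n)//=.
apply: (@le_trans _ _ (ereal_sup [set (Num.sqrt (\sum_(I : (ord_x n).-tuple 'I_d)
   iter_deriv T (steps I etas) u w ^+ 2))%:E | w in X & etas in @unit_directions _ T e (ord_g n)])).
  apply: le_trans (ereal_sup_ubound _); last by exists w => //; exists etas.
  rewrite lee_fin -sqrtr_sqr ler_wsqrtr// (bigD1 I)//= lerDl sumr_ge0// => j _.
  exact: sqr_ge0.
rewrite leeDl// sume_ge0// => m _; exact: normN_term_ge0.
Qed.

(** As for [sup_ball], a strict slack s < delta produces an open set, since neighbourhoods come from
    open sets and not from balls. *)
Lemma derivs_close_nbhs delta (u : CN_space X) : 0 < delta ->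
  nbhs u [set v : CN_space X | derivs_close delta (sval u) (sval v)].
Proof.
move=> d0.
apply: (@filterS _ _ _ [set v : CN_space X | exists2 s, s < delta & derivs_close s (sval u) (sval v)]).
  by move=> v [s sd uv] n I etas w nN Xw ue; apply: le_trans (ltW sd); exact: uv.
apply/open_nbhs_nbhs; split; last first.
  by exists 0 => // n I etas w nN Xw ue; rewrite subrr normr0.
move=> v [s sd uv]; have e0 : 0 < (delta - s) / 2 by rewrite divr_gt0// subr_gt0.
exists ((delta - s) / 2) => // y vy; exists (s + (delta - s) / 2); first by lra.
apply: derivs_close_trans uv _; apply/derivs_closeE; [exact: svalP|exact: svalP|].
by apply: normN_ge; exact: ltW.
Qed.

End NormN.

(** * The differential operator and convergence by compactness *)

Section Operator.
Variables (R : realType) (T p : R) (d e : nat).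
Hypothesis T_gt0 : 0 < T.
Variable X : set (ospace T p d e).
Local Notation path := (path_type R e).
Variables (a : forall n : midx, (ord_x n).-tuple 'I_d -> R)
  (eta : forall n : midx, (ord_g n).-tuple path).
Hypothesis eta_BV0 : forall n i, in_N n -> BV0 T (tnth (eta n) i).
Implicit Types (u v : ppoint R d e -> R) (w : ppoint R d e) (n : midx).
Local Notation L := (operator_L T a eta).

(** The norm tests unit directions, whereas the equation has arbitrary ones; the factor has one
    power of the rescaling for each pathwise derivative. *)
Lemma iter_deriv_unit_scale n (etas : (ord_g n).-tuple path) : in_N n ->
  (forall i, BV0 T (tnth etas i)) ->
  exists2 c, 0 <= c & exists2 etas' : (ord_g n).-tuple path, unit_directions T etas' &
    forall I u w, in_CN X u -> X w ->
    iter_deriv T (steps (I : (ord_x n).-tuple 'I_d) etas) u w = c * iter_deriv T (steps I etas') u w.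
Proof.
move=> nN bv; have [N N0 [etas' ue E]] := unit_scale T_gt0 bv.
exists (N ^+ ord_g n); first exact/exprn_ge0/ltW.
exists etas' => // I u w Cu Xw; rewrite /steps E.
have [/(_ w Xw) ex _] := Cu.1 n I etas' nN (fun i => (ue i).1).
rewrite /steps !catA in ex *.
have [g0|g0] := eqVneq (ord_g n) 0%N.
  have -> : tval etas' = [::] by apply: size0nil; rewrite size_tuple.
  by rewrite g0 expr0 mul1r.
have t0 : ord_t n = 0%N.
  by move: nN; rewrite /in_N (negbTE g0) !andbF/= => /andP[/eqP].
rewrite iter_deriv_scale ?size_tuple//; first by rewrite gt_eqF.
rewrite t0/= => st; elim: (tval I) => [//|x s IH] /= [<-//|]; exact: IH.
Qed.

Lemma operator_close : exists2 A, 0 <= A & forall u v delta w,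
  in_CN X u -> in_CN X v -> derivs_close X delta u v -> X w ->
  `|L u w - L v w| <= A * delta.
Proof.
have /choice[c Hc] n : exists c, 0 <= c /\ (in_N n -> forall I u v delta w,
    in_CN X u -> in_CN X v -> derivs_close X delta u v -> X w ->
    `|iter_deriv T (steps (I : (ord_x n).-tuple 'I_d) (eta n)) u w -
      iter_deriv T (steps I (eta n)) v w| <= c * delta).
  have [nN|nN] := boolP (in_N n); last by exists 0.
  have [c c0 [etas' ue E]] := iter_deriv_unit_scale nN (fun i => eta_BV0 i nN).
  exists c; split=> // _ I u v delta w Cu Cv uv Xw; rewrite !E// -mulrBr normrM ger0_norm//.
  by rewrite ler_wpM2l// uv.
exists (\sum_(n : midx | in_N n) \sum_(I : (ord_x n).-tuple 'I_d) `|a I| * c n).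
  by apply: sumr_ge0 => n _; apply: sumr_ge0 => I _; rewrite mulr_ge0// (Hc n).1.
move=> u v delta w Cu Cv uv Xw; rewrite /operator_L -sumrB mulr_suml.
apply: le_trans (ler_norm_sum _ _ _) _; apply: ler_sum => n nN.
rewrite -sumrB mulr_suml; apply: le_trans (ler_norm_sum _ _ _) _; apply: ler_sum => I _.
rewrite -mulrBr normrM -mulrA ler_wpM2l//; exact: (Hc n).2.
Qed.

Lemma operator_cvg v (w : ospace T p d e) : in_CN X v -> before_T X w ->
  L v z @[z --> within (before_T X) (nbhs w)] --> L v w.
Proof.
move=> [Cv _] Xw; rewrite /operator_L.
apply: (cvg_big (op := +%R)); first exact: add_continuous.
move=> n nN; apply: (cvg_big (op := +%R)); first exact: add_continuous.
move=> I _; apply: cvgM; first exact: cvg_cst.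
have [_ cv] := Cv n I (eta n) nN (fun i => eta_BV0 i nN).
have {}cv : {within before_T X, continuous (iter_deriv T (steps I (eta n)) v : ospace T p d e -> R)}.
  by move: cv; case: ifP => // _; apply: continuous_subspaceW => z [].
by move/subspace_continuousP : cv; apply.
Qed.

Lemma in_CN_cvg v (w : ospace T p d e) (Y : set (ospace T p d e)) : in_CN X v -> Y `<=` X -> Y w ->
  v z @[z --> within Y (nbhs w)] --> v w.
Proof.
move=> [Cv _] YX Yw; pose n0 : midx := (ord0, ord0, ord0).
have [|_] := Cv n0 [tuple] [tuple] isT; first by case.
by move=> /(continuous_subspaceW YX)/subspace_continuousP; apply.
Qed.

Lemma derivs_close_val delta u v w : derivs_close X delta u v -> X w -> `|u w - v w| <= delta.
Proof.
move=> uv Xw; pose n0 : midx := (ord0, ord0, ord0).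
by have := uv n0 [tuple] [tuple] w isT Xw; apply; case.
Qed.

Variables (f phi : ppoint R d e -> R).
Local Notation solves := (solves_ppde X a eta f phi).

(* The limit point inherits the equation because both sides are continuous and
   the collocation points become dense. *)
Lemma limit_solves (wint wter : nat -> nat -> nat -> ppoint R d e) (ustar v : ppoint R d e -> R)
    (U : nat -> nat -> ppoint R d e -> R) :
  in_CN X ustar -> solves ustar -> in_CN X v ->
  asymptotically_dense (before_T X) fst wint -> asymptotically_dense (at_T X) snd wter ->
  (forall m n : nat, (0 < m)%N -> (0 < n)%N ->
    [/\ in_CN X (U m n),
        forall i, (i < m)%N -> before_T X (wint m n i) /\ L (U m n) (wint m n i) = f (wint m n i) &
        forall j, (j < n)%N -> at_T X (wter m n j) /\ U m n (wter m n j) = phi (wter m n j)]) ->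
  (forall delta (P : set (nat * nat)), 0 < delta -> filter_prod \oo \oo P ->
    exists m n : nat, [/\ P (m, n), (0 < m)%N, (0 < n)%N & derivs_close X delta v (U m n)]) ->
  solves v.
Proof.
move=> Cs [s1 s2] Cv dint dter HU cl.
have small (x y A : R) : 0 <= A -> (forall eps, 0 < eps -> `|x - y| <= A * eps) -> x = y.
  move=> A0 h; apply/eqP; rewrite -subr_eq0 -normr_le0; apply/ler_addgt0Pr => eps e0.
  rewrite add0r; have A1 : 0 < A + 1 by rewrite ltr_wpDl.
  apply: le_trans (h (eps / (A + 1)) (divr_gt0 e0 A1)) _.
  have A2 : A / (A + 1) <= 1 by rewrite ler_pdivrMr// mul1r lerDl.
  by rewrite mulrCA; apply: ler_piMr => //; exact: ltW.
split=> w Yw.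
  (* Three errors: A eps for the distance between v and the minimiser, and eps each for the
     continuity of L v and of L ustar. The latter agrees with f before time T and provides the
     continuity of the right-hand side. *)
  have [A A0 HA] := operator_close; apply: (small _ _ (A + 2)); first by rewrite addr_ge0.
  move=> eps e0.
  have /cvgrPdist_le/(_ _ e0) h1 := operator_cvg Cv Yw.
  have /cvgrPdist_le/(_ _ e0) h2 := operator_cvg Cs Yw.
  have /(dint w Yw) h3 : nbhs (w : ospace T p d e) [set z | before_T X z ->
     `|L v w - L v z| <= eps /\ `|L ustar w - L ustar z| <= eps].
    by apply: filterS2 h1 h2 => z z1 z2; split.
  have [m [n [[i im Hi] m0 n0 vU]]] := cl _ _ e0 h3.
  have [CU /(_ i im)[Xi Ui] _] := HU m n m0 n0.
  have [k1 k2] := Hi Xi.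
  have k3 := HA _ _ _ _ Cv CU vU (proj1 Xi).
  rewrite -s1// in k2 *; rewrite Ui -s1// in k3.
  have -> : L v w - L ustar w = (L v w - L v (wint m n i)) +
     (L v (wint m n i) - L ustar (wint m n i)) - (L ustar w - L ustar (wint m n i)) by ring.
  apply: le_trans (ler_normB _ _) _; have := ler_normD (L v w - L v (wint m n i)) (L v (wint m n i) - L ustar (wint m n i)).
  by move: k1 k2 k3 => /=; lra.
apply: (small _ _ 3) => // eps e0.
have atX : at_T X `<=` X by move=> z [].
have /cvgrPdist_le/(_ _ e0) h1 := in_CN_cvg Cv atX Yw.
have /cvgrPdist_le/(_ _ e0) h2 := in_CN_cvg Cs atX Yw.
have /(dter w Yw) h3 : nbhs (w : ospace T p d e) [set z | at_T X z ->
   `|v w - v z| <= eps /\ `|ustar w - ustar z| <= eps].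
  by apply: filterS2 h1 h2 => z z1 z2; split.
have [m [n [[i im Hi] m0 n0 vU]]] := cl _ _ e0 h3.
have [CU _ /(_ i im)[Xi Ui]] := HU m n m0 n0.
have [k1 k2] := Hi Xi.
have k3 := derivs_close_val vU (proj1 Xi).
rewrite -s2// in k2 *; rewrite Ui -s2// in k3.
have -> : v w - ustar w = (v w - v (wter m n i)) +
   (v (wter m n i) - ustar (wter m n i)) - (ustar w - ustar (wter m n i)) by ring.
apply: le_trans (ler_normB _ _) _; have := ler_normD (v w - v (wter m n i)) (v (wter m n i) - ustar (wter m n i)).
by move: k1 k2 k3 => /=; lra.
Qed.

Hypothesis X0 : exists w, X w.
Hypothesis path0 : exists gam : path, BV0 T gam /\ (pvar_norm 1 0 T gam <= 1)%E.

(** By contradiction: the filter [G] carries the product filter, restricted to the pairs (m, n)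
    whose minimiser is not delta-close to ustar, over to the function space. A cluster point of [G]
    solves the equation, so it is at distance 0 from ustar; yet some of these minimisers are
    delta-close to it. *)
Lemma compact_convergence (wint wter : nat -> nat -> nat -> ppoint R d e) (ustar : ppoint R d e -> R)
    (U : nat -> nat -> ppoint R d e -> R) :
  in_CN X ustar -> solves ustar ->
  (forall v, in_CN X v -> solves v -> normN X (v \- ustar) = 0%E) ->
  precompact [set v : CN_space X | exists m n : nat, [/\ (0 < m)%N, (0 < n)%N & sval v = U m n]] ->
  asymptotically_dense (before_T X) fst wint -> asymptotically_dense (at_T X) snd wter ->
  (forall m n : nat, (0 < m)%N -> (0 < n)%N ->
    [/\ in_CN X (U m n),
        forall i, (i < m)%N -> before_T X (wint m n i) /\ L (U m n) (wint m n i) = f (wint m n i) &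
        forall j, (j < n)%N -> at_T X (wter m n j) /\ U m n (wter m n j) = phi (wter m n j)]) ->
  forall delta, 0 < delta -> \forall mn \near filter_prod \oo \oo,
    (0 < mn.1)%N -> (0 < mn.2)%N -> derivs_close X delta (U mn.1 mn.2) ustar.
Proof.
move=> Cs ss uniq [K KU cK] dint dter HU delta d0; apply: contrapT => nclose.
pose F := filter_prod (\oo : set_system nat) (\oo : set_system nat).
pose bad (mn : nat * nat) := [/\ (0 < mn.1)%N, (0 < mn.2)%N & ~ derivs_close X delta (U mn.1 mn.2) ustar].
pose G := [set W : set (CN_space X) | F [set mn | bad mn ->
  forall v : CN_space X, sval v = U mn.1 mn.2 -> W v]].
have FG : Filter G.
  split; first by apply: filterS (@filterT _ F _).
    by move=> V W; apply: (@filterS2 _ F) => mn hV hW b v vU; split; [exact: hV|exact: hW].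
  by move=> V W VW; apply: (@filterS _ F) => mn hV b v vU; apply: VW; exact: hV.
have PG : ProperFilter G.
  apply: Build_ProperFilter_ex => W GW.
  apply: contrapT => noW.
  apply: nclose; apply: (@filterS _ F _ _ _ _ GW) => mn hW m0 n0; apply: contrapT => nc.
  have [CU _ _] := HU mn.1 mn.2 m0 n0.
  apply: noW; exists (exist _ _ CU); exact: hW.
have GK : G K.
  by apply: filterS (@filterT _ F _) => mn _ [m0 n0 _] v vU; apply: KU; exists mn.1, mn.2.
have [v [_ clv]] := cK.1 G PG GK.
have Cv : in_CN X (sval v) := svalP v.
have close delta' (P : set (nat * nat)) : 0 < delta' -> F P ->
    exists m n : nat, [/\ P (m, n), bad (m, n) & derivs_close X delta' (sval v) (U m n)].
  move=> d'0 FP.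
  pose A := [set z : CN_space X | exists m n : nat, [/\ P (m, n), bad (m, n) & sval z = U m n]].
  have GA : G A.
    by apply: filterS FP => -[m n] Pmn b z zU; exists m, n.
  have [z [[m [n [Pmn b zU]]] vz]] := clv _ _ GA (derivs_close_nbhs X0 path0 v d'0).
  by exists m, n; rewrite -zU.
have sv : solves (sval v).
  apply: (limit_solves Cs ss Cv dint dter HU) => delta' P d'0 FP.
  by have [m [n [Pmn [m0 n0 _] c]]] := close _ _ d'0 FP; exists m, n.
have vs : derivs_close X 0 (sval v) ustar.
  apply/derivs_closeE => //; apply: (normN_ge X0 path0); rewrite uniq//.
have [m [n [_ [_ _ nc] c]]] := close _ _ d0 (@filterT _ F _).
apply: nc; rewrite -(addr0 delta) /=; apply: derivs_close_trans vs; exact: derivs_closeC.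
Qed.

End Operator.

(** * Bounded functionals of the equation and convergence in the RKHS *)

Section Collocation.
Variables (R : realType) (T p : R) (d e : nat).
Hypotheses (T_gt0 : 0 < T) (p_gt1 : 1 < p).
Local Notation V1 := 'rV[R]_(1 + d).
Local Notation V2 := 'rV[R]_e.+1.
Local Notation path := (path_type R e).
Variables (X : set (ospace T p d e)) (r : R).
Hypotheses (X_Omega : X `<=` @Omega R T d e) (X_bounded : forall w : ppoint R d e, X w ->
   (pvar_norm 1 0 T (ppath w) <= r%:E)%E).
Variables (k : V1 -> V1 -> R) (Hk : rkhs k) (l : V2 -> V2 -> R) (Hl : rkhs l).
Variables (g : V2 -> V2 -> R) (Hg : rkhs g) (TV : rkhs (tensor_kernel g)).
Variables (Ck Cl Cg : R).
Hypotheses (Cg0 : 0 <= Cg) (k_smooth : diff_bounded k 3 k Ck).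
Hypotheses (l_smooth : diff_bounded l 3 l Cl) (g_smooth : diff_bounded g 4 g Cg).
Variable H : rkhs (restricted_kernel (X := X) (kappa T k l TV)).
Local Notation B := {w : ppoint R d e | X w}.
Implicit Types (h f : B -> R) (w : ppoint R d e) (sts : seq (step R d e)) (n : midx).
Local Notation D sts h w := (iter_deriv T sts (extension H h) w).
Local Notation M0 := (mdiff_cst Ck Cl Cg r).

Let M00 : 0 <= M0. Proof. exact: (mdiff_cst_ge0 _ k_smooth l_smooth). Qed.

Let X_time' w : X w -> 0 <= ptime w <= T. Proof. exact: X_time. Qed.
Let tamept w : X w -> tame_pt T (pt_of w). Proof. exact: (X_tame_pt T_gt0 X_Omega X_bounded). Qed.

Let deriv_ex N sts h w : 1 <= N -> admissible T N sts -> X w -> carrier H h ->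
  iter_deriv_exists T sts (extension H h) w.
Proof.
move=> N1 adm Xw Ch.
exact: (iter_deriv_extension T_gt0 X_Omega X_bounded Hk Hl Hg Cg0 k_smooth l_smooth g_smooth N1 adm Ch
  (X_time' Xw) (tamept Xw)).1.
Qed.

Let deriv_lin N sts (c : R) f h w : 1 <= N -> admissible T N sts -> X w ->
  carrier H f -> carrier H h -> D sts (fun z => c * f z + h z) w = c * D sts f w + D sts h w.
Proof. exact: (ext_deriv_lin T_gt0 X_Omega X_bounded Hk Hl Hg Cg0 k_smooth l_smooth g_smooth). Qed.

Let deriv_le N sts h w : 1 <= N -> admissible T N sts -> X w -> carrier H h ->
  `|D sts h w| <= M0 * N ^+ 2 * hnorm H h.
Proof. exact: (ext_deriv_le T_gt0 X_Omega X_bounded Hk Hl Hg Cg0 k_smooth l_smooth g_smooth). Qed.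

Let deriv_cont N sts w (eps : R) : 1 <= N -> admissible T N sts -> 0 < eps -> X w ->
  (has (@is_time R d e) sts -> ptime w < T) ->
  exists2 rho, 0 < rho & forall w', X w' -> (has (@is_time R d e) sts -> ptime w' < T) ->
    sup_ball T rho w w' -> forall h, carrier H h ->
    `|D sts h w' - D sts h w| <= eps * hnorm H h.
Proof. exact: (ext_deriv_cont T_gt0 X_Omega X_bounded Hk Hl Hg Cg0 k_smooth l_smooth g_smooth). Qed.

Lemma BV0_good m (etas : m.-tuple path) : (forall i, BV0 T (tnth etas i)) ->
  exists2 N, 1 <= N & forall i, good_step T N (@Step_path R d e (tnth etas i)).
Proof.
move=> bv; have /choice[N HN] i : exists N, 0 < N /\ (pvar_norm 1 0 T (tnth etas i) <= N%:E)%E.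
  by have [N N0 pN] := BV0_tame T_gt0 (bv i); exists N.
have Nge0 : 0 <= \sum_i N i by apply: sumr_ge0 => i _; apply: ltW; exact: (HN i).1.
exists (1 + \sum_i N i) => [|i]; first by rewrite lerDl.
have [_ cg _ _] := bv i; apply: (pvar_norm1_tame T_gt0 cg); apply: le_trans (HN i).2 _.
rewrite lee_fin (bigD1 i)//= addrCA lerDl addr_ge0//.
by apply: sumr_ge0 => j _; apply: ltW; exact: (HN j).1.
Qed.

Lemma unit_good m (etas : m.-tuple path) : unit_directions T etas ->
  forall i, good_step T 1 (@Step_path R d e (tnth etas i)).
Proof. by move=> ue i; have [[_ cg _ _] pN] := ue i; exact: (pvar_norm1_tame T_gt0 cg). Qed.

Lemma extension_in_CN h : carrier H h -> in_CN X (extension H h).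
Proof.
move=> Ch; split; last first.
  apply: le_lt_trans (normN_le (delta := M0 * hnorm H h) _ _) (ltry _).
    by rewrite mulr_ge0// hnorm_ge0.
  move=> n I etas w nN Xw ue; have [adm _] := admissible_steps I nN (unit_good ue).
  by have := deriv_le (lexx 1) adm Xw Ch; rewrite expr1n mulr1.
move=> n I etas nN bv; have [N N1 good] := BV0_good bv.
have [adm hE] := admissible_steps I nN good.
split=> [w Xw|]; first exact: (deriv_ex N1 adm).
have tm w : (if (ord_t n == 0)%N then X else before_T X) w ->
    X w /\ (has (@is_time R d e) (steps I etas) -> ptime w < T).
  by rewrite hE; case: ifP => //= _ [].
apply/subspace_continuousP => w Yw; have [Xw tw] := tm w Yw.
apply/cvgrPdist_le => eps e0.
have h1 : 0 < hnorm H h + 1 by rewrite ltr_wpDl// hnorm_ge0.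
have [rho rho0 Hrho] := deriv_cont N1 adm (divr_gt0 e0 h1) Xw tw.
have nb : nbhs (w : ospace T p d e) (sup_ball T rho w : set (ospace T p d e)).
  exact: (sup_ball_nbhs p_gt1).
apply: filterS nb => w' ww' Yw'; have [Xw' tw'] := tm w' Yw'.
rewrite distrC; apply: le_trans (Hrho w' Xw' tw' ww' h Ch) _.
by rewrite mulrAC ler_pdivrMr// ler_pM2l// lerDl.
Qed.

(** Derivatives in unit directions are functionals on the RKHS bounded uniformly over X, so
    convergence in the RKHS implies convergence of all derivatives in the norm. *)
Lemma extension_close f h : carrier H f -> carrier H h ->
  derivs_close X (M0 * hnorm H (fun z => f z - h z)) (extension H f) (extension H h).
Proof.
move=> Cf Ch n I etas w nN Xw ue; have [adm _] := admissible_steps I nN (unit_good ue).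
have Cb := carrierB Cf Ch.
have := deriv_lin 1 (lexx 1) adm Xw Cb Ch.
rewrite (_ : (fun z => 1 * (f z - h z) + h z) = f); last by apply/funext => z; rewrite mul1r subrK.
move=> ->; rewrite mul1r addrK; have := deriv_le (lexx 1) adm Xw Cb.
by rewrite expr1n mulr1.
Qed.

Lemma extension_val h w (Xw : X w) : carrier H h -> extension H h w = h (exist _ w Xw).
Proof.
by move=> Ch; rewrite /extension (reproducing (exist _ w Xw) Ch).
Qed.

Variables (a : forall n : midx, (ord_x n).-tuple 'I_d -> R)
  (eta : forall n : midx, (ord_g n).-tuple path).
Hypothesis eta_BV0 : forall n i, in_N n -> BV0 T (tnth (eta n) i).
Local Notation L h w := (operator_L T a eta (extension H h) w).

Let eta_adm : exists2 N, 1 <= N & forall n I, in_N n ->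
  admissible T N (steps (I : (ord_x n).-tuple 'I_d) (eta n)) /\
  has (@is_time R d e) (steps I (eta n)) = (ord_t n != 0)%N.
Proof.
have /choice[N HN] n : exists N, 1 <= N /\ (in_N n -> forall i, good_step T N (@Step_path R d e (tnth (eta n) i))).
  have [nN|nN] := boolP (in_N n); last by exists 1.
  by have [N N1 good] := BV0_good (fun i => eta_BV0 i nN); exists N.
have N0 n : 0 <= N n by apply: le_trans (HN n).1.
exists (1 + \sum_n N n) => [|n I nN]; first by rewrite lerDl sumr_ge0.
apply: admissible_steps => // i; have [te be] := (HN n).2 nN i.
have le : N n <= 1 + \sum_n N n by rewrite (bigD1 n)//= addrCA lerDl addr_ge0// sumr_ge0.
split; first exact: tame_mono te.
by move=> s sT; apply: le_trans le; exact: be.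
Qed.

Lemma operator_lin (c : R) f h w : X w -> carrier H f -> carrier H h ->
  L (fun z => c * f z + h z) w = c * L f w + L h w.
Proof.
move=> Xw Cf Ch; have [N N1 adm] := eta_adm.
rewrite /operator_L mulr_sumr -big_split; apply: eq_bigr => n nN.
rewrite mulr_sumr -big_split; apply: eq_bigr => I _.
rewrite (deriv_lin c N1 (adm n I nN).1 Xw Cf Ch) /=; ring.
Qed.

Lemma operator_le : exists2 M, 0 <= M & forall h w, X w -> carrier H h -> `|L h w| <= M * hnorm H h.
Proof.
have [N N1 adm] := eta_adm.
exists (\sum_(n : midx | in_N n) \sum_(I : (ord_x n).-tuple 'I_d) `|a I| * (M0 * N ^+ 2)).
  apply: sumr_ge0 => n _; apply: sumr_ge0 => I _; apply: mulr_ge0 => //.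
  by apply: mulr_ge0 => //; apply/exprn_ge0/(le_trans _ N1).
move=> h w Xw Ch; rewrite mulr_suml; apply: le_trans (ler_norm_sum _ _ _) _.
apply: ler_sum => n nN; rewrite mulr_suml; apply: le_trans (ler_norm_sum _ _ _) _.
apply: ler_sum => I _; rewrite normrM -mulrA ler_wpM2l//.
exact: deriv_le (adm n I nN).1 _ _.
Qed.

Lemma operator_near w (eps : R) : before_T X w -> 0 < eps -> exists2 rho, 0 < rho &
  forall w', before_T X w' -> sup_ball T rho w w' -> forall h, carrier H h ->
  `|L h w' - L h w| <= eps * hnorm H h.
Proof.
move=> [Xw tw] e0; have [N N1 adm] := eta_adm.
pose A := \sum_(n : midx | in_N n) \sum_(I : (ord_x n).-tuple 'I_d) `|a I|.
have A0 : 0 <= A by apply: sumr_ge0 => n _; apply: sumr_ge0.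
have A1 : 0 < A + 1 by rewrite ltr_wpDl.
have e1 : 0 < eps / (A + 1) by rewrite divr_gt0.
have /choice[rho Hrho] n : exists rho, 0 < rho /\ (in_N n -> forall (I : (ord_x n).-tuple 'I_d) w',
    before_T X w' -> sup_ball T rho w w' -> forall h, carrier H h ->
    `|D (steps I (eta n)) h w' - D (steps I (eta n)) h w| <= eps / (A + 1) * hnorm H h).
  have [nN|nN] := boolP (in_N n); last by exists 1.
  have /choice[rho Hrho] (I : (ord_x n).-tuple 'I_d) :
      exists rho, 0 < rho /\ forall w', before_T X w' -> sup_ball T rho w w' -> forall h, carrier H h ->
      `|D (steps I (eta n)) h w' - D (steps I (eta n)) h w| <= eps / (A + 1) * hnorm H h.
    have [rho rho0 Hr] := deriv_cont N1 (adm n I nN).1 e1 Xw (fun _ => tw).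
    by exists rho; split=> // w' [Xw' tw'] ww' h Ch; exact: Hr.
  exists (\big[Num.min/1]_I rho I); split.
    by apply: lt_bigmin => // I _; exact: (Hrho I).1.
  move=> _ I w' Yw' [s sr hs]; apply: (Hrho I).2 => //; exists s => //.
  by apply: lt_le_trans sr _; exact: bigmin_inf.
exists (\big[Num.min/1]_n rho n).
  by apply: lt_bigmin => // n _; exact: (Hrho n).1.
move=> w' Yw' [s sr hs] h Ch.
have ww' n : sup_ball T (rho n) w w'.
  by exists s => //; apply: lt_le_trans sr _; exact: bigmin_inf.
rewrite /operator_L -sumrB.
apply: (@le_trans _ _ (A * (eps / (A + 1) * hnorm H h))).
  rewrite /A mulr_suml; apply: le_trans (ler_norm_sum _ _ _) _; apply: ler_sum => n nN.
  rewrite -sumrB mulr_suml; apply: le_trans (ler_norm_sum _ _ _) _; apply: ler_sum => I _.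
  by rewrite -mulrBr normrM ler_wpM2l//; exact: (Hrho n).2.
have A2 : A / (A + 1) <= 1 by rewrite ler_pdivrMr// mul1r lerDl.
rewrite mulrA ler_wpM2r ?hnorm_ge0// mulrCA; apply: ler_piMr => //; exact: ltW.
Qed.

Variables (f phi : ppoint R d e -> R).
Local Notation solves := (solves_ppde X a eta f phi).
Variables (wint wter : nat -> nat -> nat -> ppoint R d e).
Hypothesis wint_in : forall m n i : nat, (0 < m)%N -> (0 < n)%N -> (i < m)%N ->
  before_T X (wint m n i).
Hypothesis wter_in : forall m n j : nat, (0 < m)%N -> (0 < n)%N -> (j < n)%N ->
  at_T X (wter m n j).
Variable u : nat -> nat -> B -> R.
Hypothesis u_optimal : forall m n : nat, (0 < m)%N -> (0 < n)%N ->
  optimal_recovery H a eta f phi m n (wint m n) (wter m n) (u m n).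
Hypothesis dint : asymptotically_dense (before_T X) fst wint.
Hypothesis dter : asymptotically_dense (at_T X) snd wter.

Lemma extension_lin (c : R) h1 h2 w : X w -> carrier H h1 -> carrier H h2 ->
  extension H (fun z => c * h1 z + h2 z) w = c * extension H h1 w + extension H h2 w.
Proof. by move=> Xw C1 C2; have Cc := carrierP c C1 C2; rewrite !(extension_val Xw). Qed.

(** At t = - b / (A + 1) the polynomial is negative unless b = 0; the summand 1 covers A = 0. *)
Lemma linear_ge0_eq0 (A b : R) : 0 <= A -> (forall t, 0 <= t ^+ 2 * A + 2 * t * b) -> b = 0.
Proof.
move=> A0 h; have A1 : 0 < A + 1 by rewrite ltr_wpDl.
have := h (- b / (A + 1)).
have -> : (- b / (A + 1)) ^+ 2 * A + 2 * (- b / (A + 1)) * b = - (b ^+ 2 * (A + 2) / (A + 1) ^+ 2).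
  by field; rewrite gt_eqF.
rewrite oppr_ge0 pmulr_lle0 ?invr_gt0 ?exprn_gt0// pmulr_lle0 ?ltr_wpDl// => b2.
by apply/eqP; rewrite -sqrf_eq0 eq_le b2 sqr_ge0.
Qed.

(* Optimality makes the minimiser orthogonal to the differences of feasible
   points, in particular to its error. *)
Lemma error_orthogonal h (m n : nat) : (0 < m)%N -> (0 < n)%N -> carrier H h -> solves (extension H h) ->
  let v := (fun z => -1 * u m n z + h z) in
  [/\ carrier H v, dot H v v = dot H v h,
      forall i, (i < m)%N -> L v (wint m n i) = 0 &
      forall j, (j < n)%N -> extension H v (wter m n j) = 0].
Proof.
move=> m0 n0 Ch [s1 s2] v; have [[Cu f1 f2] opt] := u_optimal m0 n0.
have Cv : carrier H v by exact: carrierP.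
have v1 i : (i < m)%N -> L v (wint m n i) = 0.
  move=> im; have [Xi Ti] := wint_in m0 n0 im.
  by rewrite operator_lin// f1// s1// mulN1r addNr.
have v2 j : (j < n)%N -> extension H v (wter m n j) = 0.
  move=> jn; have [Xj Tj] := wter_in m0 n0 jn.
  by rewrite extension_lin// f2// s2// mulN1r addNr.
(* Adding t v to the minimiser preserves all constraints. *)
have orth : dot H v (u m n) = 0.
  apply: (@linear_ge0_eq0 (hnorm H v ^+ 2)); first exact: sqr_ge0.
  move=> t; have Ct := carrierP t Cv Cu.
  have : feasible H a eta f phi m n (wint m n) (wter m n) (fun z => t * v z + u m n z).
    split=> // [i im|j jn].
      have [Xi _] := wint_in m0 n0 im.
      by rewrite operator_lin// v1// mulr0 add0r f1.
    have [Xj _] := wter_in m0 n0 jn.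
    by rewrite extension_lin// v2// mulr0 add0r f2.
  by move=> /opt; rewrite ler_pM2l ?invr_gt0// hnorm_lin// => h1; lra.
split=> //; have Cv' := carrierZ (-1) Cu.
rewrite {2}/v dotDr// dotZr// orth mulr0 add0r//.
Qed.

Lemma hilbert_convergence h : carrier H h -> solves (extension H h) ->
  (forall h', carrier H h' -> solves (extension H h') -> h' = h) ->
  forall delta, 0 < delta -> \forall mn \near filter_prod \oo \oo,
    (0 < mn.1)%N -> (0 < mn.2)%N ->
    derivs_close X delta (extension H (u mn.1 mn.2)) (extension H h).
Proof.
move=> Ch sh uniq delta d0.
pose F := filter_prod (\oo : set_system nat) (\oo : set_system nat).
pose v (mn : nat * nat) := (fun z => -1 * u mn.1 mn.2 z + h z).
have pos : F [set mn | (0 < mn.1)%N /\ (0 < mn.2)%N].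
  exists ([set m | (0 < m)%N], [set n | (0 < n)%N]); last by move=> [].
  by split; exists 1%N.
have E mn := fun m1 m2 => error_orthogonal (m := mn.1) (n := mn.2) m1 m2 Ch sh.
pose LL := [set L0 : (B -> R) -> R | (exists2 w, before_T X w & L0 = fun h' => L h' w) \/
  (exists2 w, at_T X w & L0 = fun h' => extension H h' w)].
have small (eps : R) : 0 < eps -> \forall mn \near F, hnorm H (v mn) <= eps.
  apply: (@hilbert_weak_strong _ _ _ _ H F _ v h LL) => //.
  - by apply: filterS pos => mn [m0 n0]; have [] := E mn m0 n0.
  - move=> L0 [[w Yw ->]|[w [Xw Tw] ->]].
      have Xw := Yw.1.
      split; first by move=> c h1 h2 C1 C2; rewrite operator_lin.
        by have [M M1 HM] := operator_le; exists M => // h' Ch'; exact: HM.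
      move=> eps' e'0; have [rho rho0 Hrho] := operator_near Yw e'0.
      (* Some collocation point lies in this neighbourhood; the operator annihilates the error
         there, so its value at w is at most eps' times the norm of the error. *)
      have := dint Yw (sup_ball_nbhs p_gt1 w rho0).
      apply: filterS2 pos => mn [m0 n0] [i im ww'].
      have [Cv _ v1 _] := E mn m0 n0.
      have := Hrho _ (wint_in m0 n0 im) ww' _ Cv.
      by rewrite v1// sub0r normrN.
    split; first by move=> c h1 h2 C1 C2; rewrite extension_lin.
      exists (M0 * 1 ^+ 2); first by rewrite expr1n mulr1; exact: M00.
      (* Evaluation is the derivative along the empty list of steps. *)
      move=> h' Ch'; apply: (deriv_le (N := 1) (sts := [::])) => //.
      by split=> //; right.
    move=> eps' e'0.
    have [rho rho0 Hrho] : exists2 rho, 0 < rho & forall w', X w' -> true -> sup_ball T rho w w' ->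
       forall h, carrier H h -> `|extension H h w' - extension H h w| <= eps' * hnorm H h.
      have [||rho rho0 Hr] := @deriv_cont 1 [::] w eps' (lexx 1) _ e'0 Xw.
      - by split=> //; right.
      - by [].
      by exists rho => // w' Xw' _; exact: Hr.
    have := dter (conj Xw Tw) (sup_ball_nbhs p_gt1 w rho0).
    apply: filterS2 pos => mn [m0 n0] [i im ww'].
    have [Cv _ _ v2] := E mn m0 n0.
    have := Hrho _ (wter_in m0 n0 im).1 isT ww' _ Cv.
    by rewrite v2// sub0r normrN.
  move=> h' Ch' HL; apply: uniq => //; case: sh => s1 s2; split=> w Yw.
    by rewrite -s1//; apply: (HL (fun h' => L h' w)); left; exists w.
  by rewrite -s2//; apply: (HL (fun h' => extension H h' w)); right; exists w.
have M1 : 0 < M0 + 1 by rewrite ltr_wpDl.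
have := small _ (divr_gt0 d0 M1); apply: filterS => mn hv m0 n0.
have [[Cu _ _] _] := u_optimal m0 n0.
have c := extension_close Ch Cu.
apply: derivs_closeC => k' I etas w nN Xw ue; apply: le_trans (c k' I etas w nN Xw ue) _.
rewrite (_ : (fun z => h z - u mn.1 mn.2 z) = v mn); last first.
  by apply/funext => z; rewrite /v mulN1r addrC.
apply: (@le_trans _ _ (M0 * (delta / (M0 + 1)))); first by rewrite ler_wpM2l.
have M2 : M0 / (M0 + 1) <= 1 by rewrite ler_pdivrMr// mul1r lerDl.
by rewrite mulrCA; apply: ler_piMr => //; exact: ltW.
Qed.

End Collocation.

Lemma normN_cvg0 (R : realType) (T p : R) (d e : nat) (X : set (ospace T p d e))
    (I : Type) (F : set_system I) (FF : Filter F) (U : I -> ppoint R d e -> R) v :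
  (exists w, X w) -> (exists gam : path_type R e, BV0 T gam /\ (pvar_norm 1 0 T gam <= 1)%E) ->
  in_CN X v -> (\forall i \near F, in_CN X (U i)) ->
  (forall delta, 0 < delta -> \forall i \near F, derivs_close X delta (U i) v) ->
  (fun i => normN X (U i \- v)) @ F --> 0%E.
Proof.
move=> X0 path0 Cv CU cl.
have cst0 : 0 <= normN_cst R d by apply: sumr_ge0.
have cst1 : 0 < normN_cst R d + 1 by rewrite ltr_wpDl.
have small eps : 0 < eps -> \forall i \near F, (normN X (U i \- v)%R <= eps%:E)%E.
  move=> e0; have d0 := divr_gt0 e0 cst1.
  apply: filterS2 CU (cl _ d0) => i CUi cli; apply: le_trans (normN_le (ltW d0) _) _.
    exact/derivs_closeE.
  have h : normN_cst R d / (normN_cst R d + 1) <= 1 by rewrite ler_pdivrMr// mul1r lerDl.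
  by rewrite lee_fin mulrCA; apply: ler_piMr => //; exact: ltW.
have N0 i : (0 <= normN X (U i \- v)%R)%E by exact: normN_ge0.
apply/fine_cvgP; split.
  by apply: filterS (small 1 ltr01) => i hi; rewrite ge0_fin_numE// (le_lt_trans hi)// ltry.
apply/cvgrPdist_le => eps e0; apply: filterS (small _ e0) => i hi /=.
have fi : normN X (U i \- v) \is a fin_num by rewrite ge0_fin_numE// (le_lt_trans hi)// ltry.
by rewrite sub0r normrN ger0_norm ?fine_ge0// -lee_fin fineK.
Qed.

Theorem theorem4p5 (R : realType) (T p : R) (d e : nat)
  (T_gt0 : 0 < T) (p_gt1 : 1 < p)
  (* the compact domain *)
  (X : set (ospace T p d e)) (r : R)
  (X_Omega : X `<=` @Omega R T d e) (X_compact : compact X) (r_gt0 : 0 < r)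
  (X_bounded : forall w : ppoint R d e, X w ->
     (pvar_norm 1 0 T (ppath w) <= r%:E)%E)
  (* the kernels *)
  (k : 'rV[R]_(1 + d) -> 'rV[R]_(1 + d) -> R) (Hk : rkhs k)
  (l : 'rV[R]_e.+1 -> 'rV[R]_e.+1 -> R) (Hl : rkhs l)
  (g : 'rV[R]_e.+1 -> 'rV[R]_e.+1 -> R) (Hg : rkhs g)
  (TV : rkhs (tensor_kernel g))
  (k_universal : cc_universal Hk) (l_universal : cc_universal Hl)
  (g_kernel : is_kernel g) (g_lipschitz : lipschitz_feature Hg)
  (g_G : assumption_G g) (k_F : assumption_F Hk) (l_F : assumption_F Hl)
  (H : rkhs (restricted_kernel (X := X) (kappa T k l TV)))
  (* the target equation *)
  (a : forall n : midx, (ord_x n).-tuple 'I_d -> R)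
  (eta : forall n : midx, (ord_g n).-tuple (path_type R e))
  (eta_BV0 : forall n i, in_N n -> BV0 T (tnth (eta n) i))
  (f phi : ppoint R d e -> R)
  (f_borel : borel_on X f) (phi_borel : borel_on X phi)
  (* the collocation points and the solutions of the optimal recovery problems *)
  (wint wter : nat -> nat -> nat -> ppoint R d e)
  (wint_in : forall m n i, (0 < m)%N -> (0 < n)%N -> (i < m)%N ->
     before_T X (wint m n i))
  (wter_in : forall m n j, (0 < m)%N -> (0 < n)%N -> (j < n)%N ->
     at_T X (wter m n j))
  (u : nat -> nat -> {w : ppoint R d e | X w} -> R)
  (u_optimal : forall m n, (0 < m)%N -> (0 < n)%N ->
     optimal_recovery H a eta f phi m n (wint m n) (wter m n) (u m n))
  (ustar : ppoint R d e -> R) :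
  (* (i) *)
  ([/\ forall m n, (0 < m)%N -> (0 < n)%N -> in_CN X (extension H (u m n)),
       precompact [set v : CN_space X | exists m n,
         [/\ (0 < m)%N, (0 < n)%N & sval v = extension H (u m n)]],
       in_CN X ustar,
       solves_ppde X a eta f phi ustar &
       forall v, in_CN X v -> solves_ppde X a eta f phi v ->
         normN X (v \- ustar) = 0%E]
   \/
   (* (ii) *)
   exists2 h, carrier H h /\ ustar = extension H h &
     solves_ppde X a eta f phi (extension H h) /\
     forall h', carrier H h' -> solves_ppde X a eta f phi (extension H h') ->
       h' = h) ->
  asymptotically_dense (before_T X) fst wint ->
  asymptotically_dense (at_T X) snd wter ->
  [/\ in_CN X ustar,
      forall m n, (0 < m)%N -> (0 < n)%N -> in_CN X (extension H (u m n)) &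
      (fun mn : nat * nat =>
         normN X (extension H (u mn.1 mn.2) \- ustar)) @ filter_prod \oo \oo
        --> 0%E].
Proof.
move=> cases dint dter.
have [Ck k_smooth] := assumption_F_diff_bounded k_F.
have [Cl l_smooth] := assumption_F_diff_bounded l_F.
have [Cg [Cg0 g_smooth]] := assumption_G_diff_bounded Hg g_G.
have X0 : exists w, X w by have [Xw _] := wint_in 1 1 0 isT isT isT; exists (wint 1 1 0)%N.
have path0 : exists gam : path_type R e, BV0 T gam /\ (pvar_norm 1 0 T gam <= 1)%E.
  (* A unit direction is obtained by rescaling the direction of the first-order pathwise derivative
     in the equation. *)
  pose n1 : midx := (ord0, ord0, Ordinal (isT : (1 < 3)%N)).
  have [N _ [etas ue _]] := unit_scale T_gt0 (fun i => eta_BV0 n1 i isT).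
  by exists (tnth etas ord0); exact: (ue ord0).
have ext_CN h : carrier H h -> in_CN X (extension H h).
  exact: (extension_in_CN T_gt0 p_gt1 X_Omega X_bounded Hk Hl Hg Cg0 k_smooth l_smooth g_smooth).
have u_CN m n : (0 < m)%N -> (0 < n)%N -> in_CN X (extension H (u m n)).
  by move=> m0 n0; have [[Cu _ _] _] := u_optimal m n m0 n0; exact: ext_CN.
have pos : \forall mn \near filter_prod \oo \oo, (0 < mn.1)%N /\ (0 < mn.2)%N.
  exists ([set m | (0 < m)%N], [set n | (0 < n)%N]); last by move=> [].
  by split; exists 1%N.
have [Cs cl] : in_CN X ustar /\ forall delta, 0 < delta -> \forall mn \near filter_prod \oo \oo,
    (0 < mn.1)%N -> (0 < mn.2)%N -> derivs_close X delta (extension H (u mn.1 mn.2)) ustar.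
  case: cases => [[_ pc Cs ss uniq]|[h [Ch ->] [sh uniq]]].
    split=> //; apply: (compact_convergence T_gt0 eta_BV0 X0 path0 Cs ss uniq pc dint dter).
    move=> m n m0 n0; have [[Cu f1 f2] _] := u_optimal m n m0 n0; split; first exact: u_CN.
      by move=> i im; split; [exact: wint_in|exact: f1].
    by move=> j jn; split; [exact: wter_in|exact: f2].
  split; first exact: ext_CN.
  exact: (hilbert_convergence T_gt0 p_gt1 X_Omega X_bounded Hk Hl Hg Cg0 k_smooth l_smooth
    g_smooth eta_BV0 wint_in wter_in u_optimal dint dter Ch sh uniq).
split=> //; apply: normN_cvg0 => //; first by apply: filterS pos => mn [m0 n0]; exact: u_CN.
by move=> delta d0; apply: filterS2 pos (cl _ d0) => mn [m0 n0]; exact.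
Qed.
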